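(* Let $m,d\in\mathbb{N}$, $q\in\mathbb{N}_0$, and let $(Z_t)_{t\in\mathbb{Z}}$ be an i.i.d. sequence of $\mathbb{C}^d$-valued random vectors. Let $\Psi_1\in\mathbb{C}^{m\times m}$ and $\Theta_0,\ldots,\Theta_q\in\mathbb{C}^{m\times d}$. Let $S\in\mathbb{C}^{m\times m}$ be an invertible matrix such that $S^{-1}\Psi_1S$ is in Jordan block form, with $H$ Jordan blocks $\Phi_h$ and associated eigenvalues $\lambda_h$, $h\in\{1,\ldots,H\}$, and let $r_1,\ldots,r_{H+1}$ and $I_h$ be as defined in the context. Then the ARMA$(1,q)$ equation $$Y_t-\Psi_1Y_{t-1}=\sum_{k=0}^q\Theta_kZ_{t-k},\quad t\in\mathbb{Z},\qquad( * )$$ has a strictly stationary solution $Y$ if and only if the following statements (i)--(iii) hold: (i) For every $h\in\{1,\ldots,H\}$ such that $|\lambda_h|\neq0,1$, $$\mathbb{E}\log^+\left\|\left(\sum_{k=0}^q\Phi_h^{q-k}I_hS^{-1}\Theta_k\right)Z_0\right\|<\infty.$$ (ii) For every $h\in\{1,\ldots,H\}$ such that $|\lambda_h|=1$ but $\lambda_h\neq1$, there exists a constant $\alpha_h\in\mathbb{C}^{r_{h+1}-r_h}$ such that $$\left(\sum_{k=0}^q\Phi_h^{q-k}I_hS^{-1}\Theta_k\right)Z_0=\alpha_h\quad\text{a.s.}\qquad( ** )$$ (iii) For every $h\in\{1,\ldots,H\}$ such that $\lambda_h=1$, there exists a constant $\alpha_h=(\alpha_{h,1},\ldots,\alpha_{h,r_{h+1}-r_h})^T\in\mathbb{C}^{r_{h+1}-r_h}$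 such that $\alpha_{h,1}=0$ and $( ** )$ holds. If these conditions are satisfied, then a strictly stationary solution of $( * )$ is given by $Y_t:=S(X_t^{(1)T},\ldots,X_t^{(H)T})^T$, $t\in\mathbb{Z}$, with $$X_t^{(h)}:=\begin{cases}\sum_{j=0}^{\infty}\Phi_h^{j-q}\left(\sum_{k=0}^{j\wedge q}\Phi_h^{q-k}I_hS^{-1}\Theta_k\right)Z_{t-j},&|\lambda_h|\in(0,1),\\[1ex]-\sum_{j=1-q}^{\infty}\Phi_h^{-j-q}\left(\sum_{k=(1-j)\vee0}^{q}\Phi_h^{q-k}I_hS^{-1}\Theta_k\right)Z_{t+j},&|\lambda_h|>1,\\[1ex]\sum_{j=0}^{m+q-1}\left(\sum_{k=0}^{j\wedge q}\Phi_h^{j-k}I_hS^{-1}\Theta_k\right)Z_{t-j},&\lambda_h=0,\\[1ex]f_h+\sum_{j=0}^{q-1}\left(\sum_{k=0}^{j}\Phi_h^{j-k}I_hS^{-1}\Theta_k\right)Z_{t-j},&|\lambda_h|=1,\end{cases}$$ where $f_h\in\mathbb{C}^{r_{h+1}-r_h}$ is a solution to $$(\mathrm{Id}_h-\Phi_h)f_h=\alpha_h,$$ which exists for $\lambda_h=1$ by (iii) and, for $|\lambda_h|=1$, $\lambda_h\neq1$, by the invertibility of $\mathrm{Id}_h-\Phi_h$. The series defining $X_t^{(h)}$ converge almost surely absolutely. If the necessary and sufficient conditions (i)--(iii) are satisfied, then, provided the underlying probability space is rich enough to support a random variable which is uniformly distributed on $[0,1)$ and independent of $(Z_t)_{t\in\mathbb{Z}}$,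 the solution $Y$ given above is the unique strictly stationary solution of $( * )$ if and only if $|\lambda_h|\neq1$ for all $h\in\{1,\ldots,H\}$.
   Context: $\mathbb{N}=\{1,2,\ldots\}$, $\mathbb{N}_0=\mathbb{N}\cup\{0\}$; $a\wedge b=\min(a,b)$, $a\vee b=\max(a,b)$; $\log^+(x)=\log\max\{1,x\}$; $\|\cdot\|$ is a fixed vector norm on $\mathbb{C}^s$ (for each $s$). Vectors are column vectors. Empty sums are $0$. A solution of $( * )$ is any $\mathbb{C}^m$-valued process $(Y_t)_{t\in\mathbb{Z}}$, defined on the same probability space as $(Z_t)_{t\in\mathbb{Z}}$, satisfying $( * )$ almost surely. A process is strictly stationary if all its finite dimensional distributions are shift invariant. Uniqueness is understood up to almost sure equality. Jordan form conventions: a Jordan block with eigenvalue $\lambda$ is a square matrix with $\lambda$ on the diagonal, entries $1$ directly below the main diagonal, and $0$ elsewhere. $S^{-1}\Psi_1S$ is block diagonal with Jordan blocks $\Phi_1,\ldots,\Phi_H$, the $h$-th block $\Phi_h$ beginning in row $r_h$, where $r_1:=1<r_2<\cdots<r_H<m+1=:r_{H+1}$; $\lambda_h$ is the eigenvalue of $\Phi_h$. $I_h$ is the $(r_{h+1}-r_h)\times m$ matrix with $(i,j)$ entry $1$ if $j=i+r_h-1$ and $0$ otherwise. $\mathrm{Id}_h$ denotes the identity matrix of size $(r_{h+1}-r_h)\times(r_{h+1}-r_h)$. *)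

(* Defs.v *)
From HB Require Import structures.
From mathcomp Require Import all_boot all_order all_algebra.
From mathcomp Require Import all_classical all_reals all_analysis.
From mathcomp Require Import complex.

Set Implicit Arguments.
Unset Strict Implicit.
Unset Printing Implicit Defensive.

Import Order.TTheory GRing.Theory Num.Theory numFieldNormedType.Exports.

Local Open Scope classical_set_scope.
Local Open Scope ring_scope.
Local Open Scope complex_scope.

(** ** Borel sigma-algebras on C and on spaces of complex matrices *)

(* The Borel sets of C = R^2 are those generated by the real and imaginary
   parts. *)
Section borel_complex.
Context {R : realType}.

HB.instance Definition _ := isPointed.Build R[i] 0.

Definition complex_borel : set (set R[i]) :=
  g_sigma_preimageU (@complex.Re R) (@complex.Im R).

Let complex_borel0 : complex_borel set0.
Proof. exact: sigma_algebra0. Qed.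

Let complex_borelC A : complex_borel A -> complex_borel (~` A).
Proof. exact: sigma_algebraC. Qed.

Let complex_borel_bigcup (F : (set R[i])^nat) :
  (forall i, complex_borel (F i)) -> complex_borel (\bigcup_i F i).
Proof. exact: sigma_algebra_bigcup. Qed.

HB.instance Definition _ := @isMeasurable.Build default_measure_display R[i]
  complex_borel complex_borel0 complex_borelC complex_borel_bigcup.

End borel_complex.

(* The product sigma-algebra, generated by the entries. *)
Section measurable_matrix.
Context {d : measure_display} {T : measurableType d}.
Variables m n : nat.

Definition mx_sigma_algebra : set (set 'M[T]_(m, n)) :=
  <<s \bigcup_(ij in [set: 'I_m * 'I_n])
        preimage_set_system setT (fun A : 'M[T]_(m, n) => A ij.1 ij.2)
                            measurable >>.

Let mx_sigma_algebra0 : mx_sigma_algebra set0.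
Proof. exact: sigma_algebra0. Qed.

Let mx_sigma_algebraC A : mx_sigma_algebra A -> mx_sigma_algebra (~` A).
Proof. exact: sigma_algebraC. Qed.

Let mx_sigma_algebra_bigcup (F : (set 'M[T]_(m, n))^nat) :
  (forall i, mx_sigma_algebra (F i)) -> mx_sigma_algebra (\bigcup_i F i).
Proof. exact: sigma_algebra_bigcup. Qed.

HB.instance Definition _ :=
  @isMeasurable.Build (measure_tuple_display d) 'M[T]_(m, n)
    mx_sigma_algebra mx_sigma_algebra0 mx_sigma_algebraC
    mx_sigma_algebra_bigcup.

End measurable_matrix.

(** ** Families of random variables *)

Section families.
Context {R : realType} {dO : measure_display} {Omega : measurableType dO}.
Variable P : probability Omega R.
Context {dE : measure_display} {E : measurableType dE}.

Definition mutually_independent {I : choiceType} (X : I -> Omega -> E) : Prop :=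
  forall (s : seq I) (A : I -> set E), uniq s ->
    (forall i, measurable (A i)) ->
    P (\big[setI/setT]_(i <- s) (X i @^-1` A i))
    = (\prod_(i <- s) P (X i @^-1` A i))%E.

Definition identically_distributed {I : Type} (X : I -> Omega -> E) : Prop :=
  forall (i j : I) (A : set E), measurable A ->
    P (X i @^-1` A) = P (X j @^-1` A).

Definition iid {I : choiceType} (X : I -> Omega -> E) : Prop :=
  [/\ forall i, measurable_fun setT (X i),
      mutually_independent X & identically_distributed X].

Definition generated_sigma_algebra {I : Type} (X : I -> Omega -> E) :
    set (set Omega) :=
  <<s \bigcup_i preimage_set_system setT (X i) measurable >>.

Definition strictly_stationary (Y : int -> Omega -> E) : Prop :=
  forall (n : nat) (t : n.-tuple int) (s : int) (B : set (n.-tuple E)),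
    measurable B ->
    P [set w | B [tuple Y (tnth t i + s) w | i < n]]
    = P [set w | B [tuple Y (tnth t i) w | i < n]].

Definition uniform01 (U : Omega -> R) : Prop :=
  measurable_fun setT U /\
  forall A : set R, measurable A ->
    P (U @^-1` A) = lebesgue_measure (A `&` `[0, 1[%classic).

Definition rich_enough {I : Type} (X : I -> Omega -> E) : Prop :=
  exists U : Omega -> R, uniform01 U /\
    forall (A : set R) (F : set Omega),
      measurable A -> generated_sigma_algebra X F ->
      P (U @^-1` A `&` F) = (P (U @^-1` A) * P F)%E.

End families.

Section vectors.
Context {R : realType}.
Local Notation C := R[i].

Definition vector_norm (s : nat) (N : 'cV[C]_s -> R) : Prop :=
  [/\ forall v, N v = 0 -> v = 0,
      forall u v, N (u + v) <= N u + N v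
    & forall (a : C) v, N (a *: v) = Normc.normc a * N v].

Definition log_plus (x : R) : R := ln (Num.max 1 x).

(* Sum of a series in C^s, computed on real and imaginary parts of the
   coordinates; a divergent real series gets the default value of [limn]. *)
Definition vseries (s : nat) (u : nat -> 'cV[C]_s) : 'cV[C]_s :=
  \col_i (limn (series (fun j => complex.Re (u j i 0)))
          +i* limn (series (fun j => complex.Im (u j i 0)))).

Definition mxpowz (n : nat) (A : 'M[C]_n) (z : int) : 'M[C]_n :=
  match z with
  | Posz k => A ^+ k
  | Negz k => invmx A ^+ k.+1
  end.

(* The 1s are below the diagonal. *)
Definition jordan_block (n : nat) (lambda : C) : 'M[C]_n :=
  \matrix_(i, j) (lambda *+ (i == j) + (i == j.+1 :> nat)%:R).

End vectors.

(** ** The ARMA(1,q) equation *)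

(* Indices are 0-based: block [h] (for [h < H]) occupies the rows
   [r h, ..., r h.+1 - 1], with [r 0 = 0] and [r H = m]. *)
Section arma.
Context {R : realType}.
Local Notation C := R[i].
Variables (m d q H : nat).

Definition is_block_partition (r : nat -> nat) : Prop :=
  [/\ r 0 = 0, forall h : 'I_H, (r h < r h.+1)%N & r H = m]%N.

Definition bsize (r : nat -> nat) (h : nat) : nat := (r h.+1 - r h)%N.

Definition block_sel (r : nat -> nat) (h : nat) : 'M[C]_(bsize r h, m) :=
  \matrix_(i, j) (j == i + r h :> nat)%N%:R.

Definition Phi (r : nat -> nat) (lambda : 'I_H -> C) (h : 'I_H) :
    'M[C]_(bsize r h) :=
  jordan_block (bsize r h) (lambda h).

(* [(block_sel r h)^T *m A *m block_sel r h] places [A] as the [h]-th diagonal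
   block of an [m x m] matrix that is zero elsewhere. *)
Definition jordan_form (r : nat -> nat) (lambda : 'I_H -> C) : 'M[C]_m :=
  \sum_(h < H) (block_sel r h)^T *m Phi r lambda h *m block_sel r h.

Definition stack (r : nat -> nat) (x : forall h : 'I_H, 'cV[C]_(bsize r h)) :
    'cV[C]_m :=
  \sum_(h < H) (block_sel r h)^T *m x h.

Section solutions.
Context {dO : measure_display} {Omega : measurableType dO}.
Variable P : probability Omega R.
Variables (Psi1 : 'M[C]_m) (Theta : 'I_q.+1 -> 'M[C]_(m, d)).
Variable Z : int -> Omega -> 'cV[C]_d.

Definition is_solution (Y : int -> Omega -> 'cV[C]_m) : Prop :=
  (forall t, measurable_fun setT (Y t)) /\
  forall t : int, {ae P, forall w,
    Y t w - Psi1 *m Y (t - 1) w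
    = \sum_(k < q.+1) Theta k *m Z (t - (k : nat)%:Z) w}.

Variables (S : 'M[C]_m) (r : nat -> nat) (lambda : 'I_H -> C).

Local Notation Phi := (Phi r lambda).
Local Notation ISTheta h k := (block_sel r h *m invmx S *m Theta k).

Definition block_noise_coef (h : 'I_H) : 'M[C]_(bsize r h, d) :=
  \sum_(k < q.+1) Phi h ^+ (q - k) *m ISTheta h k.

Definition block_noise_const (h : 'I_H) (alpha : 'cV[C]_(bsize r h)) : Prop :=
  {ae P, forall w, block_noise_coef h *m Z 0 w = alpha}.

Definition first_coord_zero (s : nat) (a : 'cV[C]_s) : Prop :=
  forall i : 'I_s, i = 0%N :> nat -> a i 0 = 0.

Definition cond_i (nrm : forall s, 'cV[C]_s -> R) : Prop :=
  forall h : 'I_H, `|lambda h| != 0 -> `|lambda h| != 1 ->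
    ('E_P[fun w => log_plus (nrm _ (block_noise_coef h *m Z 0 w)%R)] < +oo)%E.

Definition cond_ii : Prop :=
  forall h : 'I_H, `|lambda h| = 1 -> lambda h <> 1 ->
    exists alpha : 'cV[C]_(bsize r h), block_noise_const alpha.

Definition cond_iii : Prop :=
  forall h : 'I_H, lambda h = 1 ->
    exists alpha : 'cV[C]_(bsize r h),
      first_coord_zero alpha /\ block_noise_const alpha.

(* [alpha h] is one of the constants provided by [cond_ii] or [cond_iii]; only
   the blocks with eigenvalue of modulus one matter. *)
Definition noise_constants (alpha : forall h : 'I_H, 'cV[C]_(bsize r h)) :
    Prop :=
  forall h : 'I_H, `|lambda h| = 1 ->
    block_noise_const (alpha h) /\
    (lambda h = 1 -> first_coord_zero (alpha h)).

(* j-th term of the series for 0 < |lambda_h| < 1 *)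
Definition inner_term (h : 'I_H) (t : int) (w : Omega) (j : nat) :
    'cV[C]_(bsize r h) :=
  mxpowz (Phi h) (j%:Z - q%:Z)
  *m (\sum_(k < q.+1 | (k <= j)%N) Phi h ^+ (q - k) *m ISTheta h k)
  *m Z (t - j%:Z) w.

(* term of index j = 1 - q + i of the series for |lambda_h| > 1 *)
Definition outer_term (h : 'I_H) (t : int) (w : Omega) (i : nat) :
    'cV[C]_(bsize r h) :=
  let j : int := 1 - q%:Z + i%:Z in
  mxpowz (Phi h) (- j - q%:Z)
  *m (\sum_(k < q.+1 | 1 - j <= (k : nat)%:Z)
        Phi h ^+ (q - k) *m ISTheta h k)
  *m Z (t + j) w.

Definition fin_coef (h : 'I_H) (j : nat) : 'M[C]_(bsize r h, d) :=
  \sum_(k < q.+1 | (k <= j)%N) Phi h ^+ (j - k) *m ISTheta h k.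

Definition block_solution (f : forall h : 'I_H, 'cV[C]_(bsize r h))
    (h : 'I_H) (t : int) (w : Omega) : 'cV[C]_(bsize r h) :=
  if lambda h == 0 then
    \sum_(0 <= j < m + q) fin_coef h j *m Z (t - j%:Z) w
  else if `|lambda h| < 1 then vseries (inner_term h t w)
  else if `|lambda h| == 1 then
    f h + \sum_(0 <= j < q) fin_coef h j *m Z (t - j%:Z) w
  else - vseries (outer_term h t w).

Definition explicit_solution (f : forall h : 'I_H, 'cV[C]_(bsize r h))
    (t : int) (w : Omega) : 'cV[C]_m :=
  S *m stack (fun h => block_solution f h t w).

Definition series_converge_absolutely (nrm : forall s, 'cV[C]_s -> R) : Prop :=
  forall (h : 'I_H) (t : int),
    (0 < `|lambda h| < 1 -> {ae P, forall w,
       (\sum_(0 <= j <oo) (nrm _ (inner_term h t w j))%:E < +oo)%E}) /\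
    (1 < `|lambda h| -> {ae P, forall w,
       (\sum_(0 <= j <oo) (nrm _ (outer_term h t w j))%:E < +oo)%E}).

(* [f] solves (Id_h - Phi_h) f_h = alpha_h for the blocks with |lambda_h| = 1 *)
Definition solves_shift (alpha f : forall h : 'I_H, 'cV[C]_(bsize r h)) :
    Prop :=
  forall h : 'I_H, `|lambda h| = 1 -> (1%:M - Phi h) *m f h = alpha h.

End solutions.
End arma.

(* Main.v *)
Require Import Defs.
From HB Require Import structures.
From mathcomp Require Import all_boot all_order all_algebra.
From mathcomp Require Import all_classical all_reals all_analysis.
From mathcomp Require Import measurable_realfun.
From mathcomp Require Import complex ring lra zify.

Import Order.TTheory GRing.Theory Num.Theory numFieldNormedType.Exports.

Local Open Scope classical_set_scope.
Local Open Scope ring_scope.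
Local Open Scope complex_scope.

(** In the coordinates given by [S], the equation splits into one equation
    [X t - Phi X (t - 1) = noise t] per Jordan block [Phi] with eigenvalue [l].
    Subtracting from [X] a finite moving average of the noise ([reduced_rec])
    leaves [X' t - Phi X' (t - 1) = N Z (t - q)], where
    [N = \sum_k Phi ^ (q - k) I S^-1 Theta_k] is the matrix in the conditions.

    Sufficiency. When [0 < |l| < 1], or [|l| > 1], the equation is solved by
    iterating backwards, or forwards, in time. In a weighted norm the powers of
    [Phi], respectively of its inverse, are bounded above and below by geometric
    sequences ([contracting]). By the Borel-Cantelli lemma a finite logarithmic
    moment of [N Z 0] keeps the noise below a slowly growing geometric sequence,
    so that the series converge absolutely ([contracting_series_ae]). When
    [l = 0] the block is nilpotent. When [|l| = 1] the vectors [N Z t] are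
    constant and a fixed point of [x |-> Phi x + alpha] does the job. The
    solution is a measurable function of the path of the noise that commutes with
    shifts, hence strictly stationary ([strictly_stationary_factor]).

    Necessity. Stationarity is used only through tightness of [X']. Suitable
    combinations of values of [X'] are tight in [n] and contain the sum of the
    [n] independent vectors [M ^ i N Z (tau i)], [i < n], with [M = Phi] or its
    inverse: [X' 0 - Phi ^ n X' (- n)] when [|l| < 1], the analogous difference
    forwards in time when [|l| > 1], and iterated differences with lag [n] when
    [|l| = 1], which annihilate the term in [Phi ^ n] because [Phi ^ n - l ^ n]
    is nilpotent ([iter_diffE]). Their characteristic functions are bounded away
    from zero near the origin, uniformly in [n], so that with
    [W = N (Z 0 - Z 1)] the sums over [i < n] of [E (1 - cos Re (u M ^ i W))] are
    bounded for small [u] ([tight_sum_cf]). When [|l| = 1], the first component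
    of [W] that does not vanish would make every term of this sum larger than a
    positive constant; hence [W = 0] and [N Z 0] is constant
    ([unit_modulus_ae_cst]). When [l = 1] the first entry of this constant
    vanishes, since the first coordinate of [X'] would otherwise drift linearly.
    When [|l|] is neither [0] nor [1], averaging over [u] turns the bound into
    [\sum_i P (|M ^ i N Z 0| > K) < oo] ([contracting_sum_proba]), and as the
    powers of [M] decay at most geometrically this is a logarithmic moment
    ([log_plus_expectation_lty]).

    Uniqueness. The difference of two stationary solutions is tight and solves
    the homogeneous equation. If no eigenvalue has modulus one, it vanishes,
    being the image of a tight family under powers of a contraction
    ([tight_contracting_eq0]). If [|l| = 1], let [v] be an eigenvector for [l]
    and [V] uniform on the unit circle and independent of the noise: adding
    [l ^ t V v] to a stationary solution gives another one, because the law of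
    [V] is invariant under rotations ([circle_rotation_invariant]). *)

Set Implicit Arguments.
Unset Strict Implicit.
Unset Printing Implicit Defensive.

(** * Norms on complex column vectors and Jordan blocks *)

Section complex_modulus.
Context {R : realType}.
Local Notation C := R[i].
Local Notation normc := Normc.normc.

Lemma normc_ge0 (z : C) : 0 <= normc z.
Proof. by case: z => a b /=; rewrite sqrtr_ge0. Qed.

Lemma normcE' (z : C) : `|z| = (normc z)%:C.
Proof. by case: z. Qed.

Lemma normc_real (x : R) : normc x%:C = `|x|.
Proof. by rewrite /= expr0n /= addr0 sqrtr_sqr. Qed.

Lemma normcX (z : C) n : normc (z ^+ n) = normc z ^+ n.
Proof.
elim: n => [|n IH]; first by rewrite !expr0 Normc.normc1.
by rewrite !exprS Normc.normcM IH.
Qed.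

Lemma Re_le_normc (z : C) : `|complex.Re z| <= normc z.
Proof.
case: z => a b /=; rewrite -sqrtr_sqr ler_wsqrtr//.
by rewrite lerDl sqr_ge0.
Qed.

Lemma Im_le_normc (z : C) : `|complex.Im z| <= normc z.
Proof.
case: z => a b /=; rewrite -sqrtr_sqr ler_wsqrtr//.
by rewrite lerDr sqr_ge0.
Qed.

Lemma normc_sqr (z : C) : normc z ^+ 2 = complex.Re z ^+ 2 + complex.Im z ^+ 2.
Proof. by case: z => a b /=; rewrite sqr_sqrtr// addr_ge0// sqr_ge0. Qed.

Lemma normc_le_ReIm (z : C) : normc z <= `|complex.Re z| + `|complex.Im z|.
Proof.
rewrite -(@ler_pXn2r _ 2) ?nnegrE ?normc_ge0 ?addr_ge0//.
rewrite normc_sqr sqrrD !real_normK ?num_real// lerD2r lerDl.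
by rewrite mulrn_wge0// mulr_ge0.
Qed.

End complex_modulus.

Section weighted_norm.
Context {R : realType}.
Local Notation C := R[i].
Local Notation normc := Normc.normc.

(** The geometric weights let multiplication by a Jordan block be as close to
    multiplication by its eigenvalue as needed: the shift part of the block
    costs only a factor [e]. *)
Definition wnorm (e : R) s (v : 'cV[C]_s) : R :=
  \sum_(i < s) e ^+ i * normc (v i 0).

Lemma wnorm_ge0 e s (v : 'cV[C]_s) : 0 <= e -> 0 <= wnorm e v.
Proof. by move=> e0; apply: sumr_ge0 => i _; rewrite mulr_ge0 ?normc_ge0 ?exprn_ge0. Qed.

Lemma wnormZ e s (a : C) (v : 'cV[C]_s) : wnorm e (a *: v) = normc a * wnorm e v.
Proof.
rewrite /wnorm mulr_sumr; apply: eq_bigr => i _.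
by rewrite mxE Normc.normcM mulrCA.
Qed.

Lemma wnormD e s (u v : 'cV[C]_s) :
  0 <= e -> wnorm e (u + v) <= wnorm e u + wnorm e v.
Proof.
move=> e0; rewrite /wnorm -big_split/=; apply: ler_sum => i _.
by rewrite -mulrDr ler_wpM2l ?exprn_ge0// mxE le_normcD.
Qed.

Lemma wnorm_vector_norm e s : 0 < e -> vector_norm (@wnorm e s).
Proof.
move=> e0; split; [|by move=> u v; apply/wnormD/ltW|exact: wnormZ].
move=> v /eqP; rewrite psumr_eq0; last first.
  by move=> i _; rewrite mulr_ge0 ?normc_ge0 ?exprn_ge0 ?ltW.
move=> /allP v0; apply/colP => i; rewrite mxE; apply: Normc.eq0_normc.
have := v0 i (mem_index_enum _); rewrite /= mulf_eq0 expf_eq0 (gt_eqF e0) andbF/=.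
by move/eqP.
Qed.

Lemma vector_norm0 s (N : 'cV[C]_s -> R) : vector_norm N -> N 0 = 0.
Proof. by case=> _ _ NZ; rewrite -(scale0r (0 : 'cV[C]_s)) NZ Normc.normc0 mul0r. Qed.

Lemma vector_normN s (N : 'cV[C]_s -> R) : vector_norm N -> forall v, N (- v) = N v.
Proof. by case=> _ _ NZ v; rewrite -scaleN1r NZ normcN Normc.normc1 mul1r. Qed.

Lemma vector_norm_ge0 s (N : 'cV[C]_s -> R) : vector_norm N -> forall v, 0 <= N v.
Proof.
move=> nN v; have [_ ND _] := nN.
have := ND v (- v); rewrite subrr (vector_norm0 nN) (vector_normN nN).
by rewrite -mulr2n pmulrn_lge0.
Qed.

Lemma vector_norm_sum s (N : 'cV[C]_s -> R) (I : Type) (r : seq I) (F : I -> 'cV[C]_s) :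
  vector_norm N -> N (\sum_(i <- r) F i) <= \sum_(i <- r) N (F i).
Proof.
move=> nN; have [_ ND _] := nN.
elim/big_ind2 : _ => // [|x1 x2 y1 y2 h1 h2]; first by rewrite (vector_norm0 nN).
by rewrite (le_trans (ND _ _))// lerD.
Qed.

Lemma vector_norm_distl s (N : 'cV[C]_s -> R) (u v : 'cV[C]_s) :
  vector_norm N -> `|N u - N v| <= N (u - v).
Proof.
move=> nN; have [_ ND _] := nN; rewrite ler_distlC; apply/andP; split.
  by rewrite lerBlDr (le_trans _ (ND _ _))// addrC subrK.
rewrite -(vector_normN nN (u - v)) opprB.
by rewrite (le_trans _ (ND _ _))// addrC subrK.
Qed.

Lemma vector_norm_le_wnorm1 s (N : 'cV[C]_s -> R) : vector_norm N ->
  exists2 c, 0 < c & forall v, N v <= c * wnorm 1 v.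
Proof.
move=> nN; have [_ ND NZ] := nN.
have N0 := vector_norm_ge0 nN.
exists (1 + \sum_i N (delta_mx i 0)); first by rewrite ltr_pwDl ?sumr_ge0.
move=> v; have {1}-> : v = \sum_i v i 0 *: delta_mx i 0.
  apply/colP => i; rewrite summxE (bigD1 i)//= big1 ?addr0; last first.
    by move=> j ji; rewrite !mxE eq_sym (negPf ji) mulr0.
  by rewrite !mxE eqxx mulr1.
apply: le_trans (vector_norm_sum _ _ nN) _.
rewrite mulr_sumr; apply: ler_sum => i _.
rewrite NZ expr1n mul1r mulrC ler_wpM2r ?normc_ge0//.
rewrite (bigD1 i)//= addrCA lerDl addr_ge0// sumr_ge0//.
Qed.

(** Real coordinates, where the unit sphere of the sup norm is compact and an
    extreme value theorem applies. *)
Definition real_coord s (x : 'rV[R]_(s + s)) : 'cV[C]_s :=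
  \col_i (x 0 (lshift s i) +i* x 0 (rshift s i)).

Lemma wnorm1_real_coord s (x : 'rV[R]_(s + s)) :
  wnorm 1 (real_coord x) <= (s%:R *+ 2) * `|x|.
Proof.
rewrite /wnorm mulrnAl -mulrnAr.
have -> : s%:R * (`|x| *+ 2) = \sum_(i < s) (`|x| *+ 2) by rewrite sumr_const card_ord mulr_natl.
have xle j : `|x 0 j| <= `|x|.
  rewrite [leRHS]/Num.norm /= mx_normrE; apply/bigmax_geP; right => /=.
  by exists (0, j).
apply: ler_sum => i _; rewrite expr1n mul1r mxE.
by rewrite (le_trans (normc_le_ReIm _))//= mulr2n lerD.
Qed.

Lemma real_coordB s (x y : 'rV[R]_(s + s)) :
  real_coord (x - y) = real_coord x - real_coord y.
Proof. by apply/colP => i; rewrite !mxE. Qed.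

Lemma real_coordZ s (a : R) (x : 'rV[R]_(s + s)) :
  real_coord (a *: x) = a%:C *: real_coord x.
Proof. by apply/colP => i; rewrite !mxE; simpc. Qed.

Lemma real_coord_eq0 s (x : 'rV[R]_(s + s)) : real_coord x = 0 -> x = 0.
Proof.
move=> /colP x0; apply/rowP => j; rewrite mxE -(splitK j).
by case: (fintype.split j) => k /=; have := x0 k; rewrite !mxE => -[].
Qed.

Lemma real_coord_surj s (v : 'cV[C]_s) : exists x, v = real_coord x.
Proof.
exists (\row_j match fintype.split j with
  inl k => complex.Re (v k 0) | inr k => complex.Im (v k 0) end).
by apply/colP => i; rewrite !mxE (unsplitK (inl i)) (unsplitK (inr i)); case: (v i 0).
Qed.

(** A norm is bounded below on the sphere of the sup norm by compactness. *)
Lemma wnorm1_le_vector_norm s (N : 'cV[C]_s -> R) : vector_norm N ->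
  exists2 c, 0 < c & forall v, wnorm 1 v <= c * N v.
Proof.
move=> nN; have [N0 ND NZ] := nN; have Nge0 := vector_norm_ge0 nN.
have [c c0 Nc] := vector_norm_le_wnorm1 nN.
pose g (x : 'rV[R]_(s + s)) := N (real_coord x).
pose A : set 'rV[R]_(s + s) := [set x | `|x| = 1].
have [A0|/set0P An0] := eqVneq A set0.
  exists 1 => // v; rewrite mul1r.
  have [x ->] := real_coord_surj v.
  have [->|x0] := eqVneq x 0.
    have -> : real_coord (0 : 'rV[R]_(s + s)) = 0 by apply/colP => i; rewrite !mxE.
    by rewrite (vector_norm0 nN) (vector_norm0 (wnorm_vector_norm _ _)).
  have : A (`|x|^-1 *: x).
    by rewrite /A/= normrZ normrV ?unitfE ?normr_eq0// normr_id mulVf ?normr_eq0.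
  by rewrite A0.
have cA : compact A.
  apply: bounded_closed_compact.
    exists 1; split => // M M1 x /= ->; exact: ltW.
  rewrite (_ : A = Num.norm @^-1` [set 1])//; apply: closed_comp => //.
  move=> x _; exact: norm_continuous.
have cg : continuous g.
  move=> x; apply/(@cvgrPdist_lt _ _ _ (nbhs x) (nbhs_filter x)) => e e0.
  pose K := c * (s%:R *+ 2) + 1.
  have K0 : 0 < K by rewrite ltr_wpDl// mulr_ge0 ?(ltW c0)// mulrn_wge0.
  near=> y.
  apply: le_lt_trans (vector_norm_distl _ _ nN) _.
  rewrite -real_coordB.
  apply: le_lt_trans (Nc _) _.
  apply: (@le_lt_trans _ _ (K * `|x - y|)).
    apply: (@le_trans _ _ (c * ((s%:R *+ 2) * `|x - y|))).
      by apply: ler_wpM2l; [exact: ltW|exact: wnorm1_real_coord].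
    by rewrite mulrA ler_wpM2r// lerDl.
  rewrite -ltr_pdivlMl// mulrC.
  near: y; apply: (@cvgr_dist_lt _ _ _ _ _ id); first exact: cvg_id.
  by rewrite divr_gt0.
have [x /set_mem Ax xmin] := EVT_min_rV An0 cA (continuous_subspaceT cg).
have gx0 : 0 < g x.
  rewrite lt_neqAle Nge0 andbT eq_sym; apply/negP => /eqP /N0/real_coord_eq0 x0.
  by move: Ax; rewrite /A/= x0 normr0 => /esym/eqP; rewrite oner_eq0.
exists ((s%:R *+ 2 + 1) / g x).
  by rewrite divr_gt0// ltr_wpDl// mulrn_wge0.
move=> v; have [y ->] := real_coord_surj v.
have [->|y0] := eqVneq y 0.
  have -> : real_coord (0 : 'rV[R]_(s + s)) = 0 by apply/colP => i; rewrite !mxE.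
  by rewrite (vector_norm0 nN) (vector_norm0 (wnorm_vector_norm _ _))// mulr0.
have ny0 : 0 < `|y| by rewrite normr_gt0.
apply: le_trans (wnorm1_real_coord _) _.
rewrite -mulrA.
have : g x <= g (`|y|^-1 *: y).
  by apply: xmin; rewrite inE /A/= normrZ normrV ?unitfE ?normr_eq0// normr_id mulVf ?normr_eq0.
rewrite /g real_coordZ NZ normc_real normfV normr_id -/(g y) ler_pdivlMl// => gyy.
have : `|y| <= (g x)^-1 * g y by rewrite ler_pdivlMl// mulrC.
by move=> h; apply: ler_pM => //; rewrite lerDl.
Unshelve. all: by end_near. Qed.

Lemma vector_norm_equiv s (N N' : 'cV[C]_s -> R) : vector_norm N -> vector_norm N' ->
  exists2 c, 0 < c & forall v, N v <= c * N' v.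
Proof.
move=> /vector_norm_le_wnorm1[c c0 cN] /wnorm1_le_vector_norm[c' c'0 cN'].
exists (c * c'); first exact: mulr_gt0.
by move=> v; rewrite (le_trans (cN v))// -mulrA ler_wpM2l// ltW.
Qed.

End weighted_norm.

Section jordan.
Context {R : realType}.
Local Notation C := R[i].
Local Notation normc := Normc.normc.
Variable p : nat.
Implicit Types (l : C) (v : 'cV[C]_p) (A B : 'M[C]_p).

Lemma jordan_blockE l : jordan_block p l = l%:M + jordan_block p 0.
Proof. by apply/matrixP => i j; rewrite !mxE mul0rn add0r. Qed.

Lemma wnorm_jordan0 e v : 0 <= e ->
  wnorm e (jordan_block p 0 *m v) <= e * wnorm e v.
Proof.
move=> e0; rewrite /wnorm.
have ei i : 0 <= e ^+ i by rewrite exprn_ge0.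
pose F (i j : 'I_p) := (e ^+ i * normc (v j 0)) *+ (i == j.+1 :> nat).
apply: (@le_trans _ _ (\sum_(i < p) \sum_(j < p) F i j)).
  apply: ler_sum => i _; rewrite mxE.
  apply: (@le_trans _ _ (e ^+ i * \sum_(j < p) normc (v j 0) *+ (i == j.+1 :> nat))).
    apply: ler_wpM2l => //.
    elim/big_ind2 : _ => [|x1 x2 y1 y2 h1 h2|j _]; first by rewrite Normc.normc0.
      exact: le_trans (le_normcD _ _) (lerD h1 h2).
    rewrite !mxE mul0rn add0r; case: eqP => _; rewrite ?mul1r//.
    by rewrite mul0r Normc.normc0.
  by rewrite mulr_sumr; apply: ler_sum => j _; rewrite /F mulrnAr.
rewrite exchange_big/= mulr_sumr; apply: ler_sum => j _.
rewrite mulrA -exprS /F.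
have [jp|pj] := ltnP j.+1 p.
  rewrite (bigD1 (Ordinal jp))//= eqxx mulr1n big1 ?addr0// => i ij.
  by case: eqP => // ij'; move/eqP: ij; case; exact/val_inj.
rewrite big1 ?mulr_ge0 ?normc_ge0 ?exprn_ge0// => i _.
by rewrite ltn_eqF// (leq_trans (ltn_ord i)).
Qed.

Lemma wnorm_jordan_le e l v : 0 <= e ->
  wnorm e (jordan_block p l *m v) <= (normc l + e) * wnorm e v.
Proof.
move=> e0; rewrite jordan_blockE mulmxDl mul_scalar_mx mulrDl.
by apply: le_trans (wnormD _ _ e0) _; rewrite wnormZ lerD2l wnorm_jordan0.
Qed.

Lemma wnorm_jordan_ge e l v : 0 <= e ->
  (normc l - e) * wnorm e v <= wnorm e (jordan_block p l *m v).
Proof.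
move=> e0; rewrite mulrBl -wnormZ lerBlDr.
have {1}-> : l *: v = jordan_block p l *m v + (- 1) *: (jordan_block p 0 *m v).
  by rewrite jordan_blockE mulmxDl mul_scalar_mx scaleN1r addrK.
apply: le_trans (wnormD _ _ e0) _.
by rewrite lerD2l wnormZ normcN Normc.normc1 mul1r wnorm_jordan0.
Qed.

(** Strict lower triangularity, graded by the distance [k] to the diagonal. *)
Definition lower_band k A := forall i j : 'I_p, (i < j + k)%N -> A i j = 0.

Lemma lower_bandM a b A B :
  lower_band a A -> lower_band b B -> lower_band (a + b) (A *m B).
Proof.
move=> hA hB i j ij; rewrite mxE big1// => k _.
have [ik|ki] := ltnP i (k + a)%N; first by rewrite hA// mul0r.
by rewrite [B k j]hB ?mulr0// -(ltn_add2r a) -addnA (addnC b) (leq_ltn_trans ki).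
Qed.

Lemma lower_bandD a A B : lower_band a A -> lower_band a B -> lower_band a (A + B).
Proof. by move=> hA hB i j ij; rewrite mxE hA// hB// addr0. Qed.

Lemma lower_band_scalar c : lower_band 0 c%:M.
Proof. by move=> i j; rewrite addn0 => ij; rewrite mxE -val_eqE ltn_eqF. Qed.

Lemma lower_bandW a b A : (a <= b)%N -> lower_band b A -> lower_band a A.
Proof. by move=> ab hA i j ij; apply: hA; rewrite (leq_trans ij)// leq_add2l. Qed.

Lemma lower_band_jordan0 : lower_band 1 (jordan_block p (0 : C)).
Proof. by move=> i j; rewrite addn1 => ij; rewrite mxE mul0rn add0r ltn_eqF. Qed.

Lemma lower_band_jordan l : lower_band 0 (jordan_block p l).
Proof.
rewrite jordan_blockE; apply: lower_bandD; first exact: lower_band_scalar.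
exact: lower_bandW lower_band_jordan0.
Qed.

(** With [lower_band_nilpotent], the difference between the powers of a Jordan
    block and those of its eigenvalue is nilpotent; [iter_diff] relies on it to
    remove the influence of the distant past. *)
Lemma lower_band_jordanX l n :
  lower_band 1 (jordan_block p l ^+ n - (l ^+ n)%:M).
Proof.
elim: n => [|n IH]; first by rewrite !expr0 subrr => i j _; rewrite mxE.
have -> : jordan_block p l ^+ n.+1 - (l ^+ n.+1)%:M
    = jordan_block p l *m (jordan_block p l ^+ n - (l ^+ n)%:M)
      + jordan_block p 0 *m (l ^+ n)%:M.
  have -> : jordan_block p 0 = jordan_block p l - l%:M.
    by rewrite [jordan_block p l]jordan_blockE addrC addKr.
  by rewrite mulmxBr mulmxBl -scalar_mxM -exprS addrA subrK exprS.
apply: lower_bandD.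
  by rewrite -[1%N]/(0 + 1)%N; apply: lower_bandM => //; exact: lower_band_jordan.
rewrite -[1%N]/(1 + 0)%N; apply: lower_bandM; first exact: lower_band_jordan0.
exact: lower_band_scalar.
Qed.

Lemma lower_bandX A n : lower_band 1 A -> lower_band n (A ^+ n).
Proof.
move=> hA; elim: n => [|n IH]; first by rewrite expr0; exact: lower_band_scalar.
by rewrite exprS -add1n; apply: lower_bandM.
Qed.

Lemma lower_band_nilpotent A : lower_band 1 A -> A ^+ p = 0.
Proof.
move=> /(@lower_bandX _ p) hA; apply/matrixP => i j; rewrite hA ?mxE//.
by rewrite (leq_trans (ltn_ord i))// leq_addl.
Qed.

Lemma unitmx_sub_jordan (c l : C) : c != l -> c%:M - jordan_block p l \in unitmx.
Proof.
move=> cl; rewrite unitmxE det_trig.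
  rewrite (eq_bigr (fun=> c - l)); last first.
    by move=> i _; rewrite !mxE eqxx mulr1n ltn_eqF// addr0.
  by rewrite unitfE prodr_const expf_eq0 subr_eq0 (negPf cl) andbF.
apply/is_trig_mxP => i j ij; rewrite !mxE -val_eqE/= ltn_eqF//.
have -> : (i == j.+1 :> nat) = false by rewrite ltn_eqF// ltnS ltnW.
by rewrite !mulr0n addr0 subr0.
Qed.

Lemma unitmx_jordan l : l != 0 -> jordan_block p l \in unitmx.
Proof.
move=> l0; have := @unitmx_sub_jordan 0 l; rewrite eq_sym => /(_ l0).
by rewrite (raddf0 (@scalar_mx _ _)) sub0r unitmxE -scaleN1r detZ unitrM => /andP[].
Qed.

(** [1 - J] is minus the shift of the entries, whose range consists of the
    vectors with vanishing first entry. *)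
Lemma jordan1_solve (alpha : 'cV[C]_p) : first_coord_zero alpha ->
  exists f, (1%:M - jordan_block p 1) *m f = alpha.
Proof.
(* the shift moves entry [i] to [i + 1], so the last entry of [f] is free *)
move=> a0; exists (\col_i - (if insub i.+1 is Some j then alpha j 0 else 0)).
rewrite jordan_blockE opprD addrA subrr add0r mulNmx.
apply/colP => i; rewrite !mxE.
have [i0|ip] := posnP i.
  rewrite big1 ?oppr0 ?a0// => j _.
  by rewrite !mxE mul0rn add0r i0 mul0r.
have i1p : (i.-1 < p)%N by rewrite (leq_ltn_trans (leq_pred _)).
rewrite (bigD1 (Ordinal i1p))//= big1 ?addr0; last first.
  move=> j /eqP ji; rewrite !mxE mul0rn add0r; case: eqP => ij; last by rewrite mul0r.
  by case: ji; apply/val_inj; rewrite /= ij.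
rewrite !mxE mul0rn add0r/= prednK// eqxx mul1r opprK insubT//= => hi.
by congr (alpha _ 0); apply/val_inj.
Qed.

(** Two-sided geometric control of the powers of [A]: the upper bound makes
    the series of the solution converge, the lower bound makes the convergence
    force a logarithmic moment. *)
Definition contracting A (e a b : R) : Prop :=
  [/\ 0 < e <= 1, 0 < a < 1, 0 < b < 1
    & forall v, a * wnorm e v <= wnorm e (A *m v) <= b * wnorm e v].

Lemma contracting_jordan l : 0 < normc l < 1 ->
  exists e a b, contracting (jordan_block p l) e a b.
Proof.
move=> /andP[l0 l1].
pose e := Num.min (normc l / 2) ((1 - normc l) / 2).
have e0 : 0 < e by rewrite lt_min !divr_gt0// subr_gt0.
have e1 : e <= normc l / 2 by rewrite ge_min lexx.
have e2 : e <= (1 - normc l) / 2 by rewrite ge_min lexx orbT.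
exists e, (normc l - e), (normc l + e); split.
- by apply/andP; split => //; lra.
- by apply/andP; split; lra.
- by apply/andP; split; lra.
- move=> v; rewrite wnorm_jordan_ge ?wnorm_jordan_le//; exact: ltW.
Qed.

Lemma contracting_invmx_jordan l : 1 < normc l ->
  exists e a b, contracting (invmx (jordan_block p l)) e a b.
Proof.
move=> l1; have l0 : l != 0.
  by apply/eqP => l0; move: l1; rewrite l0 Normc.normc0 ltr10.
have J v : v = jordan_block p l *m (invmx (jordan_block p l) *m v).
  by rewrite mulmxA mulmxV ?mul1mx// unitmx_jordan.
pose e : R := Num.min 1 ((normc l - 1) / 2).
have e0 : 0 < e by rewrite lt_min !divr_gt0 ?ltr01// subr_gt0.
have e1 : e <= 1 by rewrite ge_min lexx.
have e2 : e <= (normc l - 1) / 2 by rewrite ge_min lexx orbT.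
exists e, (normc l + e)^-1, (normc l - e)^-1; split.
- by rewrite e0 e1.
- by rewrite invr_gt0 invf_lt1; lra.
- by rewrite invr_gt0 invf_lt1; lra.
- move=> v; apply/andP; split.
    rewrite {1}(J v) mulrC ler_pdivrMr; last by lra.
    by rewrite mulrC wnorm_jordan_le ?ltW.
  rewrite {2}(J v) mulrC ler_pdivlMr; last by lra.
  by rewrite mulrC wnorm_jordan_ge ?ltW.
Qed.

Lemma contractingX A e a b n v : contracting A e a b ->
  a ^+ n * wnorm e v <= wnorm e (A ^+ n *m v) <= b ^+ n * wnorm e v.
Proof.
case=> _ /andP[a0 _] /andP[b0 _] h; elim: n => [|n IH]; first by rewrite !expr0 mul1mx !mul1r !lexx.
have /andP[h1 h2] := h (A ^+ n *m v); have /andP[IH1 IH2] := IH.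
rewrite !exprS -[A * _]/(A *m _) -mulmxA -!mulrA; apply/andP; split.
  by apply: le_trans h1; rewrite ler_pM2l.
by apply: le_trans h2 _; rewrite ler_pM2l.
Qed.

Lemma wnorm_le_wnorm1 e v : 0 <= e <= 1 -> wnorm e v <= wnorm 1 v.
Proof.
case/andP=> e0 e1; apply: ler_sum => i _; rewrite expr1n ler_wpM2r ?normc_ge0//.
exact: exprn_ile1.
Qed.

End jordan.

(** * Measurability of complex vectors *)

Section measurability.
Context {R : realType} {d : measure_display} {T : measurableType d}.
Local Notation C := R[i].
Local Notation normc := Normc.normc.

Lemma measurable_Re : measurable_fun setT (@complex.Re R).
Proof. by move=> _ A mA; apply: sub_sigma_algebra; left; exists A. Qed.

Lemma measurable_Im : measurable_fun setT (@complex.Im R).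
Proof. by move=> _ A mA; apply: sub_sigma_algebra; right; exists A. Qed.

Lemma measurable_fun_complexP (f : T -> C) :
  measurable_fun setT (@complex.Re R \o f) -> measurable_fun setT (@complex.Im R \o f) ->
  measurable_fun setT f.
Proof.
move=> mRe mIm; apply: (@measurability _ _ _ _ _ _
  (preimage_set_system setT (@complex.Re R) measurable `|`
   preimage_set_system setT (@complex.Im R) measurable)) => //.
by move=> _ [_ [[A mA <-]|[A mA <-]] <-]; rewrite setTI; [exact: mRe|exact: mIm].
Qed.

Lemma measurable_fun_mxP d' (T' : measurableType d') m n (f : T -> 'M[T']_(m, n)) :
  (forall i j, measurable_fun setT (fun x => f x i j)) -> measurable_fun setT f.
Proof.
move=> mf; apply: (@measurability _ _ _ _ _ _ (\bigcup_(ij in [set: 'I_m * 'I_n])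
  preimage_set_system setT (fun A : 'M[T']_(m, n) => A ij.1 ij.2) measurable)) => //.
by move=> _ [_ [[i j] _ [A mA <-]] <-]; rewrite setTI; exact: mf.
Qed.

Lemma measurable_mxE d' (T' : measurableType d') m n i j :
  measurable_fun setT (fun A : 'M[T']_(m, n) => A i j).
Proof. by move=> _ A mA; apply: sub_sigma_algebra; exists (i, j) => //; exists A. Qed.

Lemma measurable_fun_mxE d' (T' : measurableType d') m n (f : T -> 'M[T']_(m, n)) i j :
  measurable_fun setT f -> measurable_fun setT (fun x => f x i j).
Proof. by move=> mf; exact: (measurableT_comp (@measurable_mxE _ _ _ _ i j) mf). Qed.

Lemma measurable_fun_complexD (f g : T -> C) : measurable_fun setT f ->
  measurable_fun setT g -> measurable_fun setT (fun x => f x + g x).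
Proof.
move=> mf mg; apply: measurable_fun_complexP.
  rewrite (_ : _ \o _ = fun x => complex.Re (f x) + complex.Re (g x)); last first.
    by apply/funext => x /=; case: (f x); case: (g x).
  by apply: measurable_funD; apply: measurableT_comp => //; exact: measurable_Re.
rewrite (_ : _ \o _ = fun x => complex.Im (f x) + complex.Im (g x)); last first.
  by apply/funext => x /=; case: (f x); case: (g x).
by apply: measurable_funD; apply: measurableT_comp => //; exact: measurable_Im.
Qed.

Lemma measurable_fun_complexM (f g : T -> C) : measurable_fun setT f ->
  measurable_fun setT g -> measurable_fun setT (fun x => f x * g x).
Proof.
move=> mf mg.
have mfr : measurable_fun setT (@complex.Re R \o f) by apply: measurableT_comp => //; exact: measurable_Re.
have mfi : measurable_fun setT (@complex.Im R \o f) by apply: measurableT_comp => //; exact: measurable_Im.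
have mgr : measurable_fun setT (@complex.Re R \o g) by apply: measurableT_comp => //; exact: measurable_Re.
have mgi : measurable_fun setT (@complex.Im R \o g) by apply: measurableT_comp => //; exact: measurable_Im.
apply: measurable_fun_complexP.
  rewrite (_ : _ \o _ = fun x => (@complex.Re R \o f) x * (@complex.Re R \o g) x
    - (@complex.Im R \o f) x * (@complex.Im R \o g) x); last first.
    by apply/funext => x /=; case: (f x); case: (g x).
  by apply: measurable_funB; apply: measurable_funM.
rewrite (_ : _ \o _ = fun x => (@complex.Re R \o f) x * (@complex.Im R \o g) x
    + (@complex.Im R \o f) x * (@complex.Re R \o g) x); last first.
  by apply/funext => x /=; case: (f x); case: (g x).
by apply: measurable_funD; apply: measurable_funM.
Qed.

Lemma measurable_fun_mxD m n (f g : T -> 'M[C]_(m, n)) : measurable_fun setT f ->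
  measurable_fun setT g -> measurable_fun setT (fun x => f x + g x).
Proof.
move=> mf mg; apply: measurable_fun_mxP => i j.
under eq_fun do rewrite mxE.
by apply: measurable_fun_complexD; exact: measurable_fun_mxE.
Qed.

Lemma measurable_fun_mx_sum m n (I : Type) (r : seq I) (Q : pred I)
    (f : I -> T -> 'M[C]_(m, n)) : (forall i, measurable_fun setT (f i)) ->
  measurable_fun setT (fun x => \sum_(i <- r | Q i) f i x).
Proof.
move=> mf; elim: r => [|i r IH].
  by under eq_fun do rewrite big_nil; exact: measurable_cst.
under eq_fun do rewrite big_cons.
by case: (Q i) => //; exact: measurable_fun_mxD.
Qed.

Lemma measurable_fun_mxM m n p (f : T -> 'M[C]_(m, n)) (g : T -> 'M[C]_(n, p)) :
  measurable_fun setT f ->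
  measurable_fun setT g -> measurable_fun setT (fun x => f x *m g x).
Proof.
move=> mf mg; apply: measurable_fun_mxP => i j.
under eq_fun do rewrite mxE.
elim: (index_enum _) => [|k r IH].
  by under eq_fun do rewrite big_nil; exact: measurable_cst.
under eq_fun do rewrite big_cons.
apply: measurable_fun_complexD => //.
by apply: measurable_fun_complexM; exact: measurable_fun_mxE.
Qed.

Lemma measurable_fun_mulmx m n p (A : 'M[C]_(m, n)) (g : T -> 'M[C]_(n, p)) :
  measurable_fun setT g -> measurable_fun setT (fun x => A *m g x).
Proof. by move=> mg; apply: measurable_fun_mxM => //; exact: measurable_cst. Qed.

Lemma measurable_fun_scalemx m n (a : T -> C) (g : T -> 'M[C]_(m, n)) :
  measurable_fun setT a ->
  measurable_fun setT g -> measurable_fun setT (fun x => a x *: g x).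
Proof.
move=> ma mg; apply: measurable_fun_mxP => i j.
under eq_fun do rewrite mxE.
by apply: measurable_fun_complexM => //; exact: measurable_fun_mxE.
Qed.

Lemma measurable_fun_mxN m n (g : T -> 'M[C]_(m, n)) :
  measurable_fun setT g -> measurable_fun setT (fun x => - g x).
Proof.
move=> mg; under eq_fun do rewrite -scaleN1r.
by apply: measurable_fun_scalemx => //; exact: measurable_cst.
Qed.

Lemma measurable_fun_mxB m n (f g : T -> 'M[C]_(m, n)) : measurable_fun setT f ->
  measurable_fun setT g -> measurable_fun setT (fun x => f x - g x).
Proof. by move=> mf mg; apply: measurable_fun_mxD => //; exact: measurable_fun_mxN. Qed.

Lemma measurable_normc (f : T -> C) :
  measurable_fun setT f -> measurable_fun setT (fun x => normc (f x)).
Proof.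
move=> mf.
have -> : (fun x => normc (f x)) = (fun x =>
   Num.sqrt ((@complex.Re R \o f) x ^+ 2 + (@complex.Im R \o f) x ^+ 2)).
  by apply/funext => x /=; case: (f x).
apply: measurableT_comp; first by apply: continuous_measurable_fun; exact: sqrt_continuous.
apply: measurable_funD; apply: measurable_funX; apply: measurableT_comp => //.
  exact: measurable_Re.
exact: measurable_Im.
Qed.

Lemma measurable_wnorm e s (f : T -> 'cV[C]_s) :
  measurable_fun setT f -> measurable_fun setT (fun x => wnorm e (f x)).
Proof.
move=> mf; apply: measurable_sum => i; apply: measurable_funM => //.
by apply: measurable_normc; exact: measurable_fun_mxE.
Qed.

(** The default value of [limn] is constant on the measurable set where a
    sequence has no limit. *)
Lemma measurable_fun_limn (h : nat -> T -> R) :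
  (forall n, measurable_fun setT (h n)) -> measurable_fun setT (fun x => limn (h ^~ x)).
Proof.
move=> mh.
pose he n x := (h n x)%:E.
have mhe n : measurable_fun setT (he n) by apply/measurable_EFinP.
have ms : measurable_fun setT (fun x => limn_esup (he ^~ x)).
  exact: measurable_fun_limn_esup.
have mi : measurable_fun setT (fun x => limn_einf (he ^~ x)).
  rewrite (_ : (fun x => _) = fun x => - limn_esup (fun n => - he n x))%E; last first.
    apply/funext => x; rewrite -limn_einfN; congr limn_einf.
    by apply/funext => n; rewrite -[LHS]oppeK.
  apply: measurableT_comp => //; apply: (measurable_fun_limn_esup (f := fun n x => - he n x)%E) => n.
  exact: measurableT_comp.
pose c x := [&& (limn_esup (he ^~ x) <= limn_einf (he ^~ x))%E,
  (-oo < limn_esup (he ^~ x))%E & (limn_esup (he ^~ x) < +oo)%E].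
have cvgE x : c x -> h ^~ x @ \oo --> fine (limn_esup (he ^~ x)).
  move=> /and3P[il sNy sy].
  have sf : limn_esup (he ^~ x) \is a fin_num by rewrite fin_numElt sNy sy.
  have -> : h ^~ x = fine \o (he ^~ x) by [].
  apply: fine_cvg; rewrite fineK//.
  apply: (@squeeze_cvge _ _ _ _ (einfs (he ^~ x)) _ (esups (he ^~ x))).
  - apply: nearW => n; apply/andP; split.
      by apply: ereal_inf_lbound; exists n => //=.
    by apply: ereal_sup_ubound; exists n => //=.
  - have -> : limn_esup (he ^~ x) = limn_einf (he ^~ x).
      by apply/eqP; rewrite eq_le il limn_einf_sup.
    by rewrite limn_einf_lim; exact: is_cvg_einfs.
  - by rewrite limn_esup_lim; exact: is_cvg_esups.
have cE x : cvgn (h ^~ x) -> c x.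
  move=> /cvg_ex[l hl].
  have hel : he ^~ x @ \oo --> l%:E by apply: cvg_EFin => //; exact: nearW.
  have [ei es] := cvg_limn_einf_sup hel.
  by rewrite /c ei es lexx ltNyr ltry.
have mc : measurable_fun setT c.
  apply: measurable_and; first exact: measurable_fun_lee.
  by apply: measurable_and; apply: measurable_fun_lte.
have -> : (fun x => limn (h ^~ x)) = fun x => if c x then fine (limn_esup (he ^~ x)) else point.
  apply/funext => x; case: ifPn => [cx|ncx].
    by apply/cvg_lim => //; exact: cvgE.
  by apply: dvgP => /cE; rewrite (negPf ncx).
apply: measurable_fun_ifT => //.
exact: measurableT_comp.
Qed.

End measurability.

(** * Expectations of bounded functions, laws and independence *)

Section bounded_expectation.
Context {R : realType} {d : measure_display} {T : measurableType d}.
Variable P : probability T R.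

(** Characteristic functions involve bounded integrands only, for which
    expectations are finite and linear. *)
Definition bounded_measurable (f : T -> R) :=
  measurable_fun setT f /\ exists M, forall w, `|f w| <= M.

Lemma bounded_measurable_integrable f :
  bounded_measurable f -> P.-integrable setT (EFin \o f).
Proof.
case=> mf [M fM]; apply: measurable_bounded_integrable => //.
  by rewrite -ge0_fin_numE// fin_num_measure.
exists M; split; first exact: num_real.
by move=> x Mx w _ /=; rewrite (le_trans (fM w))// ltW.
Qed.

Lemma bounded_measurableD f g : bounded_measurable f -> bounded_measurable g ->
  bounded_measurable (fun w => f w + g w).
Proof.
move=> [mf [M fM]] [mg [N gN]]; split; first exact: measurable_funD.
by exists (M + N) => w; rewrite (le_trans (ler_normD _ _))// lerD.
Qed.

Lemma bounded_measurableM f g : bounded_measurable f -> bounded_measurable g ->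
  bounded_measurable (fun w => f w * g w).
Proof.
move=> [mf [M fM]] [mg [N gN]]; split; first exact: measurable_funM.
by exists (M * N) => w; rewrite normrM ler_pM.
Qed.

Lemma bounded_measurable_cst c : bounded_measurable (fun=> c).
Proof. by split; [exact: measurable_cst|exists `|c|]. Qed.

Lemma bounded_measurableB f g : bounded_measurable f -> bounded_measurable g ->
  bounded_measurable (fun w => f w - g w).
Proof.
move=> [mf [M fM]] [mg [N gN]]; split; first exact: measurable_funB.
by exists (M + N) => w; rewrite (le_trans (ler_normB _ _))// lerD.
Qed.

Lemma bounded_measurable_sum I (r : seq I) (f : I -> T -> R) :
  (forall i, bounded_measurable (f i)) ->
  bounded_measurable (fun w => \sum_(i <- r) f i w).
Proof.
move=> bf; elim: r => [|i r IH].
  by under eq_fun do rewrite big_nil; exact: bounded_measurable_cst.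
by under eq_fun do rewrite big_cons; exact: bounded_measurableD.
Qed.

Lemma bounded_measurable_indic A : measurable A -> bounded_measurable \1_A.
Proof.
move=> mA; split; first exact: measurable_indic.
by exists 1 => w; rewrite indicE; case: (_ \in _); rewrite ?normr1 ?normr0.
Qed.

Lemma bounded_measurable_cos f : measurable_fun setT f ->
  bounded_measurable (fun w => cos (f w)).
Proof.
move=> mf; split.
  by apply: measurableT_comp mf; apply: continuous_measurable_fun; exact: continuous_cos.
by exists 1 => w; rewrite ler_norml cos_geN1 cos_le1.
Qed.

Lemma bounded_measurable_sin f : measurable_fun setT f ->
  bounded_measurable (fun w => sin (f w)).
Proof.
move=> mf; split.
  by apply: measurableT_comp mf; apply: continuous_measurable_fun; exact: continuous_sin.
by exists 1 => w; rewrite ler_norml sin_geN1 sin_le1.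
Qed.

Lemma RintegralD_bounded f g : bounded_measurable f -> bounded_measurable g ->
  \int[P]_w (f w + g w) = \int[P]_w f w + \int[P]_w g w.
Proof. by move=> bf bg; apply: RintegralD => //; exact: bounded_measurable_integrable. Qed.

Lemma RintegralB_bounded f g : bounded_measurable f -> bounded_measurable g ->
  \int[P]_w (f w - g w) = \int[P]_w f w - \int[P]_w g w.
Proof. by move=> bf bg; apply: RintegralB => //; exact: bounded_measurable_integrable. Qed.

Lemma RintegralZl_bounded c f : bounded_measurable f ->
  \int[P]_w (c * f w) = c * \int[P]_w f w.
Proof. by move=> bf; apply: RintegralZl => //; exact: bounded_measurable_integrable. Qed.

Lemma Rintegral_cst_proba c : \int[P]_w c = c.
Proof.
rewrite Rintegral_cst// -[RHS]mulr1; congr (_ * _).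
exact: (congr1 fine (probability_setT P)).
Qed.

Lemma Rintegral_sum_bounded I (r : seq I) (f : I -> T -> R) :
  (forall i, bounded_measurable (f i)) ->
  \int[P]_w (\sum_(i <- r) f i w) = \sum_(i <- r) \int[P]_w f i w.
Proof.
move=> bf; elim: r => [|i r IH].
  by under eq_Rintegral do rewrite big_nil; rewrite big_nil Rintegral_cst_proba.
under eq_Rintegral do rewrite big_cons.
by rewrite big_cons RintegralD_bounded ?IH//; exact: bounded_measurable_sum.
Qed.

Lemma le_Rintegral_bounded f g : bounded_measurable f -> bounded_measurable g ->
  (forall w, f w <= g w) -> \int[P]_w f w <= \int[P]_w g w.
Proof. by move=> bf bg fg; apply: le_Rintegral => //; exact: bounded_measurable_integrable. Qed.

Lemma Rintegral_indic A : measurable A -> \int[P]_w \1_A w = fine (P A).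
Proof. by move=> mA; rewrite /Rintegral integral_indic// setIT. Qed.

Lemma eq_Rintegral_ae f g : bounded_measurable f -> bounded_measurable g ->
  {ae P, forall w, f w = g w} -> \int[P]_w f w = \int[P]_w g w.
Proof.
move=> [mf _] [mg _] fg; congr fine; apply: ae_eq_integral => //.
- exact/measurable_EFinP.
- exact/measurable_EFinP.
- by apply: filterS fg => w -> _.
Qed.

Lemma bounded_Rintegral0_ae f : bounded_measurable f -> (forall w, 0 <= f w) ->
  \int[P]_w f w = 0 -> {ae P, forall w, f w = 0}.
Proof.
move=> bf f0 If0; have [mf _] := bf.
have /integrableP[_ foo] := bounded_measurable_integrable bf.
have : (\int[P]_w `|(f w)%:E| = 0)%E.
  under eq_integral do rewrite gee0_abs ?lee_fin//.
  rewrite -[LHS]fineK ?[fine _]If0//.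
  rewrite ge0_fin_numE; last by apply: integral_ge0 => w _; rewrite lee_fin.
  by under eq_integral do rewrite -[X in X%:E]ger0_norm//.
move/ae_eq_integral_abs => /(_ measurableT).
have /measurable_EFinP mf' := mf.
move=> /(_ mf')/=.
by apply: filterS => w /(_ I)[].
Qed.

End bounded_expectation.

Section mfun.
Context {d d' : measure_display} {T : measurableType d} {T' : measurableType d'}.
Variables (f : T -> T') (mf : measurable_fun setT f).

(** Carries a proof of measurability, so that image measures under [f] are
    recognised as measures. *)
Definition mfun_of : T -> T' := let _ := mf in f.

HB.instance Definition _ := isMeasurableFun.Build d d' T T' mfun_of mf.

End mfun.

Section laws.
Context {R : realType} {d : measure_display} {T : measurableType d}.
Variable P : probability T R.

(** Uniqueness of measures on a pi-system. *)
Lemma law_unique d' (T' : measurableType d') (G : set (set T')) (X Y : T -> T') :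
  measurable = <<s G >> -> setI_closed G -> G setT ->
  measurable_fun setT X -> measurable_fun setT Y ->
  (forall A, G A -> P (X @^-1` A) = P (Y @^-1` A)) ->
  forall A, measurable A -> P (X @^-1` A) = P (Y @^-1` A).
Proof.
move=> GE GI GT mX mY XY A mA.
pose m1 := distribution P (mfun_of mX); pose m2 := distribution P (mfun_of mY).
apply: (@measure_unique _ _ _ G (fun=> setT) GE GI _ _ m1 m2) => //.
  by rewrite bigcup_const//; exists 0%N.
by move=> _; rewrite -ge0_fin_numE// fin_num_measure.
Qed.

Definition independent2 d1 d2 (T1 : measurableType d1) (T2 : measurableType d2)
    (X : T -> T1) (Y : T -> T2) :=
  forall A B, measurable A -> measurable B ->
    P (X @^-1` A `&` Y @^-1` B) = (P (X @^-1` A) * P (Y @^-1` B))%E.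

Lemma independent2_Rintegral d1 d2 (T1 : measurableType d1) (T2 : measurableType d2)
    (X : T -> T1) (Y : T -> T2) (f : T1 -> R) (g : T2 -> R) :
  measurable_fun setT X -> measurable_fun setT Y -> independent2 X Y ->
  bounded_measurable f -> bounded_measurable g ->
  \int[P]_w (f (X w) * g (Y w)) = \int[P]_w f (X w) * \int[P]_w g (Y w).
Proof.
move=> mX mY XY bf bg; have [mf [Mf fM]] := bf; have [mg [Mg gM]] := bg.
pose m1 : probability T1 R := distribution P (mfun_of mX).
pose m2 : probability T2 R := distribution P (mfun_of mY).
have mXY : measurable_fun setT (fun w => (X w, Y w)) by exact: measurable_fun_pair.
pose m : probability (T1 * T2)%type R := distribution P (mfun_of mXY).
have mE A : measurable A -> (m1 \x m2)%E A = m A.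
  by apply: product_measure_unique => B C mB mC; rewrite /m1 /m2 /m /distribution/= -XY.
pose F (z : T1 * T2) := f z.1 * g z.2.
have mF : measurable_fun setT F.
  apply: measurable_funM; first exact: (measurableT_comp mf measurable_fst).
  exact: (measurableT_comp mg measurable_snd).
have bF : bounded_measurable F.
  by split => //; exists (Mf * Mg) => z; rewrite normrM ler_pM.
have iF : integrable (m1 \x m2)%E setT (EFin \o F).
  apply/integrableP; split; first exact/measurable_EFinP.
  rewrite (eq_measure_integral m)//; last by move=> A mA _; exact: mE.
  by have /integrableP[] := bounded_measurable_integrable m bF.
have bf1 : bounded_measurable (fun w => f (X w)).
  by split; [exact: measurableT_comp|exists Mf].
have bg1 : bounded_measurable (fun w => g (Y w)).
  by split; [exact: measurableT_comp|exists Mg].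
have bfg := bounded_measurableM bf1 bg1.
have -> : \int[P]_w (f (X w) * g (Y w)) = \int[m]_z F z.
  congr fine; rewrite (@integral_distribution _ _ _ _ _ P (mfun_of mXY) (EFin \o F))//.
    exact/measurable_EFinP.
  exact: bounded_measurable_integrable bfg.
have -> : \int[m]_z F z = \int[m1]_x \int[m2]_y F (x, y).
  rewrite /Rintegral (@eq_measure_integral _ _ _ setT (m1 \x m2)%E m)//; last first.
    by move=> A mA _; exact/esym/mE.
  rewrite -integral12_prod_meas1//; congr fine; apply: eq_integral => x _.
  rewrite /fubini_F fineK//.
  have bFx := bounded_measurableM (bounded_measurable_cst (f x)) bg.
  exact: (integrable_fin_num measurableT (bounded_measurable_integrable m2 bFx)).
transitivity (\int[m1]_x (f x * \int[m2]_y g y)).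
  by apply: eq_Rintegral => x _; exact: (RintegralZl_bounded m2 (f x) bg).
rewrite RintegralZr//; last exact: bounded_measurable_integrable.
congr (_ * _); congr fine; symmetry.
  rewrite (@integral_distribution _ _ _ _ _ P (mfun_of mX) (EFin \o f))//.
    exact/measurable_EFinP.
  exact: bounded_measurable_integrable bf1.
rewrite (@integral_distribution _ _ _ _ _ P (mfun_of mY) (EFin \o g))//.
  exact/measurable_EFinP.
exact: bounded_measurable_integrable bg1.
Qed.

End laws.

Section iid_sequences.
Context {R : realType} {dO : measure_display} {Omega : measurableType dO}.
Variable P : probability Omega R.
Context {dE : measure_display} {E : measurableType dE}.

Definition cylinder {T : Type} (Z : int -> T -> E) (s : seq int) (A : int -> set E) : set T :=
  \big[setI/setT]_(i <- s) (Z i @^-1` A i).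

Lemma cylinderP {T : Type} (Z : int -> T -> E) s A w :
  cylinder Z s A w <-> forall i, i \in s -> A i (Z i w).
Proof.
rewrite /cylinder; elim: s => [|j s IH].
  by rewrite big_nil; split.
rewrite big_cons; split=> [[/= Aj /IH h] i|h].
  by rewrite inE => /predU1P[->//|/h].
split; first by apply: h; rewrite mem_head.
by apply/IH => i si; apply: h; rewrite inE si orbT.
Qed.

Lemma cylinder_undup {T : Type} (Z : int -> T -> E) s A :
  cylinder Z s A = cylinder Z (undup s) A.
Proof.
apply/seteqP; split => w /cylinderP h; apply/cylinderP => i.
  by rewrite mem_undup; exact: h.
by rewrite -mem_undup; exact: h.
Qed.

Lemma cylinderI {T : Type} (Z : int -> T -> E) s s' A A' :
  cylinder Z s A `&` cylinder Z s' A' =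
  cylinder Z (s ++ s') (fun i => (if i \in s then A i else setT)
                                 `&` (if i \in s' then A' i else setT)).
Proof.
apply/seteqP; split => [w [/cylinderP h /cylinderP h']|w /cylinderP h].
  apply/cylinderP => i _; split; case: ifPn => //; [exact: h|exact: h'].
by split; apply/cylinderP => i si; have := h i; rewrite mem_cat si ?orbT => /(_ erefl)[].
Qed.

Lemma measurable_cylinder d (T : measurableType d) (Z : int -> T -> E) s A :
  (forall i, measurable_fun setT (Z i)) -> (forall i, measurable (A i)) ->
  measurable (cylinder Z s A).
Proof.
move=> mZ mA; apply: bigsetI_measurable => i _.
by rewrite -[X in measurable X]setTI; exact: mZ.
Qed.

Definition cylinders {T : Type} (Z : int -> T -> E) (K : pred int) : set (set T) :=
  [set F | exists s A, [/\ all K s, forall i, measurable (A i) & F = cylinder Z s A]].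

Lemma cylinders_setI_closed {T : Type} (Z : int -> T -> E) K :
  setI_closed (cylinders Z K).
Proof.
move=> _ _ [s [A [Ks mA ->]]] [s' [A' [Ks' mA' ->]]].
rewrite cylinderI; eexists; eexists; split; [|move=> i|reflexivity].
  by rewrite all_cat Ks.
by apply: measurableI; case: ifPn.
Qed.

Lemma cylindersT {T : Type} (Z : int -> T -> E) K : cylinders Z K setT.
Proof.
exists [::], (fun=> setT); split => //.
by apply/seteqP; split => // w _; apply/cylinderP.
Qed.

Lemma cylinders_coord {T : Type} (Z : int -> T -> E) (K : pred int) i A :
  K i -> measurable A -> cylinders Z K (Z i @^-1` A).
Proof.
move=> Ki mA; exists [:: i], (fun=> A); split => //=; first by rewrite Ki.
by rewrite /cylinder big_seq1.
Qed.

Lemma measurable_coord_cylinders (T : pointedType) (Z : int -> T -> E) (K : pred int) i :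
  K i -> measurable_fun setT (Z i : g_sigma_algebraType (cylinders Z K) -> E).
Proof.
move=> Ki _ A mA; rewrite setTI; apply: sub_sigma_algebra.
exact: cylinders_coord.
Qed.

Variable Z : int -> Omega -> E.
Hypothesis hZ : iid P Z.

Let mZ i : measurable_fun setT (Z i). Proof. by case: hZ. Qed.

Let mZpre i A : measurable A -> measurable (Z i @^-1` A).
Proof. by move=> mA; rewrite -[X in measurable X]setTI; exact: mZ. Qed.

(** The restriction of [P] to the event about [Z k] and the corresponding
    multiple of [P] are finite measures that agree on the pi-system of the
    cylinders about the other coordinates. *)
Lemma independent_coord k F B : <<s cylinders Z (predC1 k) >> F -> measurable B ->
  P (F `&` Z k @^-1` B) = (P F * P (Z k @^-1` B))%E.
Proof.
move=> sF mB; have [_ iZ _] := hZ.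
have mB' := mZpre k mB.
have pB0 : 0 <= fine (P (Z k @^-1` B)) by apply: fine_ge0.
pose m1 := mrestr P mB'.
pose m2 := mscale (NngNum pB0) P.
have Gm : cylinders Z (predC1 k) `<=` measurable.
  by move=> _ [s [A [_ mA ->]]]; exact: measurable_cylinder.
have G12 A : cylinders Z (predC1 k) A -> m1 A = m2 A.
  move=> [s [A' [ks mA' ->]]]; rewrite cylinder_undup.
  rewrite /m1 /m2 /mrestr /mscale/= fineK ?fin_num_measure//.
  have nk : k \notin undup s.
    by rewrite mem_undup; apply/negP => /(allP ks)/=; rewrite eqxx.
  have := iZ (k :: undup s) (fun i => if i == k then B else A' i).
  rewrite /= nk undup_uniq => /(_ erefl).
  have ml i : measurable (if i == k then B else A' i) by case: ifP.
  move=> /(_ ml); rewrite !big_cons eqxx setIC.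
  have -> : \big[setI/setT]_(j <- undup s) (Z j @^-1` (if j == k then B else A' j))
      = cylinder Z (undup s) A'.
    apply: eq_big_seq => j js; case: eqP => // jk.
    by move: nk; rewrite -jk js.
  move=> ->; congr (_ * _)%E.
  rewrite /cylinder iZ//; last exact: undup_uniq.
  by apply: eq_big_seq => j js; case: eqP => // jk; move: nk; rewrite -jk js.
have : m1 F = m2 F.
  apply: (@g_sigma_algebra_measure_unique _ _ _ (cylinders Z (predC1 k)) Gm (fun=> setT)) => //.
  - by move=> _; exact: cylindersT.
  - by rewrite bigcup_const//; exists 0%N.
  - exact: cylinders_setI_closed.
  - by move=> _; rewrite /m1 /mrestr -ge0_fin_numE// fin_num_measure//; exact: measurableI.
by rewrite /m1 /m2 /mrestr /mscale/= fineK ?fin_num_measure// muleC.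
Qed.

Lemma independent2_sum_coord (s : seq int) (a : int -> E -> R) k (b : E -> R) :
  k \notin s -> (forall j, measurable_fun setT (a j)) -> measurable_fun setT b ->
  independent2 P (fun w => \sum_(j <- s) a j (Z j w)) (fun w => b (Z k w)).
Proof.
move=> ks ma mb A B mA mB.
rewrite (_ : (fun w => b (Z k w)) @^-1` B = Z k @^-1` (b @^-1` B))//.
apply: independent_coord; last by rewrite -[X in measurable X]setTI; exact: mb.
have mf : measurable_fun setT ((fun w => \sum_(j <- s) a j (Z j w)) :
    g_sigma_algebraType (cylinders Z (predC1 k)) -> R).
  rewrite (_ : (fun w => _) =
      fun w => \sum_(j <- s) if j == k then 0 else a j (Z j w)); last first.
    by apply/funext => w; apply: eq_big_seq => j js; case: eqP => // jk; move: ks; rewrite -jk js.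
  apply: measurable_sum => j; have [_|jk] := eqVneq j k; first exact: measurable_cst.
  apply: measurableT_comp => //; exact: measurable_coord_cylinders.
by have := mf measurableT A mA; rewrite setTI.
Qed.

Lemma identically_distributed_Rintegral i j (f : E -> R) : bounded_measurable f ->
  \int[P]_w f (Z i w) = \int[P]_w f (Z j w).
Proof.
move=> bf; have [mf [M fM]] := bf; have [_ _ dZ] := hZ.
have h k : \int[P]_w f (Z k w) = \int[distribution P (mfun_of (mZ k))]_y f y.
  congr fine; rewrite (@integral_distribution _ _ _ _ _ P (mfun_of (mZ k)) (EFin \o f))//.
    exact/measurable_EFinP.
  apply: bounded_measurable_integrable; split; first exact: measurableT_comp.
  by exists M => w; exact: fM.
rewrite !h; congr fine; apply: eq_measure_integral => A mA _.
exact: dZ.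
Qed.

(** The squared modulus of the characteristic function of [X] at [1]; like the
    characteristic function it is multiplicative over independent sums. *)
Definition sqnorm_cf (X : Omega -> R) : R :=
  (\int[P]_w cos (X w)) ^+ 2 + (\int[P]_w sin (X w)) ^+ 2.

Lemma sqnorm_cf_ge0 X : 0 <= sqnorm_cf X.
Proof. by rewrite addr_ge0// sqr_ge0. Qed.

Lemma sqnorm_cf_le1 X : measurable_fun setT X -> sqnorm_cf X <= 1.
Proof.
move=> mX; rewrite /sqnorm_cf.
have bc := bounded_measurable_cos mX; have bs := bounded_measurable_sin mX.
set a := \int[P]_w cos (X w); set b := \int[P]_w sin (X w).
have bac := bounded_measurableM (bounded_measurable_cst a) bc.
have bbs := bounded_measurableM (bounded_measurable_cst b) bs.
have : \int[P]_w (a * cos (X w) + b * sin (X w)) <= \int[P]_w ((a ^+ 2 + b ^+ 2 + 1) / 2).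
  apply: le_Rintegral_bounded; [exact: bounded_measurableD|exact: bounded_measurable_cst|].
  move=> w; have := cos2Dsin2 (X w); set c := cos _; set s := sin _ => cs.
  have := sqr_ge0 (a - c); have := sqr_ge0 (b - s); nra.
rewrite Rintegral_cst_proba RintegralD_bounded// !RintegralZl_bounded//.
rewrite -/a -/b; nra.
Qed.

Lemma sqnorm_cfD (X Y : Omega -> R) : measurable_fun setT X -> measurable_fun setT Y ->
  independent2 P X Y ->
  sqnorm_cf (fun w => X w + Y w) = sqnorm_cf X * sqnorm_cf Y.
Proof.
move=> mX mY XY.
have bcos : bounded_measurable (@cos R).
  split; first by apply: continuous_measurable_fun; exact: continuous_cos.
  by exists 1 => w; rewrite ler_norml cos_geN1 cos_le1.
have bsin : bounded_measurable (@sin R).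
  split; first by apply: continuous_measurable_fun; exact: continuous_sin.
  by exists 1 => w; rewrite ler_norml sin_geN1 sin_le1.
have bcX := bounded_measurable_cos mX; have bsX := bounded_measurable_sin mX.
have bcY := bounded_measurable_cos mY; have bsY := bounded_measurable_sin mY.
rewrite /sqnorm_cf.
under eq_Rintegral do rewrite cosD.
under [X in _ + X ^+ 2]eq_Rintegral do rewrite sinD.
rewrite RintegralB_bounded; try exact: bounded_measurableM.
rewrite RintegralD_bounded; try exact: bounded_measurableM.
rewrite !(independent2_Rintegral mX mY XY)//; ring.
Qed.

Lemma sqnorm_cf_sum (s : seq int) (a : int -> E -> R) :
  uniq s -> (forall j, measurable_fun setT (a j)) ->
  sqnorm_cf (fun w => \sum_(j <- s) a j (Z j w)) =
  \prod_(j <- s) sqnorm_cf (fun w => a j (Z j w)).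
Proof.
move=> us ma; elim: s us => [_|k s IH /= /andP[ks us]].
  rewrite big_nil /sqnorm_cf.
  under eq_Rintegral do rewrite big_nil cos0.
  under [X in _ + X ^+ 2]eq_Rintegral do rewrite big_nil sin0.
  by rewrite !Rintegral_cst_proba expr1n expr0n addr0.
rewrite big_cons -IH// mulrC -sqnorm_cfD.
- by congr sqnorm_cf; apply/funext => w; rewrite big_cons addrC.
- by apply: measurable_sum => j; exact: measurableT_comp.
- exact: measurableT_comp.
- exact: independent2_sum_coord.
Qed.

(** [|E exp (i X)|^2 = E cos (X - X')] for an independent copy [X'] of [X]. *)
Lemma sqnorm_cf_copy (a : E -> R) k : measurable_fun setT a ->
  sqnorm_cf (fun w => a (Z k w)) = \int[P]_w cos (a (Z 0 w) - a (Z 1 w)).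
Proof.
move=> ma; rewrite /sqnorm_cf.
have bc : bounded_measurable (fun x => cos (a x)) by exact: bounded_measurable_cos.
have bs : bounded_measurable (fun x => sin (a x)) by exact: bounded_measurable_sin.
have bcZ k' : bounded_measurable (fun w => cos (a (Z k' w))).
  by apply: bounded_measurable_cos; exact: measurableT_comp.
have bsZ k' : bounded_measurable (fun w => sin (a (Z k' w))).
  by apply: bounded_measurable_sin; exact: measurableT_comp.
under [RHS]eq_Rintegral do rewrite cosB.
rewrite RintegralD_bounded; try exact: bounded_measurableM.
have i01 : independent2 P (Z 0) (Z 1).
  move=> A B mA mB; apply: independent_coord => //.
  by apply: sub_sigma_algebra; exact: cylinders_coord.
rewrite (independent2_Rintegral (mZ 0) (mZ 1) i01 bc bc).
rewrite (independent2_Rintegral (mZ 0) (mZ 1) i01 bs bs).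
rewrite (identically_distributed_Rintegral k 0 bc) (identically_distributed_Rintegral k 0 bs).
by rewrite (identically_distributed_Rintegral 1 0 bc) (identically_distributed_Rintegral 1 0 bs) !expr2.
Qed.

End iid_sequences.

(** By induction the product times [1 + \sum_i (1 - x i)] is at most one, since
    [x * (2 - x) <= 1]. *)
Lemma prod_lower_bound_sum {R : realType} (n : nat) (x : nat -> R) (c : R) :
  (forall i, 0 <= x i <= 1) -> 0 < c -> c <= \prod_(i < n) x i ->
  \sum_(i < n) (1 - x i) <= c^-1 - 1.
Proof.
move=> x01 c0 cx.
have key : (\prod_(i < n) x i) * (1 + \sum_(i < n) (1 - x i)) <= 1
   /\ 0 <= \prod_(i < n) x i /\ 0 <= \sum_(i < n) (1 - x i).
  elim: n {cx} => [|n [IH1 [IH2 IH3]]]; first by rewrite !big_ord0 mul1r addr0 lexx ler01.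
  have /andP[h0 h1] := x01 n.
  rewrite !big_ord_recr/=; set p := \prod_(i < n) _ in IH1 IH2 *; set S := \sum_(i < n) _ in IH1 IH3 *.
  split; last by split; [rewrite mulr_ge0|rewrite addr_ge0// subr_ge0].
  have d0 : 0 <= 1 - x n by rewrite subr_ge0.
  have : 0 <= p * ((1 - x n) * (S + (1 - x n))) by rewrite !mulr_ge0// addr_ge0.
  move=> h; apply: le_trans IH1; rewrite -subr_ge0.
  by rewrite (_ : _ - _ = p * ((1 - x n) * (S + (1 - x n))))//; ring.
have [k1 [_ k3]] := key.
rewrite lerBrDr addrC -[leRHS]mul1r ler_pdivlMr//.
apply: le_trans k1; rewrite mulrC ler_wpM2r// addr_ge0//.
Qed.

(** * Tightness *)

Section tightness.
Context {R : realType} {dO : measure_display} {Omega : measurableType dO}.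
Variable P : probability Omega R.
Local Notation C := R[i].
Local Notation normc := Normc.normc.

Lemma measurable_gt_set d (T : measurableType d) (f : T -> R) (c : R) :
  measurable_fun setT f -> measurable [set w | c < f w].
Proof.
move=> mf; have -> : [set w | c < f w] = setT `&` f @^-1` `]c, +oo[.
  by rewrite setTI; apply/seteqP; split => w /=; rewrite in_itv/= andbT.
exact: mf.
Qed.

Lemma measurable_le_set d (T : measurableType d) (f : T -> R) (c : R) :
  measurable_fun setT f -> measurable [set w | f w <= c].
Proof.
move=> mf; have -> : [set w | f w <= c] = setT `&` f @^-1` `]-oo, c].
  by rewrite setTI; apply/seteqP; split => w /=; rewrite in_itv/=.
exact: mf.
Qed.

Lemma probability_le_ae (A B : set Omega) : measurable A -> measurable B ->
  {ae P, forall w, A w -> B w} -> (P A <= P B)%E.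
Proof.
move=> mA mB [N [mN PN AB]].
apply: (@le_trans _ _ (P (B `|` N))).
  apply: le_measure; rewrite ?inE//; first exact: measurableU.
  move=> w Aw; have [Bw|nBw] := pselect (B w); first by left.
  by right; apply: AB => /= h; apply: nBw; exact: h.
apply: (le_trans (measureU2 _ mB mN)).
by rewrite [X in (_ + X)%E](_ : _ = 0%E) ?adde0.
Qed.

Lemma real_tight (f : Omega -> R) (e : R) : measurable_fun setT f -> 0 < e ->
  exists K, (P [set w | (K < f w)%R] <= e%:E)%E.
Proof.
move=> mf e0.
pose F (n : nat) := [set w | n%:R < f w].
have mF n : measurable (F n) by exact: measurable_gt_set.
have F0 : \bigcap_n F n = set0.
  apply/seteqP; split => // w h.
  have := archi_boundP (normr_ge0 (f w)); set n := Num.bound _ => nf.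
  by have := lt_trans (h n I) (le_lt_trans (ler_norm _) nf); rewrite ltxx.
have : P (F n) @[n --> \oo] --> P (\bigcap_n F n).
  apply: nonincreasing_cvg_mu => //.
  - by rewrite -ge0_fin_numE// fin_num_measure.
  - exact: bigcap_measurable.
  - move=> m n mn; apply/subsetPset => w; rewrite /F/=; apply: le_lt_trans.
    by rewrite ler_nat.
rewrite F0 measure0 => /fine_cvgP[_ h].
have /cvgrPdist_le/(_ e e0)[n _ hn] := h.
exists n%:R; have := hn n (leqnn n); rewrite /= sub0r normrN.
rewrite -[P [set w | _]]fineK ?fin_num_measure//; last exact: mF.
by rewrite lee_fin; apply: le_trans; exact: ler_norm.
Qed.

(** Boundedness in probability. The choice of the norm is immaterial, all
    norms on [C^p] being equivalent. *)
Definition tight {I : Type} {p} (X : I -> Omega -> 'cV[C]_p) : Prop :=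
  (forall i, measurable_fun setT (X i)) /\
  forall e : R, 0 < e ->
    exists K, forall i, (P [set w | (K < wnorm 1 (X i w))%R] <= e%:E)%E.

Lemma tight_comp I J p (f : J -> I) (X : I -> Omega -> 'cV[C]_p) :
  tight X -> tight (fun j => X (f j)).
Proof.
by case=> mX tX; split => // e /tX[K hK]; exists K => j; exact: hK.
Qed.

Lemma tightD I p (X Y : I -> Omega -> 'cV[C]_p) :
  tight X -> tight Y -> tight (fun i w => X i w + Y i w).
Proof.
move=> [mX tX] [mY tY]; split=> [i|e e0]; first exact: measurable_fun_mxD.
have e20 : 0 < e / 2 by rewrite divr_gt0.
have [K hK] := tX _ e20; have [L hL] := tY _ e20.
have mnX i : measurable_fun setT (fun w => wnorm 1 (X i w)) by exact: measurable_wnorm.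
have mnY i : measurable_fun setT (fun w => wnorm 1 (Y i w)) by exact: measurable_wnorm.
exists (K + L) => i.
apply: (@le_trans _ _ (P ([set w | (K < wnorm 1 (X i w))%R] `|`
                          [set w | (L < wnorm 1 (Y i w))%R]))).
  apply: le_measure; rewrite ?inE.
  - by apply: measurable_gt_set; apply: measurable_wnorm; exact: measurable_fun_mxD.
  - by apply: measurableU; exact: measurable_gt_set.
  - move=> w /= h; have [KX|XK] := ltP K (wnorm 1 (X i w)); first by left.
    right => /=; rewrite ltNge; apply/negP => YL.
    have := lt_le_trans h (le_trans (wnormD _ _ ler01) (lerD XK YL)).
    by rewrite ltxx.
apply: le_trans (measureU2 _ _ _) _; try exact: measurable_gt_set.
by rewrite [e]splitr EFinD; exact: (leeD (hK i) (hL i)).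
Qed.

Lemma tight_mulmx I p q (A : I -> 'M[C]_(q, p)) (B : R) (X : I -> Omega -> 'cV[C]_p) :
  (forall i v, wnorm 1 (A i *m v) <= B * wnorm 1 v) ->
  tight X -> tight (fun i w => A i *m X i w).
Proof.
move=> hA [mX tX]; split=> [i|e e0]; first exact: measurable_fun_mulmx.
have [K hK] := tX _ e0; exists (`|B| * K) => i; apply: le_trans (hK i).
apply: le_measure; rewrite ?inE.
- by apply: measurable_gt_set; apply: measurable_wnorm; exact: measurable_fun_mulmx.
- by apply: measurable_gt_set; exact: measurable_wnorm.
move=> w /= h; rewrite ltNge; apply/negP => hK'.
have := lt_le_trans h (hA i (X i w)); apply/negP; rewrite -leNgt.
apply: (@le_trans _ _ (`|B| * wnorm 1 (X i w))).
  by rewrite ler_wpM2r ?ler_norm ?wnorm_ge0.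
by rewrite ler_wpM2l.
Qed.

Lemma wnorm1_mulmx_le p q (A : 'M[C]_(q, p)) :
  exists2 B, 0 <= B & forall v : 'cV[C]_p, wnorm 1 (A *m v) <= B * wnorm 1 v.
Proof.
exists (\sum_j \sum_i normc (A i j)).
  by apply: sumr_ge0 => j _; apply: sumr_ge0 => i _; exact: normc_ge0.
move=> v; rewrite /wnorm mulr_suml.
apply: (@le_trans _ _ (\sum_(i < q) \sum_(j < p) normc (A i j) * normc (v j 0))).
  apply: ler_sum => i _; rewrite expr1n mul1r mxE.
  elim/big_ind2 : _ => [|x1 x2 y1 y2 h1 h2|j _]; first by rewrite Normc.normc0.
    exact: le_trans (le_normcD _ _) (lerD h1 h2).
  by rewrite Normc.normcM.
rewrite exchange_big/=; apply: ler_sum => j _.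
rewrite -mulr_suml ler_wpM2l//.
  by apply: sumr_ge0 => i _; exact: normc_ge0.
rewrite (bigD1 j)//= expr1n mul1r lerDl sumr_ge0// => k _.
by rewrite expr1n mul1r normc_ge0.
Qed.

Lemma tight_mulmx_cst I p q (A : 'M[C]_(q, p)) (X : I -> Omega -> 'cV[C]_p) :
  tight X -> tight (fun i w => A *m X i w).
Proof.
have [B _ hB] := wnorm1_mulmx_le A.
exact: (@tight_mulmx _ _ _ (fun=> A) B).
Qed.

Lemma tight_scale I p (a : I -> C) (X : I -> Omega -> 'cV[C]_p) :
  (forall i, normc (a i) <= 1) -> tight X -> tight (fun i w => a i *: X i w).
Proof.
move=> ha tX.
have -> : (fun i w => a i *: X i w) = (fun i w => (a i)%:M *m X i w).
  by apply/funext => i; apply/funext => w; rewrite mul_scalar_mx.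
apply: (@tight_mulmx _ _ _ (fun i => (a i)%:M) 1) => // i v.
by rewrite mul_scalar_mx wnormZ ler_wpM2r// wnorm_ge0.
Qed.

Lemma tightB I p (X Y : I -> Omega -> 'cV[C]_p) :
  tight X -> tight Y -> tight (fun i w => X i w - Y i w).
Proof.
move=> tX tY; have -> : (fun i w => X i w - Y i w) = fun i w => X i w + (- 1) *: Y i w.
  by apply/funext => i; apply/funext => w; rewrite scaleN1r.
apply: tightD => //; apply: (@tight_scale _ _ (fun=> -1)) => // i.
by rewrite normcN Normc.normc1.
Qed.

Lemma tight_identical I p (X : I -> Omega -> 'cV[C]_p) (i0 : I) :
  (forall i, measurable_fun setT (X i)) ->
  (forall i A, measurable A -> P (X i @^-1` A) = P (X i0 @^-1` A)) -> tight X.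
Proof.
move=> mX dX; split => // e e0.
have [K hK] := real_tight (measurable_wnorm 1 (mX i0)) e0.
exists K => i; apply: le_trans hK.
rewrite -[X in (P X <= _)%E]/(X i @^-1` [set v | K < wnorm 1 v]) dX//.
apply: (@measurable_gt_set _ _ (fun v => wnorm 1 v)).
by apply: measurable_wnorm; exact: measurable_id.
Qed.

Lemma tight_sum I p (J : Type) (r : seq J) (X : J -> I -> Omega -> 'cV[C]_p) :
  (forall j, tight (X j)) -> tight (fun i w => \sum_(j <- r) X j i w).
Proof.
move=> tX; elim: r => [|j r IH].
  have -> : (fun i w => \sum_(j <- [::]) X j i w) = fun _ _ => 0.
    by apply/funext => i; apply/funext => w; rewrite big_nil.
  split=> [i|e e0]; first exact: measurable_cst.
  exists 0 => i; rewrite (_ : [set w | _] = set0) ?measure0 ?lee_fin ?ltW//.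
  apply/seteqP; split => // w /=.
  by rewrite /wnorm big1 ?ltxx// => k _; rewrite mxE Normc.normc0 mulr0.
have -> : (fun i w => \sum_(j <- j :: r) X j i w) =
    fun i w => X j i w + \sum_(j <- r) X j i w.
  by apply/funext => i; apply/funext => w; rewrite big_cons.
exact: tightD.
Qed.

End tightness.

(** * Tight sums of independent vectors *)

Section tight_independent_sums.
Context {R : realType} {dO : measure_display} {Omega : measurableType dO}.
Variable P : probability Omega R.
Local Notation C := R[i].
Local Notation normc := Normc.normc.
Variables (d : nat) (Z : int -> Omega -> 'cV[C]_d).
Hypothesis hZ : iid P Z.

Let mZ i : measurable_fun setT (Z i). Proof. by case: hZ. Qed.

(** The real linear forms on [C^p], viewed as a real vector space. *)
Definition Re_form p (u : 'rV[C]_p) (v : 'cV[C]_p) : R := complex.Re ((u *m v) 0 0).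

Lemma Re_formD p (u : 'rV[C]_p) v w : Re_form u (v + w) = Re_form u v + Re_form u w.
Proof. by rewrite /Re_form mulmxDr mxE; case: (_ 0 0); case: (_ 0 0). Qed.

Lemma Re_formN p (u : 'rV[C]_p) v : Re_form u (- v) = - Re_form u v.
Proof. by rewrite /Re_form mulmxN mxE; case: (_ 0 0). Qed.

Lemma Re_form_sum p (u : 'rV[C]_p) I (r : seq I) (F : I -> 'cV[C]_p) :
  Re_form u (\sum_(i <- r) F i) = \sum_(i <- r) Re_form u (F i).
Proof.
elim: r => [|i r IH]; last by rewrite !big_cons Re_formD IH.
by rewrite !big_nil /Re_form mulmx0 mxE.
Qed.

Lemma Re_form_le p (u : 'rV[C]_p) v (e : R) : (forall k, normc (u 0 k) <= e) ->
  `|Re_form u v| <= e * wnorm 1 v.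
Proof.
move=> ue; apply: le_trans (Re_le_normc _) _.
rewrite mxE /wnorm mulr_sumr.
elim/big_ind2 : _ => [|x1 x2 y1 y2 h1 h2|k _]; first by rewrite Normc.normc0.
  exact: le_trans (le_normcD _ _) (lerD h1 h2).
by rewrite expr1n mul1r Normc.normcM ler_wpM2r// normc_ge0.
Qed.

Lemma measurable_Re_form d' (T : measurableType d') p (u : 'rV[C]_p) (f : T -> 'cV[C]_p) :
  measurable_fun setT f -> measurable_fun setT (fun w => Re_form u (f w)).
Proof.
move=> mf.
exact: (measurableT_comp (@measurable_Re R) (measurable_fun_mxE 0 0 (measurable_fun_mulmx u mf))).
Qed.

(** Of the remainder terms one only needs to know which of the independent
    vectors [Z j] they involve. *)
Definition lin_comb (s : seq int) p (W : Omega -> 'cV[C]_p) :=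
  exists D : int -> 'M[C]_(p, d), forall w, W w = \sum_(j <- s) D j *m Z j w.

Lemma lin_combD s p (V W : Omega -> 'cV[C]_p) :
  lin_comb s V -> lin_comb s W -> lin_comb s (fun w => V w + W w).
Proof.
move=> [D hD] [D' hD']; exists (fun j => D j + D' j) => w.
by rewrite hD hD' -big_split/=; apply: eq_bigr => j _; rewrite mulmxDl.
Qed.

Lemma lin_comb_mulmx s p q (A : 'M[C]_(q, p)) (V : Omega -> 'cV[C]_p) :
  lin_comb s V -> lin_comb s (fun w => A *m V w).
Proof.
move=> [D hD]; exists (fun j => A *m D j) => w.
by rewrite hD mulmx_sumr; apply: eq_bigr => j _; rewrite mulmxA.
Qed.

Lemma lin_comb0 s p : lin_comb s (fun=> 0 : 'cV[C]_p).
Proof. by exists (fun=> 0) => w; rewrite big1// => j _; rewrite mul0mx. Qed.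

Lemma lin_comb_coord s p (A : 'M[C]_(p, d)) k : uniq s -> k \in s ->
  lin_comb s (fun w => A *m Z k w).
Proof.
move=> us ks; exists (fun j => if j == k then A else 0) => w.
rewrite (bigD1_seq k)//= eqxx big1 ?addr0// => j /negPf ->.
by rewrite mul0mx.
Qed.

Lemma lin_comb_sum s p I (r : seq I) (F : I -> Omega -> 'cV[C]_p) :
  (forall i, lin_comb s (F i)) -> lin_comb s (fun w => \sum_(i <- r) F i w).
Proof.
move=> hF; elim: r => [|i r IH].
  by under eq_fun do rewrite big_nil; exact: lin_comb0.
by under eq_fun do rewrite big_cons; exact: lin_combD.
Qed.

Lemma cos_near0 (c : R) : c < 1 ->
  exists2 e : R, 0 < e & forall x : R, `|x| <= e -> c <= cos x.
Proof.
move=> c1; have := @continuous_cos R 0; rewrite /continuous_at cos0.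
move=> /cvgrPdist_le/(_ (1 - c)); rewrite subr_gt0 => /(_ c1).
move=> /nbhs_ballP[e /= e0 he]; exists (e / 2); first by rewrite divr_gt0.
move=> x xe; have : ball 0 e x.
  rewrite /ball/= sub0r normrN (le_lt_trans xe)// ltr_pdivrMr// mulr2n mulrDr mulr1.
  by rewrite ltrDl.
move=> /he; rewrite ler_norml => /andP[_]; lra.
Qed.

(** Tightness keeps the characteristic functions of the [T n] away from zero
    near the origin, hence also those of the independent blocks
    [\sum_(i < n) B i *m Z (tau n i)], whatever the other summands are. For
    these, the squared modulus is the product of the expectations of
    [cos (Re_form u (B i *m (Z 0 - Z 1)))], and a product of numbers in [0, 1]
    bounded below bounds the sum of their distances to 1. *)
Lemma tight_sum_cf p (T : nat -> Omega -> 'cV[C]_p) (B : nat -> 'M[C]_(p, d))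
    (tau : nat -> nat -> int) (s : nat -> seq int) :
  tight P T ->
  (forall n, uniq ([seq tau n i | i <- iota 0 n] ++ s n)) ->
  (forall n, exists V, lin_comb (s n) V /\
    {ae P, forall w, T n w = \sum_(i < n) B i *m Z (tau n i) w + V w}) ->
  exists2 e : R, 0 < e & forall u : 'rV[C]_p, (forall k, normc (u 0 k) <= e) ->
    forall n, \sum_(i < n) (1 - \int[P]_w cos (Re_form u (B i *m (Z 0 w - Z 1 w)))) <= 3.
Proof.
move=> [mT tT] us hT.
have [eta eta0 heta] : exists2 e : R, 0 < e & forall x : R, `|x| <= e -> 3 / 4 <= cos x.
  by apply: cos_near0; lra.
have [K0 hK0] := tT (1 / 8) ltac:(lra).
pose K := Num.max K0 1.
have K_gt0 : 0 < K by rewrite lt_max ltr01 orbT.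
exists (eta / K); first by rewrite divr_gt0.
move=> u hu n.
have [V [[D hD] hV]] := hT n.
(* [M] lists the times of the block, and [a j] is the contribution of [Z j] *)
pose M := [seq tau n i | i <- iota 0 n].
have sM : size M = n by rewrite size_map size_iota.
have uM : uniq M by have := us n; rewrite cat_uniq => /andP[].
have nM i : (i < n)%N -> nth 0 M i = tau n i.
  by move=> hi; rewrite (nth_map 0%N) ?size_iota// nth_iota.
pose a (j : int) (z : 'cV[C]_d) :=
  Re_form u ((if j \in M then B (index j M) else D j) *m z).
have ma j : measurable_fun setT (a j).
  by apply: measurable_Re_form; apply: measurable_fun_mulmx; exact: measurable_id.
have TE : {ae P, forall w, Re_form u (T n w) = \sum_(j <- M ++ s n) a j (Z j w)}.
  apply: filterS hV => w ->; rewrite hD Re_formD big_cat/=; congr (_ + _).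
    rewrite -(big_mkord xpredT (fun i => B i *m Z (tau n i) w)) Re_form_sum.
    rewrite [RHS](big_nth 0) sM !big_mkord.
    apply: eq_bigr => i _; have hi : (i < size M)%N by rewrite sM.
    by rewrite /a (mem_nth 0 hi) (index_uniq 0 hi uM) nM.
  rewrite Re_form_sum; apply: eq_big_seq => j js; rewrite /a; case: ifPn => // jM.
  have := us n; rewrite cat_uniq => /and3P[_ /hasPn/(_ _ js)].
  by rewrite /M in jM; rewrite /= jM.
have mTn : measurable_fun setT (fun w => Re_form u (T n w)) by exact: measurable_Re_form.
(* the cosine is at least [3 / 4] off [A], and at least [3 / 4 - 2] on [A] *)
have cosT : 1 / 2 <= \int[P]_w cos (Re_form u (T n w)).
  pose A := [set w | K < wnorm 1 (T n w)].
  have mA : measurable A by apply: measurable_gt_set; exact: measurable_wnorm.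
  have PA : fine (P A) <= 1 / 8.
    rewrite -lee_fin fineK ?fin_num_measure//.
    apply: le_trans (hK0 n); apply: le_measure; rewrite ?inE//.
      by apply: measurable_gt_set; exact: measurable_wnorm.
    by move=> w; rewrite /A/=; apply: le_lt_trans; rewrite le_max lexx.
  have bA : bounded_measurable (\1_A : Omega -> R) by exact: bounded_measurable_indic.
  have b2A := bounded_measurableM (bounded_measurable_cst 2) bA.
  apply: (@le_trans _ _ (\int[P]_w (3 / 4 - 2 * \1_A w))).
    rewrite RintegralB_bounded//; last exact: bounded_measurable_cst.
    by rewrite Rintegral_cst_proba RintegralZl_bounded// Rintegral_indic//; lra.
  apply: le_Rintegral_bounded.
  - by apply: bounded_measurableB => //; exact: bounded_measurable_cst.
  - exact: bounded_measurable_cos.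
  move=> w; rewrite indicE; have [wA|wA] := boolP (w \in A).
    by have := cos_geN1 (Re_form u (T n w)); rewrite mulr1; lra.
  rewrite mulr0 subr0; apply: heta.
  apply: le_trans (Re_form_le _ hu) _.
  have : wnorm 1 (T n w) <= K by rewrite leNgt; apply/negP => h; move: wA; rewrite notin_setE.
  by move=> h; rewrite -mulrA ger_pMr// ler_pdivrMl// mulr1.
have mS : measurable_fun setT (fun w => \sum_(j <- M ++ s n) a j (Z j w)).
  by apply: measurable_sum => j; exact: measurableT_comp.
have rhoS : 1 / 4 <= sqnorm_cf P (fun w => \sum_(j <- M ++ s n) a j (Z j w)).
  rewrite /sqnorm_cf.
  have -> : \int[P]_w cos (\sum_(j <- M ++ s n) a j (Z j w)) =
      \int[P]_w cos (Re_form u (T n w)).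
    apply: eq_Rintegral_ae; [exact: bounded_measurable_cos|exact: bounded_measurable_cos|].
    by apply: filterS TE => w ->.
  have := sqr_ge0 (\int[P]_w sin (\sum_(j <- M ++ s n) a j (Z j w))).
  by move: cosT; set c := \int[P]_w _; nra.
rewrite (sqnorm_cf_sum hZ (us n) ma) big_cat/= in rhoS.
have rho01 j : 0 <= sqnorm_cf P (fun w => a j (Z j w)) <= 1.
  by rewrite sqnorm_cf_ge0 sqnorm_cf_le1//; exact: measurableT_comp.
have rhoM : 1 / 4 <= \prod_(j <- M) sqnorm_cf P (fun w => a j (Z j w)).
  apply: le_trans rhoS _; rewrite ler_piMr//.
    by apply: prodr_ge0 => j _; have /andP[] := rho01 j.
  by apply: prodr_ile1 => j _; exact: rho01.
pose x i := \int[P]_w cos (Re_form u (B i *m (Z 0 w - Z 1 w))).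
have xE i : x i = sqnorm_cf P (fun w => Re_form u (B i *m Z 0 w)).
  rewrite (@sqnorm_cf_copy _ _ _ P _ _ Z hZ (fun z => Re_form u (B i *m z)))//; last first.
    by apply: measurable_Re_form; apply: measurable_fun_mulmx; exact: measurable_id.
  by apply: eq_Rintegral => w _; rewrite mulmxBr Re_formD Re_formN.
have -> : (3 : R) = (1 / 4)^-1 - 1 by lra.
apply: (@prod_lower_bound_sum R n x); [|by lra|].
  move=> i; rewrite xE sqnorm_cf_ge0 sqnorm_cf_le1//.
  by apply: measurable_Re_form; exact: measurable_fun_mulmx.
apply: le_trans rhoM _; rewrite (big_nth 0) sM big_mkord le_eqVlt; apply/orP; left; apply/eqP.
apply: eq_bigr => i _; have hi : (i < size M)%N by rewrite sM.
rewrite xE /a (mem_nth 0 hi) (index_uniq 0 hi uM).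
have mBi : measurable_fun setT (fun z : 'cV[C]_d => Re_form u (B i *m z)).
  by apply: measurable_Re_form; apply: measurable_fun_mulmx; exact: measurable_id.
by rewrite (sqnorm_cf_copy hZ (nth 0 M i) mBi) (sqnorm_cf_copy hZ 0 mBi).
Qed.

End tight_independent_sums.

(** * Degeneracy for eigenvalues of modulus one *)

Section iid_constant.
Context {R : realType} {dO : measure_display} {Omega : measurableType dO}.
Variable P : probability Omega R.
Context {dE : measure_display} {E : measurableType dE}.
Variable Z : int -> Omega -> E.
Hypothesis hZ : iid P Z.

Let mZ i : measurable_fun setT (Z i). Proof. by case: hZ. Qed.

Lemma independent2_Z01 : independent2 P (Z 0) (Z 1).
Proof.
move=> A B mA mB; apply: (independent_coord hZ) => //.
by apply: sub_sigma_algebra; exact: cylinders_coord.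
Qed.

(** The bounded variable [atan (a (Z 0))] has zero variance, being equal to
    its own independent copy. *)
Lemma iid_ae_eq_cst (a : E -> R) : measurable_fun setT a ->
  {ae P, forall w, a (Z 0 w) = a (Z 1 w)} -> exists c, {ae P, forall w, a (Z 0 w) = c}.
Proof.
move=> ma a01; pose f x := atan (a x).
have bf : bounded_measurable f.
  split; first by apply: measurableT_comp ma; apply: continuous_measurable_fun => x; exact: continuous_atan.
  exists (pi / 2) => x; rewrite ler_norml; apply/andP; split; apply: ltW.
    exact: atan_gtNpi2.
  exact: atan_ltpi2.
have bfZ i : bounded_measurable (fun w => f (Z i w)).
  have [mf [M fM]] := bf; split; first exact: measurableT_comp.
  by exists M => w; exact: fM.
pose m := \int[P]_w f (Z 0 w).
exists (tan m).
have h2 : \int[P]_w (f (Z 0 w) * f (Z 0 w)) = m * m.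
  rewrite [X in _ = _ * X](identically_distributed_Rintegral hZ 0 1 bf).
  rewrite -(independent2_Rintegral (mZ 0) (mZ 1) independent2_Z01 bf bf).
  apply: eq_Rintegral_ae; [exact: bounded_measurableM|exact: bounded_measurableM|].
  by apply: filterS a01 => w; rewrite /f => ->.
have bc := bounded_measurable_cst (T := Omega) m.
have bd := bounded_measurableB (bfZ 0) bc.
have bmf := bounded_measurableM bc (bfZ 0).
have : {ae P, forall w, (f (Z 0 w) - m) * (f (Z 0 w) - m) = 0}.
  apply: bounded_Rintegral0_ae; first exact: bounded_measurableM.
    by move=> w; rewrite -expr2 sqr_ge0.
  have -> : \int[P]_w ((f (Z 0 w) - m) * (f (Z 0 w) - m)) =
      \int[P]_w (f (Z 0 w) * f (Z 0 w) - (m * f (Z 0 w) + (m * f (Z 0 w) - m * m))).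
    by apply: eq_Rintegral => w _; ring.
  have bmm := bounded_measurable_cst (T := Omega) (m * m).
  have bmd := bounded_measurableB bmf bmm.
  rewrite RintegralB_bounded; [|exact: bounded_measurableM|exact: bounded_measurableD].
  rewrite RintegralD_bounded// RintegralB_bounded// RintegralZl_bounded//.
  by rewrite Rintegral_cst_proba h2 -/m; ring.
apply: filterS => w /eqP; rewrite mulf_eq0 orbb subr_eq0 => /eqP <-.
by rewrite atanK.
Qed.

End iid_constant.

Section unit_modulus.
Context {R : realType} {dO : measure_display} {Omega : measurableType dO}.
Variable P : probability Omega R.
Local Notation C := R[i].
Local Notation normc := Normc.normc.
Variables (d : nat) (Z : int -> Omega -> 'cV[C]_d).
Hypothesis hZ : iid P Z.

Let mZ i : measurable_fun setT (Z i). Proof. by case: hZ. Qed.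

Lemma iid_ae_eq_cst_vec p (N : 'M[C]_(p, d)) :
  {ae P, forall w, N *m (Z 0 w - Z 1 w) = 0} ->
  exists alpha : 'cV[C]_p, {ae P, forall w, N *m Z 0 w = alpha}.
Proof.
move=> h.
have mN k : measurable_fun setT (fun z : 'cV[C]_d => (N *m z) k 0).
  by apply: measurable_fun_mxE; apply: measurable_fun_mulmx; exact: measurable_id.
have hk (k : 'I_p) : exists c : C, {ae P, forall w, (N *m Z 0 w) k 0 = c}.
  have hRe : {ae P, forall w, complex.Re ((N *m Z 0 w) k 0) = complex.Re ((N *m Z 1 w) k 0)}.
    by apply: filterS h => w; rewrite mulmxBr => /subr0_eq ->.
  have hIm : {ae P, forall w, complex.Im ((N *m Z 0 w) k 0) = complex.Im ((N *m Z 1 w) k 0)}.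
    by apply: filterS h => w; rewrite mulmxBr => /subr0_eq ->.
  have [x hx] := iid_ae_eq_cst hZ (measurableT_comp (@measurable_Re R) (mN k)) hRe.
  have [y hy] := iid_ae_eq_cst hZ (measurableT_comp (@measurable_Im R) (mN k)) hIm.
  exists (x +i* y); apply: filterS2 hx hy => w /= <- <-.
  by case: (_ k 0).
have [c hc] := choice hk.
exists (\col_k c k).
have : {ae P, forall w, forall k, (N *m Z 0 w) k 0 = c k} by apply: filter_forall.
by apply: filterS => w hw; apply/colP => k; rewrite hw mxE.
Qed.

Lemma Re_form_delta p (c : C) (k : 'I_p) (v : 'cV[C]_p) :
  Re_form (c *: delta_mx 0 k) v = complex.Re (c * v k 0).
Proof. by rewrite /Re_form -scalemxAl mxE -rowE mxE. Qed.

Lemma normc_delta p (c : C) (k j : 'I_p) :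
  normc ((c *: delta_mx 0 k : 'rV[C]_p) 0 j) <= normc c.
Proof.
rewrite !mxE eqxx/=; case: eqP => _; first by rewrite mulr1.
by rewrite mulr0 Normc.normc0 normc_ge0.
Qed.

(** The real or the imaginary part of [z] has absolute value at least [a / 2],
    and the cosine decreases on [[0, 1]]. *)
Lemma cos_lower_bound (z : C) (x a L : R) : 0 <= a -> a <= normc z <= L -> 0 <= x ->
  x * L <= 1 ->
  1 - cos (x * (a / 2)) <= (1 - cos (x * complex.Re z)) + (1 - cos (x * complex.Im z)).
Proof.
move=> a0 /andP[az zL] x0 xL.
have key (y : R) : a / 2 <= `|y| -> `|y| <= normc z -> cos (x * y) <= cos (x * (a / 2)).
  move=> ay yz; rewrite -cos_norm normrM (ger0_norm x0).
  have h1 : x * (a / 2) <= x * `|y| by rewrite ler_wpM2l.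
  have h2 : x * `|y| <= x * L by rewrite ler_wpM2l// (le_trans yz).
  have h0 : 0 <= x * (a / 2) by rewrite mulr_ge0// divr_ge0.
  have := @pi_ge2 R => p2.
  have [->//|neq] := eqVneq (x * `|y|) (x * (a / 2)).
  apply: ltW; rewrite ltr_cos ?lt_neqAle 1?eq_sym ?neq// in_itv/=; apply/andP; split => //; lra.
have [h|h] := leP (a / 2) `|complex.Re z|.
  have := key _ h (Re_le_normc z); have := cos_le1 (x * complex.Im z); lra.
have h' : a / 2 <= `|complex.Im z| by have := normc_le_ReIm z; lra.
have := key _ h' (Im_le_normc z); have := cos_le1 (x * complex.Re z); lra.
Qed.

(** Induction on the component [k] of [z = N *m (Z 0 - Z 1)]: once the components
    before [k] vanish, the [k]-th component of the [i]-th vector is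
    [l ^+ i * z_k], whose modulus does not depend on [i]. Every term of the
    bounded sums is then at least a positive constant times
    [P (a <= |z_k| <= L)], so that this probability is zero. *)
Lemma unit_modulus_ae_cst p (l : C) (N : 'M[C]_(p, d)) (e : R) : normc l = 1 -> 0 < e ->
  (forall u : 'rV[C]_p, (forall k, normc (u 0 k) <= e) -> forall n,
    \sum_(i < n) (1 - \int[P]_w cos (Re_form u
       ((jordan_block p l ^+ i *m N) *m (Z 0 w - Z 1 w)))) <= 3) ->
  exists alpha : 'cV[C]_p, {ae P, forall w, N *m Z 0 w = alpha}.
Proof.
move=> l1 e0 hcf; apply: iid_ae_eq_cst_vec.
pose z w := N *m (Z 0 w - Z 1 w).
have mz : measurable_fun setT z by apply: measurable_fun_mulmx; exact: measurable_fun_mxB.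
suff hz (k : 'I_p) : {ae P, forall w, z w k 0 = 0}.
  have : {ae P, forall w, forall k, z w k 0 = 0} by apply: filter_forall.
  by apply: filterS => w hw; apply/colP => k; rewrite -/(z w) hw mxE.
have [n] := ubnP (val k); elim: n k => // n IH k kn.
have {IH} hlow : {ae P, forall w, forall j : 'I_p, (j < k)%N -> z w j 0 = 0}.
  apply: filter_forall => j; have [jk|kj] := ltnP j k; last by apply: nearW.
  have := IH j (leq_trans jk (ltnSE kn)).
  by apply: filterS => w ->.
(* where the components before [k] vanish, the powers of the block act on
   component [k] as the powers of [l] *)
have hpow : {ae P, forall w, forall i, (jordan_block p l ^+ i *m z w) k 0 = l ^+ i * z w k 0}.
  apply: filterS hlow => w hw i.
  rewrite -[jordan_block p l ^+ i](subrK (l ^+ i)%:M) mulmxDl mul_scalar_mx !mxE.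
  rewrite big1 ?add0r// => j _; have [jk|kj] := ltnP j k; first by rewrite hw// mulr0.
  by rewrite (lower_band_jordanX l i) ?mul0r// addn1 ltnS.
have mzk : measurable_fun setT (fun w => z w k 0) by exact: measurable_fun_mxE.
have bound (a L : R) : 0 < a -> 0 < L -> P [set w | a <= normc (z w k 0) <= L] = 0%E.
  move=> a0 L0.
  have mA : measurable [set w | a <= normc (z w k 0) <= L].
    have mn : measurable_fun setT (fun w => normc (z w k 0)) by exact: measurable_normc.
    have -> : [set w | a <= normc (z w k 0) <= L] =
      setT `&` (fun w => normc (z w k 0)) @^-1` `[a, L].
      by rewrite setTI; apply/seteqP; split => w /=; rewrite in_itv.
    exact: mn.
  set A := [set w | _] in mA *.
  pose x := Num.min e L^-1.
  have x0 : 0 < x by rewrite lt_min e0 invr_gt0.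
  have xe : x <= e by rewrite ge_min lexx.
  have xL : x * L <= 1 by rewrite -ler_pdivlMr// div1r ge_min lexx orbT.
  pose c := 1 - cos (x * (a / 2)).
  have [aL|La] := leP a L; last first.
    rewrite (_ : A = set0) ?measure0//; apply/seteqP; split => // w /= /andP[h1 h2].
    by have := lt_le_trans La (le_trans h1 h2); rewrite ltxx.
  have c0 : 0 < c.
    rewrite subr_gt0 -[ltRHS]cos0 ltr_cos ?in_itv/= ?lexx ?pi_ge0//.
      by rewrite mulr_gt0// divr_gt0.
    have := @pi_ge2 R; have : x * (a / 2) <= x * L by rewrite ler_pM2l//; lra.
    have : 0 < x * (a / 2) by rewrite mulr_gt0// divr_gt0.
    by move=> h1 h2 h3; apply/andP; split; lra.
  have h3 (y : C) : normc y <= e -> forall n',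
     \sum_(i < n') (1 - \int[P]_w cos (complex.Re (y * (l ^+ i * z w k 0)))) <= 3.
    move=> ye n'; have := hcf (y *: delta_mx 0 k) (fun j => le_trans (normc_delta y k j) ye) n'.
    apply: le_trans; rewrite le_eqVlt; apply/orP; left; apply/eqP.
    apply: eq_bigr => i _; congr (1 - _).
    apply: eq_Rintegral_ae.
    - apply: bounded_measurable_cos; apply: (measurableT_comp (@measurable_Re R)).
      apply: measurable_fun_complexM; first exact: measurable_cst.
      by apply: measurable_fun_complexM => //; exact: measurable_cst.
    - apply: bounded_measurable_cos; apply: measurable_Re_form.
      by apply: measurable_fun_mulmx; exact: measurable_fun_mxB.
    apply: filterS hpow => w hw.
    by rewrite Re_form_delta -mulmxA hw.
  have nx : normc (x%:C : C) <= e by rewrite normc_real ger0_norm ?(ltW x0).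
  (* multiplying by [- i x] instead of [x] turns real parts into imaginary ones *)
  have nix : normc ((0 +i* (- x)) : C) <= e.
    by rewrite /= expr0n/= add0r sqrrN sqrtr_sqr ger0_norm ?(ltW x0).
  have Pn n' : n'%:R * (c * fine (P A)) <= 6.
    have := lerD (h3 _ nx n') (h3 _ nix n').
    rewrite -big_split/= (_ : 3 + 3 = 6 :> R); last by lra.
    apply: le_trans.
    have -> : n'%:R * (c * fine (P A)) = \sum_(i < n') (c * fine (P A)).
      by rewrite sumr_const card_ord mulr_natl.
    apply: ler_sum => i _.
    pose y w := l ^+ i * z w k 0.
    have my : measurable_fun setT y by apply: measurable_fun_complexM => //; exact: measurable_cst.
    have mr : measurable_fun setT (fun w => complex.Re (x%:C * y w)).
      apply: (measurableT_comp (@measurable_Re R)).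
      exact: (@measurable_fun_complexM _ _ _ (fun=> x%:C) _ (measurable_cst _) my).
    have mi : measurable_fun setT (fun w => complex.Re ((0 +i* (- x)) * y w)).
      apply: (measurableT_comp (@measurable_Re R)).
      exact: (@measurable_fun_complexM _ _ _ (fun=> 0 +i* (- x)) _ (measurable_cst _) my).
    have b1 := bounded_measurable_cst (T := Omega) (1 : R).
    have br := bounded_measurableB b1 (bounded_measurable_cos mr).
    have bi := bounded_measurableB b1 (bounded_measurable_cos mi).
    have bA : bounded_measurable (\1_A : Omega -> R) by exact: bounded_measurable_indic.
    have -> : c * fine (P A) = \int[P]_w (c * \1_A w).
      by rewrite RintegralZl_bounded// Rintegral_indic.
    apply: (@le_trans _ _ (\int[P]_w ((1 - cos (complex.Re (x%:C * y w)))
        + (1 - cos (complex.Re ((0 +i* (- x)) * y w)))))); last first.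
      rewrite RintegralD_bounded// !RintegralB_bounded ?Rintegral_cst_proba//;
        exact: bounded_measurable_cos.
    apply: le_Rintegral_bounded; [|exact: bounded_measurableD|].
      by apply: bounded_measurableM => //; exact: bounded_measurable_cst.
    move=> w; have -> : complex.Re (x%:C * y w) = x * complex.Re (y w).
      by case: (y w) => ? ?; simpc.
    have -> : complex.Re ((0 +i* (- x)) * y w) = x * complex.Im (y w).
      by case: (y w) => ? ?; simpc => /=; ring.
    rewrite indicE; have [/set_mem wA|_] := boolP (w \in A).
      rewrite mulr1; apply: (@cos_lower_bound _ _ _ L) => //; try exact: ltW.
      by rewrite /y Normc.normcM normcX l1 expr1n mul1r.
    by rewrite mulr0 addr_ge0// subr_ge0 cos_le1.
  have PA0 : 0 <= fine (P A) by exact: fine_ge0.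
  rewrite -[P A]fineK ?fin_num_measure//; congr EFin; apply/eqP; rewrite eq_le PA0 andbT.
  rewrite leNgt; apply/negP => PAp.
  have cP : 0 < c * fine (P A) by rewrite mulr_gt0.
  have := archi_boundP (ltW (divr_gt0 (ltr0n R 6) cP)); set n' := Num.bound _ => hn'.
  by have := Pn n'; rewrite leNgt -ltr_pdivrMr// hn'.
have : P.-negligible (\bigcup_(m in setT) [set w | m.+1%:R^-1 <= normc (z w k 0) <= m.+1%:R]).
  apply: negligible_bigcup => m; apply/negligibleP; last exact: bound.
  have mn : measurable_fun setT (fun w => normc (z w k 0)) by exact: measurable_normc.
  have -> : [set w | m.+1%:R^-1 <= normc (z w k 0) <= m.+1%:R] =
    setT `&` (fun w => normc (z w k 0)) @^-1` `[m.+1%:R^-1, m.+1%:R].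
    by rewrite setTI; apply/seteqP; split => w /=; rewrite in_itv.
  exact: mn.
apply: negligibleS => w /= nz.
have nz0 : 0 < normc (z w k 0).
  rewrite lt_neqAle normc_ge0 andbT eq_sym; apply/eqP => /Normc.eq0_normc; exact: nz.
have := archi_boundP (ltW (ltr_wpDr (ltW nz0) (divr_gt0 ltr01 nz0))).
set m := Num.bound _ => hm.
have nI : 0 < 1 / normc (z w k 0) by rewrite divr_gt0.
have mm : (m%:R : R) <= m.+1%:R by rewrite ler_nat.
exists m => //=; apply/andP; split; last by lra.
by rewrite invf_ple ?posrE// -div1r; lra.
Qed.

End unit_modulus.

(** * Logarithmic moments *)

Section dirichlet.
Context {R : realType}.

Lemma sin_half_bound : exists2 e : R, 0 < e & forall x, 0 <= x <= e -> x / 2 <= sin x.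
Proof.
have [e e0 he] : exists2 e : R, 0 < e & forall x : R, `|x| <= e -> 1 / 2 <= cos x.
  by apply: cos_near0; lra.
exists e => // x /andP[x0 xe].
have [c /[!in_itv]/= /andP[c0 cx]] :
    exists2 c, c \in `[0, x]%R & sin x - sin 0 = cos c * (x - 0).
  apply: MVT_segment => //; apply: continuous_subspaceT.
  exact: continuous_sin.
rewrite sin0 !subr0 => ->.
have : 1 / 2 <= cos c by apply: he; rewrite ger0_norm// (le_trans cx).
by move=> h; rewrite mulrC ler_wpM2r//; lra.
Qed.

(** Averaging [1 - cos (u y)] over an equidistant grid of values of [u] in
    [0, 1]: the sum of the cosines is a Dirichlet kernel, small unless [y] is
    close to zero or large with respect to the number of points of the grid. *)
Lemma dirichlet_average : exists2 e : R, 0 < e & forall m (y : R),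
  (0 < m)%N -> 8 <= `|y| -> `|y| <= e * m%:R ->
  m%:R / 2 <= \sum_(k < m) (1 - cos (k.+1%:R / m%:R * y)).
Proof.
have [e e0 he] := sin_half_bound.
exists (2 * e); first by rewrite mulr_gt0.
move=> m y m0 y8 ye.
have m0R : 0 < m%:R :> R by rewrite ltr0n.
pose h := `|y| / m%:R.
have h0 : 0 < h by rewrite divr_gt0//; lra.
have hE k : cos (k.+1%:R / m%:R * y) = cos (k.+1%:R * h).
  rewrite -cos_norm normrM ger0_norm; last by rewrite divr_ge0.
  by congr cos; rewrite /h; field; lra.
under eq_bigr do rewrite hE.
rewrite sumrB sumr_const card_ord.
set s := \sum_(k < m) cos _.
(* multiplied by [2 sin (h / 2)], the sum of the cosines telescopes *)
have tel : 2 * sin (h / 2) * s = sin (m%:R * h + h / 2) - sin (h / 2).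
  rewrite /s mulr_sumr.
  have -> : sin (m%:R * h + h / 2) - sin (h / 2) =
      \sum_(0 <= k < m) (sin (k.+1%:R * h + h / 2) - sin (k%:R * h + h / 2)).
    by rewrite (telescope_sumr (fun k => sin (k%:R * h + h / 2)))// mul0r add0r.
  rewrite big_mkord; apply: eq_bigr => k _.
  have -> : (k%:R : R) * h + h / 2 = k.+1%:R * h - h / 2 by rewrite -natr1; field.
  by rewrite sinD sinB; ring.
have hs : h / 4 <= sin (h / 2).
  have : h / 2 / 2 <= sin (h / 2).
    apply: he; apply/andP; split; first lra.
    by rewrite /h ler_pdivrMr// ler_pdivrMr//; lra.
  by apply: le_trans; lra.
suff : s <= m%:R / 2 by lra.
rewrite leNgt; apply/negP => sm.
have s0 : 0 < s by apply: lt_trans sm; rewrite divr_gt0.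
have h1 : 2 * (h / 4) * s <= 2.
  apply: (@le_trans _ _ (2 * sin (h / 2) * s)).
    by rewrite ler_wpM2r//; [exact: ltW|lra].
  rewrite tel; have := sin_le1 (m%:R * h + h / 2); have := sin_geN1 (h / 2); lra.
have h2 : 2 * (h / 4) * (m%:R / 2) < 2 * (h / 4) * s by rewrite ltr_pM2l//; lra.
have h3 : 2 * (h / 4) * (m%:R / 2) = `|y| / 4 by rewrite /h; field; lra.
lra.
Qed.

End dirichlet.

Section log_moment.
Context {R : realType} {dO : measure_display} {Omega : measurableType dO}.
Variable P : probability Omega R.
Local Notation C := R[i].
Local Notation normc := Normc.normc.

Lemma indic_le (A : set Omega) (f : Omega -> R) :
  (forall w, 0 <= f w) -> (forall w, A w -> 1 <= f w) -> forall w, \1_A w <= f w.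
Proof.
move=> f0 hf w; rewrite indicE; have [/set_mem/hf//|_] := boolP (w \in A).
exact: f0.
Qed.

(** Average the hypothesis over a grid of values of [c] and use
    [dirichlet_average]. The grid must be fine compared with the size of the
    [Y i], which is arranged for fixed [n] off an event [B] of small
    probability. *)
Lemma sum_proba_le_of_cf (Y : nat -> Omega -> R) (e : R) :
  (forall i, measurable_fun setT (Y i)) -> 0 < e ->
  (forall c, 0 < c <= e -> forall n, \sum_(i < n) (1 - \int[P]_w cos (c * Y i w)) <= 3) ->
  forall n, \sum_(i < n) fine (P [set w | 8 / e < `|Y i w|]) <= 6.
Proof.
move=> mY e0 hY n; apply/ler_addgt0Pr => eps eps0.
have [eta eta0 heta] := @dirichlet_average R.
have mnY i : measurable_fun setT (fun w => `|Y i w|) by exact: measurableT_comp.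
have mS : measurable_fun setT (fun w => \sum_(i < n) `|Y i w|) by exact: measurable_sum.
have e'0 : 0 < eps / n.+1%:R by rewrite divr_gt0.
have [K hK] := real_tight P mS e'0.
pose L := e * Num.max K 0 / eta.
have L0 : 0 <= L.
  have M0 : 0 <= Num.max K 0 by rewrite le_max lexx orbT.
  by rewrite /L divr_ge0 ?mulr_ge0 ?(ltW e0) ?(ltW eta0).
have := archi_boundP L0; set m := Num.bound _ => Lm.
have m0 : (0 < m)%N by rewrite -(ltr0n R) (le_lt_trans L0).
have m0R : 0 < m%:R :> R by rewrite ltr0n.
pose A i := [set w | 8 / e < `|Y i w|].
pose B := [set w | K < \sum_(i < n) `|Y i w|].
have mA i : measurable (A i) by exact: measurable_gt_set.
have mB : measurable B by exact: measurable_gt_set.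
have bA i : bounded_measurable (\1_(A i) : Omega -> R) by exact: bounded_measurable_indic.
have bB : bounded_measurable (\1_B : Omega -> R) by exact: bounded_measurable_indic.
pose c (k : nat) : R := k.+1%:R / m%:R * e.
have bck i k : bounded_measurable (fun w => 1 - cos (c k * Y i w)).
  apply: bounded_measurableB; first exact: bounded_measurable_cst.
  by apply: bounded_measurable_cos; apply: measurable_funM => //; exact: measurable_cst.
have bsum i : bounded_measurable (fun w => \sum_(k < m) (1 - cos (c k * Y i w))).
  exact: bounded_measurable_sum.
have key i : (i < n)%N -> m%:R / 2 * fine (P (A i)) <=
    \sum_(k < m) (1 - \int[P]_w cos (c k * Y i w)) + m%:R / 2 * fine (P B).
  move=> ni.
  have -> : \sum_(k < m) (1 - \int[P]_w cos (c k * Y i w)) =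
      \int[P]_w \sum_(k < m) (1 - cos (c k * Y i w)).
    rewrite Rintegral_sum_bounded//; apply: eq_bigr => k _.
    rewrite RintegralB_bounded ?Rintegral_cst_proba//; first exact: bounded_measurable_cst.
    by apply: bounded_measurable_cos; apply: measurable_funM => //; exact: measurable_cst.
  rewrite -(Rintegral_indic P (mA i)) -(Rintegral_indic P mB) -!RintegralZl_bounded//.
  have bcB := bounded_measurableM (bounded_measurable_cst (T := Omega) (m%:R / 2)) bB.
  rewrite -RintegralD_bounded//.
  apply: le_Rintegral_bounded; [|exact: bounded_measurableD|].
    by apply: bounded_measurableM => //; exact: bounded_measurable_cst.
  move=> w; have s0 : 0 <= \sum_(k < m) (1 - cos (c k * Y i w)).
    by apply: sumr_ge0 => k _; rewrite subr_ge0 cos_le1.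
  rewrite !indicE; have [/set_mem wA|_] := boolP (w \in A i); last first.
    by rewrite mulr0 addr_ge0// mulr_ge0// divr_ge0.
  have [/set_mem wB|/negP wB] := boolP (w \in B).
    by rewrite lerDr.
  rewrite mulr0 addr0 mulr1.
  have ck k : cos (c k * Y i w) = cos (k.+1%:R / m%:R * (e * Y i w)) by rewrite /c mulrA.
  under eq_bigr do rewrite ck.
  apply: heta => //; rewrite normrM (ger0_norm (ltW e0)).
    by rewrite mulrC -ler_pdivrMr// ltW.
  have YK : `|Y i w| <= K.
    apply: (@le_trans _ _ (\sum_(i < n) `|Y i w|)).
      by rewrite (bigD1 (Ordinal ni))//= lerDl sumr_ge0.
    by rewrite leNgt; apply/negP => h; apply: wB; rewrite inE.
  have hL : e * Num.max K 0 <= m%:R * eta by rewrite -ler_pdivrMr// ltW.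
  rewrite [eta * _]mulrC; apply: le_trans hL; apply: ler_wpM2l; first exact: ltW.
  by rewrite le_max YK.
have PB : fine (P B) <= eps / n.+1%:R.
  by rewrite -lee_fin fineK ?fin_num_measure.
have : \sum_(i < n) (m%:R / 2 * fine (P (A i))) <=
    \sum_(i < n) (\sum_(k < m) (1 - \int[P]_w cos (c k * Y i w)) + m%:R / 2 * fine (P B)).
  by apply: ler_sum => i _; exact: key.
rewrite -mulr_sumr big_split/= exchange_big/= sumr_const card_ord => h.
have h3 : \sum_(k < m) \sum_(i < n) (1 - \int[P]_w cos (c k * Y i w)) <= 3 * m%:R.
  apply: (@le_trans _ _ (\sum_(k < m) 3)).
    apply: ler_sum => k _; apply: hY; rewrite /c; apply/andP; split.
      by rewrite mulr_gt0// divr_gt0.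
    by rewrite ger_pMl// ler_pdivrMr// mul1r ler_nat.
  by rewrite sumr_const card_ord mulr_natr.
have h4 : n%:R * fine (P B) <= eps.
  have : n%:R * fine (P B) <= n.+1%:R * (eps / n.+1%:R).
    by apply: ler_pM => //; [exact: fine_ge0|rewrite ler_nat].
  by rewrite mulrCA divff// mulr1.
rewrite -(ler_pM2l (x := m%:R / 2)); last by rewrite divr_gt0.
apply: le_trans h _; rewrite -mulr_natl mulrDr lerD//.
  by apply: le_trans h3 _; lra.
rewrite -mulrnAr; apply: ler_wpM2l; first by rewrite divr_ge0// mulr_ge0.
by rewrite -mulr_natl.
Qed.

Variables (d : nat) (Z : int -> Omega -> 'cV[C]_d).
Hypothesis hZ : iid P Z.

Let mZ i : measurable_fun setT (Z i). Proof. by case: hZ. Qed.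

(** From the symmetrised vector [N *m (Z 0 - Z 1)] back to [N *m Z 0]: with
    probability at least one half [N *m Z 1] stays below a fixed level. *)
Lemma contracting_sum_proba p (M : 'M[C]_p) (N : 'M[C]_(p, d)) (e a b dl : R) :
  contracting M e a b -> 0 < dl ->
  (forall u : 'rV[C]_p, (forall k, normc (u 0 k) <= dl) -> forall n,
    \sum_(i < n) (1 - \int[P]_w cos (Re_form u ((M ^+ i *m N) *m (Z 0 w - Z 1 w)))) <= 3) ->
  exists K c, 0 < K /\ forall n,
    \sum_(i < n) fine (P [set w | K < a ^+ i * wnorm e (N *m Z 0 w)]) <= c.
Proof.
move=> hM dl0 hcf; have [/andP[e0 e1] /andP[a0 a1] _ _] := hM.
pose v (i : nat) w := (M ^+ i *m N) *m (Z 0 w - Z 1 w).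
have mv i : measurable_fun setT (v i).
  by apply: measurable_fun_mulmx; exact: measurable_fun_mxB.
pose YR (k : 'I_p) (i : nat) w := complex.Re (v i w k 0).
pose YI (k : 'I_p) (i : nat) w := complex.Im (v i w k 0).
have mYR k i : measurable_fun setT (YR k i).
  by apply: (measurableT_comp (@measurable_Re R)); exact: measurable_fun_mxE.
have mYI k i : measurable_fun setT (YI k i).
  by apply: (measurableT_comp (@measurable_Im R)); exact: measurable_fun_mxE.
have hR k n : \sum_(i < n) fine (P [set w | 8 / dl < `|YR k i w|]) <= 6.
  apply: sum_proba_le_of_cf => // c /andP[c0 cdl] n'.
  have cn : normc (c%:C : C) <= dl by rewrite normc_real ger0_norm// ltW.
  have := hcf (c%:C *: delta_mx 0 k) (fun j => le_trans (normc_delta _ k j) cn) n'.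
  apply: le_trans; rewrite le_eqVlt; apply/orP; left; apply/eqP.
  apply: eq_bigr => i _; congr (1 - _); apply: eq_Rintegral => w _.
  by rewrite Re_form_delta -/(v i w) /YR; case: (v i w k 0) => ? ?; simpc.
have hI k n : \sum_(i < n) fine (P [set w | 8 / dl < `|YI k i w|]) <= 6.
  apply: sum_proba_le_of_cf => // c /andP[c0 cdl] n'.
  have cn : normc ((0 +i* (- c)) : C) <= dl.
    by rewrite /= expr0n/= add0r sqrrN sqrtr_sqr ger0_norm// ltW.
  have := hcf ((0 +i* (- c)) *: delta_mx 0 k) (fun j => le_trans (normc_delta _ k j) cn) n'.
  apply: le_trans; rewrite le_eqVlt; apply/orP; left; apply/eqP.
  apply: eq_bigr => i _; congr (1 - _); apply: eq_Rintegral => w _.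
  rewrite Re_form_delta -/(v i w) /YI; case: (v i w k 0) => ? ? /=.
  by congr cos; ring.
(* [wnorm 1] exceeds [K0] only if the real or the imaginary part of some entry
   exceeds [8 / dl] *)
pose K0 : R := p%:R * (8 / dl + 8 / dl).
have K00 : 0 <= K0 by rewrite mulr_ge0// addr_ge0// divr_ge0// ltW.
have mK0 i : measurable [set w | K0 < wnorm 1 (v i w)].
  by apply: measurable_gt_set; exact: measurable_wnorm.
have mAR k i : measurable [set w | 8 / dl < `|YR k i w|].
  by apply: measurable_gt_set; exact: measurableT_comp.
have mAI k i : measurable [set w | 8 / dl < `|YI k i w|].
  by apply: measurable_gt_set; exact: measurableT_comp.
have union i : fine (P [set w | K0 < wnorm 1 (v i w)]) <=
   \sum_(k < p) (fine (P [set w | 8 / dl < `|YR k i w|]) + fine (P [set w | 8 / dl < `|YI k i w|])).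
  pose f (k : 'I_p) w : R := \1_[set w | 8 / dl < `|YR k i w|] w + \1_[set w | 8 / dl < `|YI k i w|] w.
  have bf k : bounded_measurable (f k).
    by apply: bounded_measurableD; exact: bounded_measurable_indic.
  have -> : \sum_(k < p) (fine (P [set w | 8 / dl < `|YR k i w|])
      + fine (P [set w | 8 / dl < `|YI k i w|])) = \int[P]_w \sum_(k < p) f k w.
    rewrite Rintegral_sum_bounded//; apply: eq_bigr => k _.
    by rewrite RintegralD_bounded ?Rintegral_indic//; exact: bounded_measurable_indic.
  rewrite -Rintegral_indic//; apply: le_Rintegral_bounded.
  - exact: bounded_measurable_indic.
  - exact: bounded_measurable_sum.
  have f0 k w : 0 <= f k w by rewrite addr_ge0// indicE.
  apply: indic_le => [w|w /= hw]; first exact: sumr_ge0.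
  have [/existsP[k hk]|/existsPn hk] := boolP [exists k : 'I_p, 1 <= f k w].
    by rewrite (bigD1 k)//= (le_trans hk)// lerDl sumr_ge0.
  move: hw; rewrite ltNge => /negP[]; rewrite /K0 /wnorm.
  have -> : p%:R * (8 / dl + 8 / dl) = \sum_(k < p) (8 / dl + 8 / dl).
    by rewrite sumr_const card_ord mulr_natl.
  apply: ler_sum => k _; rewrite expr1n mul1r.
  apply: le_trans (normc_le_ReIm _) _.
  have := hk k; rewrite -ltNge /f !indicE.
  have [_|nR] := boolP (w \in _); first by rewrite ltNge lerDl ler0n.
  have [_|nI] := boolP (w \in _); first by rewrite add0r ltxx.
  move=> _; apply: lerD; rewrite leNgt; apply/negP => h.
    by move: nR; rewrite notin_setE.
  by move: nI; rewrite notin_setE.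
have hK0 n : \sum_(i < n) fine (P [set w | K0 < wnorm 1 (v i w)]) <= p%:R * 12.
  apply: (@le_trans _ _ (\sum_(i < n) \sum_(k < p)
    (fine (P [set w | 8 / dl < `|YR k i w|]) + fine (P [set w | 8 / dl < `|YI k i w|])))).
    by apply: ler_sum => i _.
  rewrite exchange_big/=.
  have -> : p%:R * 12 = \sum_(k < p) (6 + 6) :> R.
    by rewrite sumr_const card_ord mulr_natl; congr (_ *+ _); lra.
  by apply: ler_sum => k _; rewrite big_split/=; apply: lerD; [exact: hR|exact: hI].
have mN i : measurable_fun setT (fun w => wnorm e (N *m Z i w)).
  by apply: measurable_wnorm; exact: measurable_fun_mulmx.
have [b1 hb1] := real_tight P (mN 1) (ltac:(lra) : 0 < 1 / 2).
pose bb := Num.max b1 0.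
have bb0 : 0 <= bb by rewrite le_max lexx orbT.
exists (K0 + bb + 1), (2 * (p%:R * 12)); split; first by lra.
move=> n; apply: le_trans (ler_wpM2l _ (hK0 n)); last by [].
rewrite mulr_sumr; apply: ler_sum => i _.
pose E0 : set 'cV[C]_d := [set z | K0 + bb + 1 < a ^+ i * wnorm e (N *m z)].
pose E1 : set 'cV[C]_d := [set z | wnorm e (N *m z) <= bb].
have mNz : measurable_fun setT (fun z : 'cV[C]_d => wnorm e (N *m z)).
  by apply: measurable_wnorm; apply: measurable_fun_mulmx; exact: measurable_id.
have mE0 : measurable E0.
  by apply: measurable_gt_set; apply: measurable_funM => //; exact: measurable_cst.
have mE1 : measurable E1 by exact: measurable_le_set.
have PE1 : 1 / 2 <= fine (P (Z 1 @^-1` E1)).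
  have mE1' : measurable (Z 1 @^-1` E1) by rewrite -[X in measurable X]setTI; exact: mZ.
  have : (P (~` (Z 1 @^-1` E1)) <= (1 / 2)%:E)%E.
    apply: le_trans hb1; apply: le_measure; rewrite ?inE.
    - exact: measurableC.
    - exact: measurable_gt_set.
    - move=> w /= /negP; rewrite -ltNge; apply: le_lt_trans.
      by rewrite le_max lexx.
  rewrite probability_setC// -[P (Z 1 @^-1` E1)]fineK ?fin_num_measure//.
  by rewrite -EFinB lee_fin; lra.
have mZE0 : measurable (Z 0 @^-1` E0) by rewrite -[X in measurable X]setTI; exact: mZ.
have mZE1 : measurable (Z 1 @^-1` E1) by rewrite -[X in measurable X]setTI; exact: mZ.
have : fine (P (Z 0 @^-1` E0 `&` Z 1 @^-1` E1)) <= fine (P [set w | K0 < wnorm 1 (v i w)]).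
  apply: fine_le; rewrite ?fin_num_measure//; first exact: measurableI.
  apply: le_measure; rewrite ?inE//; first exact: measurableI.
  move=> w [/= h0 h1].
  have ai1 : a ^+ i <= 1 by apply: exprn_ile1; exact: ltW.
  have ai0 : 0 <= a ^+ i by rewrite exprn_ge0// ltW.
  have hsub : wnorm e (N *m Z 0 w) <= wnorm e (N *m (Z 0 w - Z 1 w)) + wnorm e (N *m Z 1 w).
    by apply: le_trans (wnormD _ _ (ltW e0)); rewrite -mulmxDr subrK.
  have /andP[hlow _] := contractingX i (N *m (Z 0 w - Z 1 w)) hM.
  have := @wnorm_le_wnorm1 _ _ e (v i w); rewrite (ltW e0) e1 => /(_ erefl).
  rewrite /v -mulmxA => hv.
  have l1 : a ^+ i * wnorm e (N *m Z 1 w) <= bb.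
    by apply: le_trans h1; apply: ler_piMl => //; apply: wnorm_ge0; exact: ltW.
  have h0' : K0 + bb + 1 < a ^+ i * wnorm e (N *m Z 0 w) := h0.
  have := ler_wpM2l ai0 hsub; rewrite mulrDr => hs.
  apply: lt_le_trans hv; apply: lt_le_trans hlow; lra.
rewrite (independent2_Z01 hZ mE0 mE1).
rewrite -[P (Z 0 @^-1` E0)]fineK ?fin_num_measure//.
rewrite -[P (Z 1 @^-1` E1)]fineK ?fin_num_measure//= => hm.
have PE0 : 0 <= fine (P (Z 0 @^-1` E0)) by exact: fine_ge0.
change (fine (P (Z 0 @^-1` E0)) <= 2 * fine (P [set w | K0 < wnorm 1 (v i w)])).
nra.
Qed.

End log_moment.

Section log_plus_integrals.
Context {R : realType}.

Lemma log_plus_ge0 (x : R) : 0 <= log_plus x.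
Proof. by rewrite /log_plus ln_ge0// le_max lexx. Qed.

Lemma le_log_plus (x y : R) : x <= y -> log_plus x <= log_plus y.
Proof.
move=> xy; rewrite /log_plus ler_ln ?posrE ?lt_max ?ltr01//.
by rewrite ge_max !le_max lexx/= xy orbT.
Qed.

Lemma log_plusM (x y : R) : 0 <= x -> 0 <= y -> log_plus (x * y) <= log_plus x + log_plus y.
Proof.
move=> x0 y0; rewrite /log_plus -lnM ?posrE ?lt_max ?ltr01//.
rewrite ler_ln ?posrE ?lt_max ?ltr01// ?mulr_gt0 ?lt_max ?ltr01//.
rewrite ge_max; apply/andP; split.
  by rewrite -[leLHS]mul1r ler_pM// le_max lexx.
by rewrite ler_pM// le_max lexx orbT.
Qed.

Lemma log_plus_id (x : R) : 1 <= x -> log_plus x = ln x.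
Proof. by move=> x1; rewrite /log_plus max_r. Qed.

Context {dO : measure_display} {Omega : measurableType dO}.
Variable P : probability Omega R.
Local Open Scope ereal_scope.

(** The integral of a nonnegative function is the supremum of the integrals of
    the simple functions below it. *)
Lemma ge0_le_integral_any (f g : Omega -> \bar R) :
  (forall w, 0 <= f w) -> (forall w, f w <= g w) ->
  \int[P]_w f w <= \int[P]_w g w.
Proof.
move=> f0 fg; have g0 w : 0 <= g w by rewrite (le_trans (f0 w)).
rewrite !ge0_integralTE//; apply: le_ereal_sup => _ [h hf <-].
by exists h => // w; rewrite (le_trans (hf w)).
Qed.

Lemma measurable_log_plus (f : Omega -> R) :
  measurable_fun setT f -> measurable_fun setT (fun w => log_plus (f w)).
Proof.
move=> mf; apply: (measurableT_comp (measurable_ln (R := R))).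
by apply: measurable_maxr => //; exact: measurable_cst.
Qed.

Lemma integral_nneseries_indic (E : nat -> set Omega) : (forall i, measurable (E i)) ->
  \int[P]_w (\sum_(i <oo) (\1_(E i) w : R)%:E) = \sum_(i <oo) P (E i).
Proof.
move=> mE; rewrite integral_nneseries//.
- by apply: eq_eseriesr => i _; rewrite integral_indic// setIT.
by move=> i; apply/measurable_EFinP; exact: measurable_indic.
Qed.

Lemma nneseries_le_fin (u : nat -> \bar R) (c : R) : (forall i, 0 <= u i) ->
  (forall n, \sum_(i < n) u i <= c%:E) -> \sum_(i <oo) u i <= c%:E.
Proof.
move=> u0 uc; apply: lime_le; first exact: is_cvg_nneseries.
by apply: nearW => n; rewrite big_mkord.
Qed.

(** The number of indices [i] with [K < a ^+ i * V] is, up to a constant, the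
    logarithm of [V] in base [a^-1]. *)
Lemma log_plus_expectation_lty (V f : Omega -> R) (K c C a : R) :
  (0 < a < 1)%R -> (0 < K)%R -> (0 < C)%R -> measurable_fun setT V ->
  (forall w, 0 <= V w)%R -> (forall w, f w <= C * V w)%R ->
  (forall n, \sum_(i < n) fine (P [set w | (K < a ^+ i * V w)%R]) <= c)%R ->
  'E_P[fun w => log_plus (f w)] < +oo.
Proof.
move=> /andP[a0 a1] K0 C0 mV V0 fV hc.
pose E i := [set w | (K < a ^+ i * V w)%R].
have mE i : measurable (E i).
  by apply: measurable_gt_set; apply: measurable_funM => //; exact: measurable_cst.
pose A := log_plus (C * K); pose L := ln (a^-1).
have A0 : (0 <= A)%R by exact: log_plus_ge0.
have ai1 : (1 <= a^-1)%R by rewrite invf_ge1// ltW.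
have L0 : (0 <= L)%R by rewrite ln_ge0.
have pw w : (log_plus (f w))%:E <= A%:E + L%:E * \sum_(i <oo) (\1_(E i) w : R)%:E.
  have s0 : 0 <= \sum_(i <oo) (\1_(E i) w : R)%:E.
    by apply: nneseries_ge0 => i _ _; rewrite lee_fin indicE.
  have ex : exists j, (a ^+ j * V w <= K)%R.
    have : (fun j => geometric (V w) a j) @ \oo --> (0 : R)%R.
      by apply: cvg_geometric; rewrite ger0_norm// ltW.
    move=> /cvgrPdist_le/(_ K K0)[j _ /(_ j (leqnn j))].
    rewrite sub0r normrN /geometric/= => h; exists j.
    by rewrite mulrC (le_trans (ler_norm _)).
  case: (ex_minnP ex) => j hj jmin.
  have sj : j%:R%:E <= \sum_(i <oo) (\1_(E i) w : R)%:E.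
    apply: le_trans (nneseries_lim_ge j _); last by move=> i _ _; rewrite lee_fin indicE.
    rewrite (eq_big_nat _ _ (F2 := fun=> 1%:E)) => [|i /andP[_ ij]].
      by rewrite big_mkord sumEFin sumr_const card_ord.
    rewrite indicE mem_set//= /E/= ltNge; apply/negP => /jmin.
    by rewrite leqNgt ij.
  apply: (@le_trans _ _ (A%:E + L%:E * j%:R%:E)).
    rewrite -EFinM -EFinD lee_fin.
    have hVj : (V w <= K * a^-1 ^+ j)%R.
      by rewrite exprVn ler_pdivlMr ?exprn_gt0// mulrC.
    apply: (@le_trans _ _ (log_plus (C * K * a^-1 ^+ j))).
      by apply: le_log_plus; apply: le_trans (fV w) _; rewrite -mulrA ler_pM2l.
    apply: le_trans (log_plusM _ _) _.
    - by rewrite mulr_ge0// ltW.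
    - by rewrite exprn_ge0// invr_ge0 ltW.
    by rewrite lerD2l log_plus_id ?exprn_ege1// lnXn ?invr_gt0// /L mulr_natr.
  by rewrite leeD2l// lee_wpmul2l.
rewrite unlock.
apply: (@le_lt_trans _ _ (\int[P]_w (A%:E + L%:E * \sum_(i <oo) (\1_(E i) w : R)%:E))).
  by apply: ge0_le_integral_any => // w; rewrite lee_fin log_plus_ge0.
have ms : measurable_fun setT (fun w => \sum_(i <oo) (\1_(E i) w : R)%:E).
  apply: ge0_emeasurable_sum => // i _.
  by apply/measurable_EFinP; exact: measurable_indic.
rewrite ge0_integralD//; last 2 first.
- by move=> w _; rewrite mule_ge0// nneseries_ge0// => i _ _; rewrite lee_fin indicE.
- exact: measurable_funeM.
rewrite ge0_integralZl//; last by move=> w _; rewrite nneseries_ge0// => i _ _; rewrite lee_fin indicE.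
rewrite integral_nneseries_indic// integral_cst//= probability_setT mule1.
have : \sum_(i <oo) P (E i) <= c%:E.
  apply: nneseries_le_fin => // n.
  have -> : \sum_(i < n) P (E i) = (\sum_(i < n) fine (P (E i)))%:E.
    by rewrite -sumEFin; apply: eq_bigr => i _; rewrite fineK// fin_num_measure.
  by rewrite lee_fin; exact: hc.
move=> hs; apply: (@le_lt_trans _ _ (A%:E + L%:E * c%:E)).
  by rewrite leeD2l// lee_wpmul2l.
by rewrite -EFinM -EFinD ltry.
Qed.

(** The number of indices [j] with [1 < c ^+ j * V] is at most
    [1 + log_plus V / ln c^-1]. *)
Lemma sum_proba_lty_of_log_plus (V f : Omega -> R) (C c : R) :
  (0 < c < 1)%R -> (0 < C)%R -> measurable_fun setT V ->
  (forall w, 0 <= V w)%R -> (forall w, 0 <= f w)%R -> (forall w, V w <= C * f w)%R ->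
  'E_P[fun w => log_plus (f w)] < +oo ->
  \sum_(j <oo) P [set w | (1 < c ^+ j * V w)%R] < +oo.
Proof.
move=> /andP[c0 c1] C0 mV V0 f0 Vf; rewrite unlock => foo.
pose E i := [set w | (1 < c ^+ i * V w)%R].
have mE i : measurable (E i).
  by apply: measurable_gt_set; apply: measurable_funM => //; exact: measurable_cst.
pose L := ln (c^-1).
have L0 : (0 < L)%R by rewrite ln_gt0// invf_gt1.
(* [log_plus (f w)] need not be measurable in [w], hence the measurable
   minorant [G] *)
pose G w : R := (Num.max (log_plus (V w) - log_plus C) 0)%R.
have G0 w : (0 <= G w)%R by rewrite le_max lexx orbT.
have mG : measurable_fun setT G.
  apply: measurable_maxr => //.
  by apply: measurable_funB => //; exact: measurable_log_plus.
have GF w : (G w <= log_plus (f w))%R.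
  rewrite /G ge_max log_plus_ge0 andbT lerBlDl.
  by apply: le_trans (le_log_plus (Vf w)) _; apply: log_plusM => //; exact: ltW.
have IG : \int[P]_w (G w)%:E < +oo.
  by apply: le_lt_trans foo; apply: ge0_le_integral_any => w; rewrite lee_fin.
pose B := (1 + log_plus C / L)%R.
have B0 : (0 <= B)%R by rewrite addr_ge0// divr_ge0 ?log_plus_ge0// ltW.
have cnt (x : R) n : (0 <= x)%R ->
    (\sum_(i < n) ((i%:R * L < x)%R : nat)%:R <= 1 + x / L :> R)%R.
  move=> x0; have h0 : (0 <= x / L)%R by rewrite divr_ge0// ltW.
  suff [h _] : (\sum_(i < n) ((i%:R * L < x)%R : nat)%:R <= 1 + x / L :> R)%R /\
      (\sum_(i < n) ((i%:R * L < x)%R : nat)%:R <= n%:R :> R)%R by [].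
  elim: n => [|n [IH1 IH2]]; first by rewrite !big_ord0 addr_ge0.
  rewrite big_ord_recr/=; case: ltP => hn /=; last first.
    by rewrite addr0; split => //; rewrite (le_trans IH2)// ler_nat.
  split; last by rewrite -[n.+1%:R]natr1 lerD2r.
  by rewrite addrC lerD2l (le_trans IH2)// ler_pdivlMr// ltW.
have pw w : \sum_(i <oo) (\1_(E i) w : R)%:E <= B%:E + L^-1%:E * (G w)%:E.
  rewrite -EFinM -EFinD; apply: nneseries_le_fin => [i|n]; first by rewrite lee_fin indicE.
  rewrite sumEFin lee_fin.
  have h : (\sum_(i < n) \1_(E i) w <= \sum_(i < n) ((i%:R * L < log_plus (V w))%R : nat)%:R :> R)%R.
    apply: ler_sum => i _; rewrite indicE ler_nat.
    have [/set_mem hE|//] := boolP (w \in E i).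
    suff -> : (i%:R * L < log_plus (V w))%R by [].
    have h1 : (c^-1 ^+ i < V w)%R by rewrite exprVn -[ltLHS]mul1r ltr_pdivrMr ?exprn_gt0// mulrC.
    have h2 : (1 <= c^-1 ^+ i)%R by rewrite exprn_ege1// invf_ge1// ltW.
    rewrite log_plus_id; last by rewrite ltW// (le_lt_trans h2).
    have -> : (i%:R * L)%R = ln (c^-1 ^+ i)%R by rewrite lnXn ?invr_gt0// mulr_natl.
    have h3 : (0 < c^-1 ^+ i)%R by rewrite exprn_gt0// invr_gt0.
    by rewrite ltr_ln ?posrE// (lt_trans h3).
  apply: le_trans h _; apply: le_trans (cnt _ _ (log_plus_ge0 _)) _.
  rewrite /B -addrA lerD2l (mulrC _ (G w)) -mulrDl ler_wpM2r ?invr_ge0 ?(ltW L0)//.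
  by rewrite -lerBlDl le_max lexx.
rewrite -integral_nneseries_indic//.
apply: (@le_lt_trans _ _ (\int[P]_w (B%:E + L^-1%:E * (G w)%:E))).
  apply: ge0_le_integral_any => // w.
  by apply: nneseries_ge0 => i _ _; rewrite lee_fin indicE.
have mGE : measurable_fun setT (fun w => (G w)%:E) by apply/measurable_EFinP.
rewrite ge0_integralD//; last 2 first.
- by move=> w _; rewrite mule_ge0// lee_fin// invr_ge0 ltW.
- exact: measurable_funeM.
rewrite ge0_integralZl//; last 2 first.
- by move=> w _; rewrite lee_fin.
- by rewrite lee_fin invr_ge0 ltW.
rewrite integral_cst//= probability_setT mule1 lte_add_pinfty ?ltry//.
by rewrite lte_mul_pinfty// lee_fin invr_ge0 ltW.
Qed.

Lemma borel_cantelli_ae (E : nat -> set Omega) : (forall i, measurable (E i)) ->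
  \sum_(i <oo) P (E i) < +oo ->
  {ae P, forall w, exists n, forall j, (n <= j)%N -> ~ E j w}.
Proof.
move=> mE hE; have := lim_sup_set_cvg0 mE hE => h0.
exists (lim_sup_set E); split => //.
  apply: bigcap_measurable => // n _; exact: bigcup_measurable.
move=> w /= hw n _; apply: contrapT => hn; apply: hw.
by exists n => j nj Ej; apply: hn; exists j.
Qed.

End log_plus_integrals.

(** * Series of vectors *)

Section vector_series.
Context {R : realType}.
Local Notation C := R[i].
Local Notation normc := Normc.normc.

Lemma cvg0_le (f g : nat -> R) : (forall n, 0 <= f n <= g n) ->
  g @ \oo --> (0 : R) -> f @ \oo --> (0 : R).
Proof.
move=> fg /cvgrPdist_le hg; apply/cvgrPdist_le => e e0.
have := hg e e0; apply: filterS => n; have /andP[f0 fgn] := fg n.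
rewrite !sub0r !normrN !ger0_norm//; first exact: le_trans.
exact: le_trans fgn.
Qed.

Lemma cvg0D (f g : nat -> R) : f @ \oo --> (0 : R) -> g @ \oo --> (0 : R) ->
  (fun n => f n + g n) @ \oo --> (0 : R).
Proof.
move=> hf hg; have := cvgD hf hg.
have -> : (0 : R) + 0 = 0 by rewrite addr0.
exact.
Qed.

(** Convergence of the partial sums in norm: linear maps and shifts of the index
    act on it directly, and [vcvg_vseries] identifies the limit with the
    coordinatewise sum. *)
Definition vcvg p (u : nat -> 'cV[C]_p) (l : 'cV[C]_p) : Prop :=
  (fun n => wnorm 1 (\sum_(i < n) u i - l)) @ \oo --> (0 : R).

Lemma wnorm1_ge0 p (v : 'cV[C]_p) : 0 <= wnorm 1 v.
Proof. exact: wnorm_ge0. Qed.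

Lemma wnorm1_entry p (v : 'cV[C]_p) i : normc (v i 0) <= wnorm 1 v.
Proof.
rewrite /wnorm (bigD1 i)//= expr1n mul1r lerDl sumr_ge0// => j _.
by rewrite expr1n mul1r normc_ge0.
Qed.

Lemma vcvg_le p p' (u : nat -> 'cV[C]_p) (l : 'cV[C]_p) (x : nat -> 'cV[C]_p') (B : R) :
  (forall n, wnorm 1 (x n) <= B * wnorm 1 (\sum_(i < n) u i - l)) -> vcvg u l ->
  (fun n => wnorm 1 (x n)) @ \oo --> (0 : R).
Proof.
move=> hx hu; apply: (@cvg0_le _ (fun n => B * wnorm 1 (\sum_(i < n) u i - l))).
  by move=> n; rewrite wnorm1_ge0 hx.
by rewrite -(mulr0 B); apply: cvgMr.
Qed.

Lemma vcvg_vseries p (u : nat -> 'cV[C]_p) l : vcvg u l -> vseries u = l.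
Proof.
move=> hu; apply/colP => i; rewrite mxE.
have entry (f : C -> R) (fD : {morph f : x y / x + y >-> x + y}) (f0 : f 0 = 0)
    (fle : forall z, `|f z| <= normc z) : limn (series (fun j => f (u j i 0))) = f (l i 0).
  apply/cvg_lim => //; apply/cvgrPdist_le => e e0.
  move/cvgrPdist_le : hu => /(_ e e0); apply: filterS => n.
  rewrite sub0r normrN ger0_norm ?wnorm1_ge0// => h.
  rewrite distrC; apply: le_trans h; apply: le_trans (wnorm1_entry _ i).
  apply: le_trans (fle _); rewrite !mxE fD summxE seriesEnat/= big_mkord.
  have fN x : f (- x) = - f x by apply/eqP; rewrite -addr_eq0 -fD addrC subrr f0.
  rewrite fN; rewrite (_ : f (\sum_(k < n) u k i 0) = \sum_(k < n) f (u k i 0))//.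
  by apply: (big_morph f fD f0).
rewrite (entry (@complex.Re R)); [|by case=> ? ? []|by []|exact: Re_le_normc].
rewrite (entry (@complex.Im R)); [|by case=> ? ? []|by []|exact: Im_le_normc].
by case: (l i 0).
Qed.

Lemma vcvg_unique p (u : nat -> 'cV[C]_p) l l' : vcvg u l -> vcvg u l' -> l = l'.
Proof. by move=> /vcvg_vseries <- /vcvg_vseries. Qed.

Lemma vcvg_mulmx p p' (A : 'M[C]_(p', p)) u l : vcvg u l ->
  vcvg (fun j => A *m u j) (A *m l).
Proof.
have [B _ hB] := wnorm1_mulmx_le A.
move=> hu; apply: (vcvg_le (B := B) _ hu) => n.
by rewrite -mulmx_sumr -mulmxBr hB.
Qed.

Lemma vcvgD p (u v : nat -> 'cV[C]_p) l l' : vcvg u l -> vcvg v l' ->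
  vcvg (fun j => u j + v j) (l + l').
Proof.
move=> hu hv.
apply: cvg0_le (cvg0D hu hv) => n; rewrite wnorm1_ge0/= big_split/= opprD addrACA.
exact: wnormD.
Qed.

Lemma vcvg_finite p (u : nat -> 'cV[C]_p) n :
  (forall j, (n <= j)%N -> u j = 0) -> vcvg u (\sum_(j < n) u j).
Proof.
move=> hu; apply/cvgrPdist_le => e e0; near=> k.
have nk : (n <= k)%N by near: k; exists n.
have -> : \sum_(i < k) u i = \sum_(i < n) u i.
  rewrite -(subnKC nk) big_split_ord/= [X in _ + X = _]big1 ?addr0// => i _.
  by rewrite hu// leq_addr.
rewrite subrr.
rewrite sub0r normrN ger0_norm ?wnorm1_ge0//.
by rewrite /wnorm big1 ?ltW// => i _; rewrite mxE Normc.normc0 mulr0.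
Unshelve. all: by end_near. Qed.

Lemma vcvg_shift p (u : nat -> 'cV[C]_p) n l : vcvg (fun j => u (j + n)%N) l ->
  vcvg u (\sum_(j < n) u j + l).
Proof.
rewrite /vcvg => hu; rewrite -(cvg_shiftn n)/=.
have -> : (fun k => wnorm 1 (\sum_(i < k + n) u i - (\sum_(j < n) u j + l))) =
    (fun k => wnorm 1 (\sum_(i < k) u (i + n)%N - l)).
  apply/funext => k; congr wnorm; rewrite addnC big_split_ord/= opprD addrACA subrr add0r.
  by congr (_ - _); apply: eq_bigr => i _; rewrite addnC.
exact: hu.
Qed.

Lemma eq_vcvg p (u v : nat -> 'cV[C]_p) l : u =1 v -> vcvg u l -> vcvg v l.
Proof. by move=> /funext ->. Qed.

Definition geom_dominated p (u : nat -> 'cV[C]_p) : Prop :=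
  exists K r : R, [/\ 0 <= K, 0 < r < 1 & forall j, wnorm 1 (u j) <= K * r ^+ j].

Lemma geom_dominated_eventually p (u : nat -> 'cV[C]_p) (K r : R) n :
  0 <= K -> 0 < r < 1 ->
  (forall j, (n <= j)%N -> wnorm 1 (u j) <= K * r ^+ j) -> geom_dominated u.
Proof.
move=> K0 /andP[r0 r1] hu.
have s0 : 0 <= \sum_(i < n) (wnorm 1 (u i) / r ^+ i).
  by apply: sumr_ge0 => i _; rewrite divr_ge0 ?wnorm1_ge0// exprn_ge0// ltW.
exists (K + \sum_(i < n) (wnorm 1 (u i) / r ^+ i)), r; split.
- exact: addr_ge0.
- by rewrite r0.
move=> j; have rj : 0 < r ^+ j by rewrite exprn_gt0.
have [jn|nj] := ltnP j n; last first.
  by apply: le_trans (hu _ nj) _; rewrite ler_wpM2r ?lerDl// ltW.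
rewrite -ler_pdivrMr// (bigD1 (Ordinal jn))//= addrCA lerDl addr_ge0//.
by apply: sumr_ge0 => i _; rewrite divr_ge0 ?wnorm1_ge0// exprn_ge0// ltW.
Qed.

Lemma geom_dominated_unshift p (u : nat -> 'cV[C]_p) n :
  geom_dominated (fun j => u (j + n)%N) -> geom_dominated u.
Proof.
move=> [K [r [K0 /andP[r0 r1] h]]].
apply: (@geom_dominated_eventually _ _ (K / r ^+ n) r n).
- by rewrite divr_ge0// exprn_ge0// ltW.
- by rewrite r0.
move=> j nj; have := h (j - n)%N; rewrite subnK//.
rewrite exprB// ?unitfE ?gt_eqF//.
by rewrite mulrA mulrAC.
Qed.

Lemma geom_dominated_nneseries p (u : nat -> 'cV[C]_p) (N : 'cV[C]_p -> R) :
  vector_norm N -> geom_dominated u -> (\sum_(0 <= j <oo) (N (u j))%:E < +oo)%E.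
Proof.
move=> nN [K [r [K0 /andP[r0 r1] h]]].
have [c c0 hc] := vector_norm_le_wnorm1 nN.
apply: (@le_lt_trans _ _ (c * K / (1 - r))%:E); last exact: ltry.
apply: nneseries_le_fin => [i|n]; first by rewrite lee_fin vector_norm_ge0.
rewrite sumEFin lee_fin.
apply: (@le_trans _ _ (\sum_(i < n) (c * K) * r ^+ i)).
  by apply: ler_sum => i _; apply: le_trans (hc _) _; rewrite -mulrA ler_pM2l.
have -> : \sum_(i < n) c * K * r ^+ i = series (geometric (c * K) r) n.
  by rewrite seriesEnat/= big_mkord.
by apply: geometric_le_lim => //; [rewrite mulr_ge0// ltW|rewrite ger0_norm// ltW].
Qed.

Lemma geom_dominated_vcvg p (u : nat -> 'cV[C]_p) : geom_dominated u -> exists l, vcvg u l.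
Proof.
move=> [K [r [K0 /andP[r0 r1] h]]].
have entry (f : C -> R) (fle : forall z, `|f z| <= normc z) i :
    cvgn (series (fun j => f (u j i 0))).
  apply: normed_cvg; apply: (@series_le_cvg _ _ (geometric K r)) => [n|n|n|].
  - exact: normr_ge0.
  - by rewrite /geometric/= mulr_ge0// exprn_ge0// ltW.
  - by rewrite /geometric/=; apply: le_trans (fle _) _; apply: le_trans (wnorm1_entry _ i) (h n).
  - by apply: is_cvg_geometric_series; rewrite ger0_norm// ltW.
have hRe i := entry _ (@Re_le_normc R) i; have hIm i := entry _ (@Im_le_normc R) i.
exists (vseries u); rewrite /vcvg.
pose a (i : 'I_p) n := `|series (fun j => complex.Re (u j i 0)) n - limn (series (fun j => complex.Re (u j i 0)))|.
pose b (i : 'I_p) n := `|series (fun j => complex.Im (u j i 0)) n - limn (series (fun j => complex.Im (u j i 0)))|.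
have a0 i : a i @ \oo --> (0 : R).
  apply/cvgrPdist_le => e e0; have /cvgrPdist_le/(_ e e0) := hRe i.
  by apply: filterS => n; rewrite /a sub0r normrN normr_id distrC.
have b0 i : b i @ \oo --> (0 : R).
  apply/cvgrPdist_le => e e0; have /cvgrPdist_le/(_ e e0) := hIm i.
  by apply: filterS => n; rewrite /b sub0r normrN normr_id distrC.
have ab : (fun n => \sum_(i < p) (a i n + b i n)) @ \oo --> (0 : R).
  elim: (index_enum _) => [|i s IH].
    by under eq_cvg do rewrite big_nil; exact: cvg_cst.
  under eq_cvg do rewrite big_cons.
  by apply: cvg0D => //; apply: cvg0D.
apply: cvg0_le ab => n; rewrite wnorm1_ge0/=; apply: ler_sum => i _.
rewrite expr1n mul1r; apply: le_trans (normc_le_ReIm _) _.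
have sumE (f : C -> R) (fD : {morph f : x y / x + y >-> x + y}) (f0 : f 0 = 0) :
    f (\sum_(j < n) u j i 0) = series (fun j => f (u j i 0)) n.
  by rewrite seriesEnat/= big_mkord; apply: (big_morph f fD f0).
rewrite !mxE summxE /a /b -(sumE (@complex.Re R)); [|by case=> ? ? []|by []].
rewrite -(sumE (@complex.Im R)); [|by case=> ? ? []|by []].
by case: (\sum_(j < n) u j i 0).
Qed.

End vector_series.

(** * The recursion of one Jordan block *)

Section block_recursion.
Context {R : realType}.
Local Notation C := R[i].
Variables (p d q : nat) (A : 'M[C]_p) (L : 'I_q.+1 -> 'M[C]_(p, d)).

Lemma invmxXK n m : A \in unitmx -> invmx A ^+ n *m A ^+ (n + m) = A ^+ m.
Proof.
move=> uA; elim: n => [|n IH]; first by rewrite expr0 mul1mx.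
rewrite exprSr addSn exprS -[_ ^+ n * _]/(_ *m _) -[A * _]/(_ *m _).
by rewrite mulmxA -[_ *m _ *m A]mulmxA mulVmx// mulmx1 IH.
Qed.

(** The coefficients of the formal power series
    [(\sum_j A ^+ j x^j) (\sum_k L k x^k)], that is of the solution of
    [X t - A X (t - 1) = \sum_k L k z (t - k)] by backward iteration; from [j = q]
    on they are [A ^+ (j - q) *m ma_total]. *)
Definition ma_coef (j : nat) : 'M[C]_(p, d) :=
  \sum_(k < q.+1 | (k <= j)%N) A ^+ (j - k) *m L k.

Definition ma_total : 'M[C]_(p, d) := \sum_(k < q.+1) A ^+ (q - k) *m L k.

Lemma ma_coef0 : ma_coef 0 = L ord0.
Proof.
rewrite /ma_coef (bigD1 ord0)//= big1 ?addr0 ?expr0 ?mul1mx// => k /andP[k0 kn0].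
by move: kn0; rewrite -val_eqE/=; move: k0; rewrite leqn0 => ->.
Qed.

Lemma ma_coefS (j : 'I_q) : ma_coef j.+1 = A *m ma_coef j + L (lift ord0 j).
Proof.
rewrite /ma_coef (bigD1 (lift ord0 j))//= subnn expr0 mul1mx addrC; congr (_ + _).
rewrite mulmx_sumr; apply: eq_big => [k|k /andP[kj kn]].
  rewrite -val_eqE/= /bump/= add1n.
  by rewrite [RHS]leq_eqVlt; case: ltngtP; lia.
move: kn kj; rewrite -val_eqE/= /bump/= add1n => kn kj.
have kj' : (k <= j)%N by lia.
by rewrite subSn// exprS mulmxA.
Qed.

Lemma ma_coef_large j : (q <= j)%N -> ma_coef j = A ^+ (j - q) *m ma_total.
Proof.
move=> qj; rewrite /ma_coef /ma_total mulmx_sumr; apply: eq_big => [k|k _].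
  by rewrite (leq_trans _ qj)// -ltnS.
have kq : (k <= q)%N by rewrite -ltnS.
by rewrite mulmxA -[_ *m _ ^+ (q - k)]/(_ * _) -exprD addnBA// subnK.
Qed.

Variable z : int -> 'cV[C]_d.

Definition noise (t : int) : 'cV[C]_p := \sum_(k < q.+1) L k *m z (t - (k : nat)%:Z).

Definition ma_part (t : int) : 'cV[C]_p := \sum_(j < q) ma_coef j *m z (t - (j : nat)%:Z).

(** Subtracting its moving average part from a solution replaces the noise by
    the single vector [ma_total *m z (t - q)]. *)
Lemma ma_part_rec t :
  ma_part t - A *m ma_part (t - 1) = noise t - ma_total *m z (t - q%:Z).
Proof.
apply/eqP; rewrite subr_eq addrAC eq_sym subr_eq eq_sym; apply/eqP.
have -> : ma_total *m z (t - q%:Z) = ma_coef q *m z (t - q%:Z).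
  by rewrite (ma_coef_large (leqnn q)) subnn expr0 mul1mx.
transitivity (\sum_(j < q.+1) ma_coef j *m z (t - (j : nat)%:Z)).
  by rewrite big_ord_recr.
rewrite /noise big_ord_recl [in RHS]big_ord_recl/= ma_coef0 -addrA; congr (_ + _).
rewrite /ma_part mulmx_sumr -big_split/=; apply: eq_bigr => j _.
have -> : t - (bump 0 j)%:Z = t - 1 - (j : nat)%:Z by rewrite /bump/=; lia.
by rewrite /bump/= add1n ma_coefS mulmxDl mulmxA addrC.
Qed.

(** For an invertible [A], factoring out [A ^+ (j - q)], a possibly negative
    power, gives the coefficients of backward iteration. *)
Lemma inner_coefE j : A \in unitmx ->
  mxpowz A (j%:Z - q%:Z) *m (\sum_(k < q.+1 | (k <= j)%N) A ^+ (q - k) *m L k) = ma_coef j.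
Proof.
move=> uA; have [qj|jq] := leqP q j.
  have -> : j%:Z - q%:Z = Posz (j - q) by lia.
  rewrite ma_coef_large//=; congr (_ *m _); apply: eq_bigl => k.
  by rewrite (leq_trans _ qj)// -ltnS.
have -> : j%:Z - q%:Z = Negz (q - j).-1 by rewrite NegzE; lia.
rewrite /= prednK ?subn_gt0// mulmx_sumr; apply: eq_bigr => k kj.
rewrite mulmxA; congr (_ *m _).
have -> : (q - k = (q - j) + (j - k))%N by lia.
exact: invmxXK.
Qed.

(** The indices [k] kept here are those that backward iteration omits, so the
    coefficient is the total minus a coefficient [ma_coef]. *)
Lemma outer_coefE i : A \in unitmx ->
  mxpowz A (- (1 - q%:Z + i%:Z) - q%:Z) *m
    (\sum_(k < q.+1 | (1 - (1 - q%:Z + i%:Z) <= (k : nat)%:Z)%R) A ^+ (q - k) *m L k) =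
  invmx A ^+ i.+1 *m ma_total - (if (i < q)%N then ma_coef (q - i.+1) else 0).
Proof.
move=> uA; have -> : - (1 - q%:Z + i%:Z) - q%:Z = Negz i by rewrite NegzE; lia.
rewrite /= /ma_total [X in _ *m X - _](bigID (fun k : 'I_q.+1 => (q <= i + k)%N))/=.
rewrite mulmxDr -[RHS]addrA [X in _ = _ + X](_ : _ = 0).
  rewrite addr0; congr (_ *m _); apply: eq_bigl => k; lia.
have [iq|qi] := ltnP i q; last first.
  by rewrite subr0 big1 ?mulmx0// => k; rewrite -ltnNge; lia.
apply/eqP; rewrite subr_eq0; apply/eqP; rewrite mulmx_sumr /ma_coef.
apply: eq_big => [k|k]; first by rewrite -ltnNge; lia.
rewrite -ltnNge => ikq; rewrite mulmxA; congr (_ *m _).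
have -> : (q - k = i.+1 + (q - i.+1 - k))%N by lia.
exact: invmxXK.
Qed.

End block_recursion.

Section block_series.
Context {R : realType}.
Local Notation C := R[i].
Variables (p d q : nat) (A : 'M[C]_p) (L : 'I_q.+1 -> 'M[C]_(p, d)).
Variable z : int -> 'cV[C]_d.
Local Notation N := (ma_total A L).

Lemma geom_dominated_mulmx p' (M : 'M[C]_(p', p)) (u : nat -> 'cV[C]_p) :
  geom_dominated u -> geom_dominated (fun j => M *m u j).
Proof.
have [B B0 hB] := wnorm1_mulmx_le M.
move=> [K [r [K0 r01 h]]]; exists (B * K), r; split => //; first exact: mulr_ge0.
by move=> j; apply: le_trans (hB _) _; rewrite -mulrA ler_wpM2l.
Qed.

Definition inner_series t (j : nat) := ma_coef A L j *m z (t - j%:Z).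

Lemma inner_seriesE t j :
  inner_series t (j + q) = A ^+ j *m (N *m z (t - q%:Z - j%:Z)).
Proof.
rewrite /inner_series ma_coef_large ?leq_addl// addnK mulmxA; congr (_ *m z _).
by rewrite PoszD; lia.
Qed.

Lemma inner_series_dominated t :
  geom_dominated (fun j => A ^+ j *m (N *m z (t - q%:Z - j%:Z))) ->
  geom_dominated (inner_series t).
Proof.
move=> h; apply: (@geom_dominated_unshift _ _ _ q).
by under eq_fun do rewrite inner_seriesE.
Qed.

(** From [j = q] on the series is geometric in [A]: it is the moving average
    part plus a [y t] with [y t = N z (t - q) + A y (t - 1)]. *)
Lemma inner_series_rec t :
  (forall s, geom_dominated (fun j => A ^+ j *m (N *m z (s - q%:Z - j%:Z)))) ->
  vseries (inner_series t) - A *m vseries (inner_series (t - 1)) = noise L z t.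
Proof.
move=> h; have [l hl] := geom_dominated_vcvg (h t).
have [l' hl'] := geom_dominated_vcvg (h (t - 1)).
have X s y : vcvg (fun j => A ^+ j *m (N *m z (s - q%:Z - j%:Z))) y ->
    vseries (inner_series s) = ma_part A L z s + y.
  move=> hy; apply: vcvg_vseries; apply: vcvg_shift.
  by apply: eq_vcvg hy => j; rewrite inner_seriesE.
rewrite (X _ _ hl) (X _ _ hl').
have -> : l = N *m z (t - q%:Z) + A *m l'.
  apply: vcvg_unique hl _.
  have := vcvg_shift (u := fun j => A ^+ j *m (N *m z (t - q%:Z - j%:Z))) (n := 1) (l := A *m l').
  rewrite big_ord1 expr0 mul1mx subr0; apply.
  apply: eq_vcvg (vcvg_mulmx A hl') => j.
  rewrite addn1 exprS -[A * _]/(A *m _) -!mulmxA.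
  by have -> : t - 1 - q%:Z - j%:Z = t - q%:Z - j.+1%:Z by lia.
rewrite mulmxDr opprD addrACA ma_part_rec addrA addrACA.
by rewrite addrA !addrK.
Qed.

Definition outer_series t (i : nat) :=
  (invmx A ^+ i.+1 *m N - (if (i < q)%N then ma_coef A L (q - i.+1) else 0))
    *m z (t + (1 - q%:Z + i%:Z)).

Definition outer_tail t (i : nat) := invmx A *m (invmx A ^+ i *m (N *m z (t - q%:Z + 1 + i%:Z))).

Lemma outer_seriesE t i : outer_series t i = outer_tail t i -
  (if (i < q)%N then ma_coef A L (q - i.+1) *m z (t - (q - i.+1)%N%:Z) else 0).
Proof.
have e1 : t + (1 - q%:Z + i%:Z) = t - q%:Z + 1 + i%:Z by lia.
rewrite /outer_series /outer_tail e1 mulmxBl exprS -[_ * _]/(_ *m _) -!mulmxA.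
case: ifP => iq; last by rewrite mul0mx.
by have -> : t - (q - i.+1)%N%:Z = t - q%:Z + 1 + i%:Z by lia.
Qed.

Lemma outer_series_dominated t :
  geom_dominated (fun j => invmx A ^+ j *m (N *m z (t - q%:Z + 1 + j%:Z))) ->
  geom_dominated (outer_series t).
Proof.
move=> /(@geom_dominated_mulmx _ (invmx A))[K [r [K0 r01 h]]].
apply: (@geom_dominated_eventually _ _ _ K r q) => // j qj.
by rewrite outer_seriesE ltnNge qj subr0; exact: h.
Qed.

(** The same decomposition, with the geometric part solved forwards in time by
    means of [invmx A]. *)
Lemma outer_series_rec t : A \in unitmx ->
  (forall s, geom_dominated (fun j => invmx A ^+ j *m (N *m z (s - q%:Z + 1 + j%:Z)))) ->
  - vseries (outer_series t) - A *m (- vseries (outer_series (t - 1))) = noise L z t.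
Proof.
move=> uA h.
have [l hl] := geom_dominated_vcvg (geom_dominated_mulmx (invmx A) (h t)).
have [l' hl'] := geom_dominated_vcvg (geom_dominated_mulmx (invmx A) (h (t - 1))).
have X s y : vcvg (outer_tail s) y -> vseries (outer_series s) = y - ma_part A L z s.
  move=> hy; apply: vcvg_vseries.
  pose g i := - (if (i < q)%N then ma_coef A L (q - i.+1) *m z (s - (q - i.+1)%N%:Z) else 0).
  have hg : vcvg g (\sum_(i < q) g i).
    by apply: vcvg_finite => j qj; rewrite /g ltnNge qj oppr0.
  have -> : - ma_part A L z s = \sum_(i < q) g i.
    rewrite /ma_part -sumrN (reindex_inj rev_ord_inj)/=; apply: eq_bigr => i _.
    by rewrite /g ltn_ord.
  by apply: eq_vcvg (vcvgD hy hg) => j; rewrite outer_seriesE.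
rewrite (X _ _ hl) (X _ _ hl').
have hA : A *m l' = N *m z (t - q%:Z) + l.
  have -> : l' = invmx A *m (N *m z (t - q%:Z)) + invmx A *m l.
    apply: vcvg_unique hl' _.
    have o0 : outer_tail (t - 1) 0 = invmx A *m (N *m z (t - q%:Z)).
      rewrite /outer_tail expr0 mul1mx.
      by have -> : t - 1 - q%:Z + 1 + 0%N%:Z = t - q%:Z by lia.
    have := vcvg_shift (u := outer_tail (t - 1)) (n := 1) (l := invmx A *m l).
    rewrite big_ord1 o0; apply.
    apply: eq_vcvg (vcvg_mulmx (invmx A) hl) => j.
    rewrite addn1 /outer_tail exprS -[_ * _]/(_ *m _) -!mulmxA.
    by have -> : t - 1 - q%:Z + 1 + j.+1%:Z = t - q%:Z + 1 + j%:Z by lia.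
  by rewrite mulmxDr !mulmxA mulmxV// !mul1mx.
rewrite mulmxN opprK opprB mulmxBr hA -[noise L z t](subrK (N *m z (t - q%:Z))).
rewrite -ma_part_rec; set a := N *m _; set b := ma_part _ _ _ _; set c := A *m _.
by rewrite -[LHS]addrA -[a + l - c]addrA [- l + _]addrCA addKr [a - c]addrC addrA.
Qed.

End block_series.

(** * Convergence of the block series *)

Section series_ae.
Context {R : realType} {dO : measure_display} {Omega : measurableType dO}.
Local Notation C := R[i].
Variables (P : probability Omega R) (d : nat) (Z : int -> Omega -> 'cV[C]_d).
Hypothesis hZ : iid P Z.

Lemma identically_distributed_ae (B : set 'cV[C]_d) k : measurable B ->
  {ae P, forall w, B (Z 0 w)} -> {ae P, forall w, B (Z k w)}.
Proof.
move=> mB; have [mZ _ dZ] := hZ.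
have mpre i : measurable (Z i @^-1` (~` B)).
  by rewrite -[X in measurable X]setTI; apply: mZ => //; exact: measurableC.
move=> [N [mN PN hN]]; exists (Z k @^-1` (~` B)); split => //.
have -> := dZ k 0 _ (measurableC mB).
exact: (subset_measure0 (mpre 0) mN hN PN).
Qed.

(** By the Borel-Cantelli lemma a finite logarithmic moment keeps the noise
    below any growing geometric sequence, and the contraction beats a slow
    enough one. *)
Lemma contracting_series_ae p (M : 'M[C]_p) (N : 'M[C]_(p, d)) (nrm : 'cV[C]_p -> R)
    (e a b : R) (tau : nat -> int) :
  contracting M e a b -> vector_norm nrm ->
  ('E_P[fun w => log_plus (nrm (N *m Z 0 w)%R)] < +oo)%E ->
  {ae P, forall w, geom_dominated (fun j => M ^+ j *m (N *m Z (tau j) w))}.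
Proof.
move=> hM hn hE; have [/andP[e0 e1] _ /andP[b0 b1] _] := hM; have [mZ _ dZ] := hZ.
pose c := (b + 1) / 2.
have bc : b < c by rewrite /c; lra.
have c1 : c < 1 by rewrite /c; lra.
have c0 : 0 < c by exact: lt_trans bc.
have [C1 C10 hC1] := vector_norm_equiv (wnorm_vector_norm p e0) hn.
have [C2 C20 hC2] := vector_norm_equiv (wnorm_vector_norm p (@ltr01 R)) (wnorm_vector_norm p e0).
pose V (v : 'cV[C]_d) := wnorm e (N *m v).
have mV : measurable_fun setT V by apply: measurable_wnorm; apply: measurable_fun_mulmx; exact: measurable_id.
have := @sum_proba_lty_of_log_plus _ _ _ P (fun w => V (Z 0 w)) (fun w => nrm (N *m Z 0 w)) C1 c.
rewrite c0 c1 => /(_ isT C10 (measurableT_comp mV (mZ 0))).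
have V0 v : 0 <= V v by apply: wnorm_ge0; exact: ltW.
move=> /(_ (fun w => V0 _) (fun w => vector_norm_ge0 hn _) (fun w => hC1 _) hE) hsum.
pose E j := [set w | 1 < c ^+ j * V (Z (tau j) w)].
have mE j : measurable (E j).
  apply: measurable_gt_set; apply: measurable_funM; first exact: measurable_cst.
  exact: (measurableT_comp mV (mZ _)).
have hsum' : (\sum_(j <oo) P (E j) < +oo)%E.
  apply: le_lt_trans hsum; rewrite le_eqVlt; apply/orP; left; apply/eqP.
  apply: eq_eseriesr => j _.
  have mS : measurable [set v | 1 < c ^+ j * V v].
    by apply: measurable_gt_set; apply: measurable_funM => //; exact: measurable_cst.
  exact: (dZ (tau j) 0 _ mS).
apply: filterS (borel_cantelli_ae mE hsum') => w [n hn'].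
apply: (@geom_dominated_eventually _ _ _ C2 (b / c) n).
- exact: ltW.
- by rewrite divr_gt0//= ltr_pdivrMr// mul1r.
move=> j nj; apply: le_trans (hC2 _) _; rewrite ler_pM2l//.
have /andP[_ hj] := contractingX j (N *m Z (tau j) w) hM.
apply: le_trans hj _; rewrite expr_div_n ler_pM2l ?exprn_gt0//.
have := hn' j nj; rewrite /E/= => /negP; rewrite -leNgt => h.
by rewrite -[leRHS]mul1r ler_pdivlMr ?exprn_gt0// mulrC.
Qed.

End series_ae.

(** * Stationarity of functionals of the noise path *)

Section paths.
Context {R : realType} {dO : measure_display} {Omega : measurableType dO}.
Variable P : probability Omega R.
Context {dE : measure_display} {E : measurableType dE}.

(** Shifting the time amounts to shifting the random element [x], which keeps
    its law. *)
Lemma strictly_stationary_factor dX (X : measurableType dX) (x : int -> Omega -> X)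
    (g : int -> X -> E) (Y : int -> Omega -> E) :
  (forall s, measurable_fun setT (x s)) ->
  (forall s A, measurable A -> P (x s @^-1` A) = P (x 0 @^-1` A)) ->
  (forall t, measurable_fun setT (g t)) ->
  (forall t s w, Y (t + s) w = g t (x s w)) -> strictly_stationary P Y.
Proof.
move=> mx lx mg Yg n t s B mB.
pose A := [set z | B [tuple g (tnth t i) z | i < n]].
have mA : measurable A.
  rewrite -[A]setTI; apply: (_ : measurable_fun setT (fun z => [tuple g (tnth t i) z | i < n])) => //.
  apply/measurable_fun_tnthP => i.
  by rewrite (_ : _ \o _ = g (tnth t i))//; apply/funext => z /=; rewrite tnth_mktuple.
have e s' : [set w | B [tuple Y (tnth t i + s') w | i < n]] = x s' @^-1` A.
  rewrite /A/=; apply/seteqP; split => w /=.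
    by rewrite (_ : [tuple _ | _ < _] = [tuple g (tnth t i) (x s' w) | i < n])//; apply: eq_mktuple => i.
  by rewrite [X in _ -> B X](_ : _ = [tuple g (tnth t i) (x s' w) | i < n])//; apply: eq_mktuple => i.
rewrite e lx// -e; congr (P _); apply/seteqP; split => w /=.
  by rewrite (_ : [tuple _ | _ < _] = [tuple Y (tnth t i) w | i < n])//; apply: eq_mktuple => i; rewrite addr0.
by rewrite [X in _ -> B X](_ : _ = [tuple Y (tnth t i) w | i < n])//; apply: eq_mktuple => i; rewrite addr0.
Qed.

Lemma strictly_stationary_law (Y : int -> Omega -> E) : strictly_stationary P Y ->
  (forall t, measurable_fun setT (Y t)) ->
  forall t A, measurable A -> P (Y t @^-1` A) = P (Y 0 @^-1` A).
Proof.
move=> sY mY t A mA.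
pose B : set (1.-tuple E) := (fun x => tnth x ord0) @^-1` A.
have mB : measurable B by rewrite -[B]setTI; exact: measurable_tnth.
have e s : [set w | B [tuple Y (tnth [tuple (0 : int)] i + s) w | i < 1]] = Y s @^-1` A.
  by rewrite /B/=; apply/seteqP; split => w /=; rewrite tnth_mktuple (tnth_nth 0)/= add0r.
have := sY 1 [tuple 0] t B mB; rewrite e => ->; rewrite -(e 0).
by congr (P _); apply/seteqP; split => w /=; rewrite /B/= !tnth_mktuple addr0.
Qed.

Definition coord_process : int -> (int -> E) -> E := fun i z => z i.

Definition path_space := g_sigma_algebraType (cylinders coord_process predT).

Lemma measurable_coord_process i : measurable_fun setT (coord_process i : path_space -> E).
Proof. exact: measurable_coord_cylinders. Qed.

Lemma measurable_path (Y : int -> Omega -> E) : (forall i, measurable_fun setT (Y i)) ->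
  measurable_fun setT ((fun w i => Y i w) : Omega -> path_space).
Proof.
move=> mY; apply: (@measurability _ _ _ path_space _ _ (cylinders coord_process predT)) => //.
move=> _ [_ [s [A [_ mA ->]]] <-]; rewrite setTI.
rewrite (_ : _ @^-1` _ = cylinder Y s A); first exact: measurable_cylinder.
by apply/seteqP; split => w /cylinderP h; apply/cylinderP.
Qed.

Variable Z : int -> Omega -> E.
Hypothesis hZ : iid P Z.

Definition shifted_path (s : int) (w : Omega) : path_space := fun i => Z (i + s) w.

Lemma measurable_shifted_path s : measurable_fun setT (shifted_path s).
Proof. by apply: measurable_path => i; case: hZ. Qed.

(** Independence and identical distribution give both laws the same values on
    cylinders. *)
Lemma shifted_path_law s A : measurable A ->
  P (shifted_path s @^-1` A) = P (shifted_path 0 @^-1` A).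
Proof.
have [mZ iZ dZ] := hZ.
apply: (@law_unique _ _ _ P _ path_space (cylinders coord_process predT)) => //.
- exact: cylinders_setI_closed.
- exact: cylindersT.
- exact: measurable_shifted_path.
- exact: measurable_shifted_path.
move=> _ [s0 [B [_ mB ->]]].
have e s' : P (shifted_path s' @^-1` cylinder coord_process s0 B) = (\prod_(i <- undup s0) P (Z 0 @^-1` B i))%E.
  have -> : shifted_path s' @^-1` cylinder coord_process s0 B =
      cylinder Z [seq i + s' | i <- undup s0] (fun i => B (i - s')).
    apply/seteqP; split => w.
      move=> /cylinderP h; apply/cylinderP => _ /mapP[i + ->].
      by rewrite mem_undup addrK => /h.
    move=> /cylinderP h; apply/cylinderP => i ii.
    by have := h (i + s'); rewrite addrK; apply; apply: map_f; rewrite mem_undup.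
  rewrite /cylinder iZ//; last by rewrite map_inj_uniq ?undup_uniq//; exact: addIr.
  rewrite big_map; apply: eq_bigr => i _.
  by rewrite addrK (dZ _ 0).
by rewrite !e.
Qed.

End paths.

(** * The explicit solution *)

Section modulus.
Context {R : realType}.
Local Notation normc := Normc.normc.
Implicit Type z : R[i].

Lemma normr_lt1 z : (`|z| < 1) = (normc z < 1).
Proof. by rewrite normcE' -[1]/(1%:C) ltcR. Qed.

Lemma normr_gt1 z : (1 < `|z|) = (1 < normc z).
Proof. by rewrite normcE' -[1]/(1%:C) ltcR. Qed.

Lemma normr_eq1 z : (`|z| == 1) = (normc z == 1).
Proof. by rewrite normcE' eq_complex/= eqxx andbT. Qed.

Lemma normc_gt0 z : (0 < normc z) = (z != 0).
Proof. by rewrite -normr_gt0 normcE' -[0 in RHS]/(0%:C) ltcR. Qed.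

End modulus.

Lemma ae_forall_int {R : realType} {dO : measure_display} {Omega : measurableType dO}
    (P : probability Omega R) (Q : int -> Omega -> Prop) :
  (forall s, {ae P, forall w, Q s w}) -> {ae P, forall w, forall s, Q s w}.
Proof.
move=> hQ.
have h1 : {ae P, forall w, forall n, Q (Posz n) w} by exact: ae_foralln.
have h2 : {ae P, forall w, forall n, Q (Negz n) w} by exact: ae_foralln.
by apply: filterS2 h1 h2 => w w1 w2 [].
Qed.

Lemma measurable_fun_vseries {R : realType} d (T : measurableType d) p
    (u : nat -> T -> 'cV[R[i]]_p) : (forall j, measurable_fun setT (u j)) ->
  measurable_fun setT (fun x => vseries (u ^~ x)).
Proof.
move=> mu; apply: measurable_fun_mxP => i j; under eq_fun do rewrite mxE.
have entry f : measurable_fun setT f ->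
    measurable_fun setT (fun x => limn (series (fun j => f (u j x i 0) : R))).
  move=> mf; apply: measurable_fun_limn => n; rewrite /series/=.
  apply: measurable_sum => k; apply: (measurableT_comp mf).
  exact: measurable_fun_mxE.
apply: measurable_fun_complexP; apply: entry; [exact: measurable_Re|exact: measurable_Im].
Qed.

Section explicit.
Context {R : realType}.
Local Notation C := R[i].
Local Notation normc := Normc.normc.
Variables (m d q H : nat) (Theta : 'I_q.+1 -> 'M[C]_(m, d)) (S : 'M[C]_m).
Variables (r : nat -> nat) (lambda : 'I_H -> C).
Local Notation Phi := (Phi r lambda).

Definition block_theta (h : nat) (k : 'I_q.+1) : 'M[C]_(bsize r h, d) :=
  block_sel m r h *m invmx S *m Theta k.

Local Notation N h := (block_noise_coef Theta S r lambda h).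

Section path.
Context {dO : measure_display} {Omega : measurableType dO}.
Variable Z : int -> Omega -> 'cV[C]_d.

Lemma inner_termE (h : 'I_H) t w : lambda h != 0 ->
  inner_term Theta Z S r lambda h t w = inner_series (Phi h) (block_theta h) (Z ^~ w) t.
Proof.
move=> l0; apply/funext => j; rewrite /inner_term /inner_series -inner_coefE//.
exact: unitmx_jordan.
Qed.

Lemma outer_termE (h : 'I_H) t w : lambda h != 0 ->
  outer_term Theta Z S r lambda h t w = outer_series (Phi h) (block_theta h) (Z ^~ w) t.
Proof.
move=> l0; apply/funext => j; rewrite /outer_term /outer_series -outer_coefE//.
exact: unitmx_jordan.
Qed.

Variable f : forall h : 'I_H, 'cV[C]_(bsize r h).

(** The almost sure properties of the noise on which the recursion of the
    [h]-th block rests. *)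
Definition good_path (h : 'I_H) (z : int -> 'cV[C]_d) : Prop :=
  [/\ 0 < normc (lambda h) < 1 ->
        forall s, geom_dominated (fun j => Phi h ^+ j *m (N h *m z (s - q%:Z - j%:Z))),
      1 < normc (lambda h) ->
        forall s, geom_dominated (fun j => invmx (Phi h) ^+ j *m (N h *m z (s - q%:Z + 1 + j%:Z)))
    & normc (lambda h) = 1 ->
        forall s, N h *m z s = (1%:M - Phi h) *m f h].

(** For the eigenvalue zero the block is nilpotent and the finite sum is an
    instance of the series for small eigenvalues. For modulus one, the constant
    noise is absorbed by [f h]. *)
Lemma block_solution_rec (h : 'I_H) (t : int) (w : Omega) : (bsize r h <= m)%N -> good_path h (Z ^~ w) ->
  block_solution Theta Z S lambda f h t w - Phi h *m block_solution Theta Z S lambda f h (t - 1) w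
  = noise (block_theta h) (Z ^~ w) t.
Proof.
move=> pm [g1 g2 g3]; rewrite /block_solution.
have [l0|l0] := eqVneq (lambda h) 0.
  have Phi0 : Phi h ^+ m = 0.
    rewrite -(subnK pm) exprD /Defs.Phi l0 (lower_band_nilpotent (@lower_band_jordan0 _ _)).
    by rewrite mulr0.
  have z0 s j : (m + q <= j)%N -> inner_series (Phi h) (block_theta h) (Z ^~ w) s j = 0.
    move=> mj; rewrite /inner_series ma_coef_large; last by rewrite (leq_trans _ mj)// leq_addl.
    have -> : (j - q = m + (j - q - m))%N by lia.
    by rewrite exprD Phi0 mul0r !mul0mx.
  have X s : \sum_(0 <= j < m + q) fin_coef Theta S r lambda h j *m Z (s - j%:Z) w =
      vseries (inner_series (Phi h) (block_theta h) (Z ^~ w) s).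
    rewrite big_mkord; apply/esym/vcvg_vseries; exact: (vcvg_finite (z0 s)).
  rewrite !X; apply: inner_series_rec => s.
  apply: (@geom_dominated_eventually _ _ _ 0 (1 / 2) m) => //; first lra.
  move=> j mj; rewrite -(subnKC mj) exprD Phi0 !mul0r mul0mx.
  by rewrite (vector_norm0 (wnorm_vector_norm _ ltr01)).
have [l1|l1] := boolP (`|lambda h| < 1).
  rewrite !inner_termE//; apply: inner_series_rec; apply: g1.
  by rewrite -normr_lt1 l1 normc_gt0 l0.
have [/eqP l2|l2] := boolP (`|lambda h| == 1).
  rewrite mulmxDr opprD addrACA !big_mkord.
  rewrite [X in _ + X](ma_part_rec (Phi h) (block_theta h) (Z ^~ w) t).
    have n1 : normc (lambda h) = 1 by apply/eqP; rewrite -normr_eq1 l2.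
  have -> : ma_total (Phi h) (block_theta h) *m Z (t - q%:Z) w = _ := g3 n1 (t - q%:Z).
  by rewrite mulmxBl mul1mx addrC subrK.
rewrite !outer_termE//; apply: outer_series_rec; first exact: unitmx_jordan.
apply: g2; rewrite -normr_gt1 lt_neqAle eq_sym l2/=.
by rewrite real_leNgt ?normr_real ?real1.
Qed.

Hypothesis mZ : forall i, measurable_fun setT (Z i).

Lemma measurable_block_solution (h : 'I_H) t :
  measurable_fun setT (block_solution Theta Z S lambda f h t).
Proof.
have mf n (c : nat -> 'M[C]_(bsize r h, d)) :
    measurable_fun setT (fun w => \sum_(0 <= j < n) c j *m Z (t - j%:Z) w).
  by apply: measurable_fun_mx_sum => j; exact: measurable_fun_mulmx.
rewrite /block_solution; case: (lambda h == 0); first exact: mf.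
case: (`|lambda h| < 1).
  apply: measurable_fun_vseries => j; exact: measurable_fun_mulmx.
case: (`|lambda h| == 1); first by apply: measurable_fun_mxD; [exact: measurable_cst|exact: mf].
apply: measurable_fun_mxN; apply: measurable_fun_vseries => j.
exact: measurable_fun_mulmx.
Qed.

Lemma measurable_explicit_solution t :
  measurable_fun setT (explicit_solution Theta Z S lambda f t).
Proof.
apply: measurable_fun_mulmx; apply: measurable_fun_mx_sum => h.
by apply: measurable_fun_mulmx; exact: measurable_block_solution.
Qed.

End path.

Section shift.
Context {dO : measure_display} {Omega : measurableType dO}.
Variable Z : int -> Omega -> 'cV[C]_d.
Variable f : forall h : 'I_H, 'cV[C]_(bsize r h).

Lemma block_solution_shift (h : 'I_H) t s w :
  block_solution Theta Z S lambda f h (t + s) w =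
  block_solution (Omega := path_space) Theta (@coord_process _ _) S lambda f h t (shifted_path Z s w).
Proof.
have e (j : int) : Z (t + s - j) w = coord_process (t - j) (shifted_path Z s w).
  by rewrite /coord_process /shifted_path addrAC.
have e' (j : int) : Z (t + s + j) w = coord_process (t + j) (shifted_path Z s w).
  by rewrite /coord_process /shifted_path addrAC.
rewrite /block_solution; case: (lambda h == 0); first by apply: eq_bigr => j _; rewrite e.
case: (`|lambda h| < 1).
  by congr vseries; apply/funext => j; rewrite /inner_term e.
case: (`|lambda h| == 1).
  by congr (_ + _); apply: eq_bigr => j _; rewrite e.
by congr (- vseries _); apply/funext => j; rewrite /outer_term e'.
Qed.

Lemma explicit_solution_shift t s w :
  explicit_solution Theta Z S lambda f (t + s) w =
  explicit_solution (Omega := path_space) Theta (@coord_process _ _) S lambda f t (shifted_path Z s w).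
Proof.
have E : (fun h => block_solution Theta Z S lambda f h (t + s) w) =
    (fun h => block_solution (Omega := path_space) Theta (@coord_process _ _) S lambda f h t
                (shifted_path Z s w)).
  by apply: functional_extensionality_dep => h; exact: block_solution_shift.
exact: (f_equal (fun x : (forall h : 'I_H, 'cV[C]_(bsize r h)) => S *m stack m x) E).
Qed.

End shift.

End explicit.

(** * The block decomposition *)

Section blocks.
Context {R : realType}.
Local Notation C := R[i].
Variables (m H : nat) (r : nat -> nat) (lambda : 'I_H -> C).
Hypothesis hr : is_block_partition m H r.
Local Notation Phi := (Phi r lambda).
Local Notation B h := (@block_sel R m r h).

Lemma partition_le i j : (i <= j <= H)%N -> (r i <= r j)%N.
Proof.
move=> /andP[]; elim: j => [|j IH]; first by rewrite leqn0 => /eqP ->.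
rewrite leq_eqVlt ltnS => /predU1P[->//|ij] jH.
apply: leq_trans (IH ij (ltnW jH)) _.
by have [_ h _] := hr; exact: ltnW (h (Ordinal jH)).
Qed.

Lemma block_end h (i : 'I_(bsize r h)) : (i + r h < r h.+1)%N.
Proof. by rewrite addnC -ltn_subRL; exact: ltn_ord. Qed.

Lemma partition_lt_m (h : 'I_H) (i : 'I_(bsize r h)) : (i + r h < m)%N.
Proof.
have [_ _ rH] := hr; apply: leq_trans (_ : r h.+1 <= m)%N.
  exact: block_end.
by rewrite -rH; apply: partition_le; rewrite ltn_ord leqnn.
Qed.

Lemma bsize_le_m (h : 'I_H) : (bsize r h <= m)%N.
Proof.
have [_ _ rH] := hr; apply: leq_trans (leq_subr _ _) _.
by rewrite -rH; apply: partition_le; rewrite ltn_ord leqnn.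
Qed.

Lemma bsize_gt0 (h : 'I_H) : (0 < bsize r h)%N.
Proof. by rewrite subn_gt0; have [_ + _] := hr; apply. Qed.

Lemma block_sel_tr (h : 'I_H) : B h *m (B h)^T = 1%:M.
Proof.
apply/matrixP => i j; rewrite !mxE.
rewrite (bigD1 (Ordinal (partition_lt_m i)))//= !mxE/= eqxx mul1r big1 ?addr0.
  by rewrite eqn_add2r; case: eqP => [/val_inj ->|]; rewrite ?eqxx//; case: eqP => // ->.
move=> k; rewrite -val_eqE/= !mxE => /negPf ->.
by rewrite mul0r.
Qed.

Lemma block_sel_tr_neq (h h' : 'I_H) : h != h' -> B h *m (B h')^T = 0.
Proof.
move=> hh'; apply/matrixP => i j; rewrite !mxE big1// => k _; rewrite !mxE.
case: eqP => [->|]; last by rewrite mul0r.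
case: eqP => [e|]; last by rewrite mulr0.
have lt_block (g g' : 'I_H) (a : 'I_(bsize r g)) (b : 'I_(bsize r g')) :
    (g < g')%N -> (a + r g < b + r g')%N.
  move=> gg'; apply: leq_trans (_ : r g.+1 <= _)%N.
    exact: block_end.
  apply: leq_trans (leq_addl _ _); apply: partition_le.
  by rewrite gg' ltnW.
move: hh'; rewrite -val_eqE neq_ltn => /orP[] /lt_block.
  by move=> /(_ i j); rewrite e ltnn.
by move=> /(_ j i); rewrite e ltnn.
Qed.

(** That row [b] lies in block [h] is expressed by the difference of the
    indicators of [b < r h.+1] and [b < r h], which telescopes over [h]. *)
Lemma sum_block_sel : \sum_(h < H) (B h)^T *m B h = 1%:M.
Proof.
have [r0 rS rH] := hr.
apply/matrixP => a b; rewrite summxE mxE.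
under eq_bigr do rewrite mxE.
have [->|ab] := eqVneq a b; last first.
  rewrite big1// => h _; rewrite big1// => i _; rewrite !mxE.
  case: eqP => [ai|]; last by rewrite mul0r.
  by rewrite -ai; rewrite -val_eqE eq_sym in ab; rewrite (negPf ab) mulr0.
pose u k : C := (b < r k)%N%:R.
transitivity (\sum_(h < H) (u h.+1 - u h)).
  apply: eq_bigr => h _; rewrite /u.
  have rh : (r h <= r h.+1)%N by exact: ltnW (rS h).
  have [hb|bh] := ltnP b (r h).
    rewrite (leq_trans hb rh) subrr big1// => i _; rewrite !mxE.
    by rewrite ltn_eqF ?mul0r// (leq_trans hb)// leq_addl.
  have [bS|Sb] := ltnP b (r h.+1); last first.
    rewrite subrr big1// => i _; rewrite !mxE gtn_eqF ?mul0r//.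
    by apply: leq_trans Sb; exact: block_end.
  have ib : (b - r h < bsize r h)%N by rewrite ltn_sub2r// (leq_ltn_trans bh).
  rewrite (bigD1 (Ordinal ib))//= !mxE/= subnK// eqxx mulr1 subr0 big1 ?addr0// => i.
  rewrite -val_eqE/= => ibi; rewrite !mxE; case: eqP => [e|]; last by rewrite mul0r.
  by rewrite e addnK eqxx in ibi.
rewrite -(big_mkord predT (fun k => u k.+1 - u k)) telescope_sumr// /u r0 rH.
by rewrite ltn_ord ltn0 subr0 mulr1n.
Qed.

Lemma jordan_form_block (h : 'I_H) : B h *m jordan_form m r lambda = Phi h *m B h.
Proof.
rewrite /jordan_form mulmx_sumr (bigD1 h)//= big1 ?addr0.
  by rewrite !mulmxA block_sel_tr mul1mx.
by move=> h' h'h; rewrite !mulmxA block_sel_tr_neq ?mul0mx// eq_sym.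
Qed.

Lemma jordan_form_stack x : jordan_form m r lambda *m stack m x = stack m (fun h => Phi h *m x h).
Proof.
rewrite /jordan_form /stack mulmx_suml; apply: eq_bigr => h _.
rewrite mulmx_sumr (bigD1 h)//= big1 ?addr0.
  by rewrite -!mulmxA (mulmxA (B h)) block_sel_tr mul1mx.
move=> h' h'h; rewrite -!mulmxA (mulmxA (B h)) block_sel_tr_neq ?mul0mx ?mulmx0//.
by rewrite eq_sym.
Qed.

Lemma stack_block (y : 'cV[C]_m) : stack m (fun h : 'I_H => B h *m y) = y.
Proof.
rewrite /stack; under eq_bigr do rewrite mulmxA.
by rewrite -mulmx_suml sum_block_sel mul1mx.
Qed.

End blocks.

(** * Sufficiency *)

Lemma noise_const_ae {R : realType} {dO : measure_display} {Omega : measurableType dO}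
    (P : probability Omega R) d p (Z : int -> Omega -> 'cV[R[i]]_d) (N : 'M[R[i]]_(p, d)) alpha :
  iid P Z -> {ae P, forall w, N *m Z 0 w = alpha} ->
  {ae P, forall w, forall s, N *m Z s w = alpha}.
Proof.
move=> hZ ha; apply: ae_forall_int => s.
pose A : set 'cV[R[i]]_d := [set v | N *m v = alpha].
have mA : measurable A.
  rewrite (_ : A = [set v | wnorm 1 (N *m v - alpha) <= 0]).
    apply: measurable_le_set; apply: measurable_wnorm; apply: measurable_fun_mxB.
      by apply: measurable_fun_mulmx; exact: measurable_id.
    exact: measurable_cst.
  apply/seteqP; split => v /=.
    by rewrite /A/= => ->; rewrite subrr (vector_norm0 (wnorm_vector_norm _ ltr01)).
  rewrite le_eqVlt ltNge wnorm1_ge0 orbF => /eqP.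
  have [wn _ _] := wnorm_vector_norm p (@ltr01 R).
  by move/wn/eqP; rewrite subr_eq0 => /eqP.
exact: (identically_distributed_ae hZ s mA ha).
Qed.

Section sufficiency.
Context {R : realType} {dO : measure_display} {Omega : measurableType dO}.
Variable P : probability Omega R.
Local Notation C := R[i].
Local Notation normc := Normc.normc.
Variable nrm : forall s : nat, 'cV[C]_s -> R.
Hypothesis hnrm : forall s, vector_norm (@nrm s).
Variables (m d q : nat) (Z : int -> Omega -> 'cV[C]_d).
Hypothesis hZ : iid P Z.
Variables (Psi1 : 'M[C]_m) (Theta : 'I_q.+1 -> 'M[C]_(m, d)) (S : 'M[C]_m).
Hypothesis hS : S \in unitmx.
Variables (H : nat) (r : nat -> nat) (lambda : 'I_H -> C).
Hypothesis hr : is_block_partition m H r.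
Hypothesis hJ : invmx S *m Psi1 *m S = jordan_form m r lambda.

Local Notation Phi := (Phi r lambda).
Local Notation B h := (@block_sel R m r h).
Local Notation theta h := (block_theta Theta S r h).

Let Psi1E : Psi1 = S *m jordan_form m r lambda *m invmx S.
Proof. by rewrite -hJ -!mulmxA mulmxV// mulmx1 mulKVmx. Qed.

Lemma noise_block h z t :
  noise (theta h) z t = B h *m invmx S *m \sum_(k < q.+1) Theta k *m z (t - (k : nat)%:Z).
Proof.
by rewrite mulmx_sumr; apply: eq_bigr => k _; rewrite !mulmxA.
Qed.

(** [invmx S] splits the equation into one equation per Jordan block, and
    [stack_equation] recombines them. *)
Lemma block_equation (h : 'I_H) (y y' v : 'cV[C]_m) : y - Psi1 *m y' = v ->
  B h *m invmx S *m y - Phi h *m (B h *m invmx S *m y') = B h *m invmx S *m v.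
Proof.
move=> <-; rewrite mulmxBr; congr (_ - _).
rewrite Psi1E -!mulmxA; rewrite (mulmxA (invmx S) S) mulVmx// mul1mx.
by rewrite !mulmxA (jordan_form_block lambda hr).
Qed.

Lemma stack_equation (x x' : forall h : 'I_H, 'cV[C]_(bsize r h)) (v : 'cV[C]_m) :
  (forall h, x h - Phi h *m x' h = B h *m invmx S *m v) ->
  S *m stack m x - Psi1 *m (S *m stack m x') = v.
Proof.
move=> hx; rewrite Psi1E -!mulmxA (mulmxA (invmx S) S) mulVmx// mul1mx.
rewrite (jordan_form_stack lambda hr) -mulmxBr -sumrB.
under eq_bigr do rewrite -mulmxBr hx -mulmxA.
by rewrite -/(stack m (fun h : 'I_H => B h *m (invmx S *m v))) (stack_block hr) mulKVmx.
Qed.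

Variables alpha f : forall h : 'I_H, 'cV[C]_(bsize r h).
Hypothesis halpha : noise_constants P Theta Z S lambda alpha.
Hypothesis hf : solves_shift lambda alpha f.
Hypothesis hi : cond_i P Theta Z S r lambda nrm.

Lemma good_path_ae (h : 'I_H) :
  {ae P, forall w, good_path Theta S lambda f h (Z ^~ w)}.
Proof.
have hE : normc (lambda h) != 0 -> normc (lambda h) != 1 ->
    ('E_P[fun w => log_plus (nrm (block_noise_coef Theta S r lambda h *m Z 0 w)%R)] < +oo)%E.
  move=> n0 n1; apply: hi; last by rewrite normr_eq1.
  by rewrite normr_eq0; apply: contra n0 => /eqP ->; rewrite Normc.normc0.
have [l1|l1|l1] := ltgtP (normc (lambda h)) 1.
- have [l0|l0] := eqVneq (lambda h) 0.
    apply: aeW => w; rewrite /good_path l0 Normc.normc0 ltxx ltr10; split => //.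
    by move=> /eqP; rewrite eq_sym oner_eq0.
  have l01 : 0 < normc (lambda h) < 1 by rewrite normc_gt0 l0.
  have [e [a [b hc]]] := contracting_jordan (bsize r h) l01.
  have n0 : normc (lambda h) != 0 by rewrite gt_eqF// normc_gt0.
  have n1 : normc (lambda h) != 1 by rewrite lt_eqF.
  have n1' := elimN eqP n1.
  apply: filterS (ae_forall_int (fun s => contracting_series_ae hZ
    (fun j => s - q%:Z - j%:Z) hc (hnrm _) (hE n0 n1))) => w hw.
  split => [//|l2|/n1' []]; exfalso; by move: (lt_trans l2 l1); rewrite ltxx.
- have [e [a [b hc]]] := contracting_invmx_jordan (bsize r h) l1.
  have n0 : normc (lambda h) != 0 by rewrite gt_eqF// (lt_trans ltr01).
  have n1 : normc (lambda h) != 1 by rewrite gt_eqF.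
  have n1' := elimN eqP n1.
  apply: filterS (ae_forall_int (fun s => contracting_series_ae hZ
    (fun j => s - q%:Z + 1 + j%:Z) hc (hnrm _) (hE n0 n1))) => w hw.
  split => [/andP[_ l2]|//|/n1' []]; exfalso; by move: (lt_trans l2 l1); rewrite ltxx.
have n1 : `|lambda h| = 1 by apply/eqP; rewrite normr_eq1 l1.
have [ha _] := halpha n1.
have hN := noise_const_ae hZ ha.
apply: filterS hN => w hw; split; rewrite l1 ?ltxx ?andbF// => _ s.
by rewrite hw hf.
Qed.

Lemma explicit_solution_is_solution :
  is_solution P Psi1 Theta Z (explicit_solution Theta Z S lambda f).
Proof.
have mZ : forall i, measurable_fun setT (Z i) by case: hZ.
split=> t; first exact: measurable_explicit_solution.
have : {ae P, forall w, forall h : 'I_H, good_path Theta S lambda f h (Z ^~ w)}.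
  by apply: filter_forall => h; exact: good_path_ae.
apply: filterS => w hw; apply: stack_equation => h.
by rewrite block_solution_rec ?(bsize_le_m hr)// noise_block.
Qed.

Lemma explicit_solution_stationary :
  strictly_stationary P (explicit_solution Theta Z S lambda f).
Proof.
apply: (@strictly_stationary_factor _ _ _ P _ _ _ path_space (shifted_path Z)
  (explicit_solution (Omega := path_space) Theta (@coord_process _ _) S lambda f)).
- exact: measurable_shifted_path hZ.
- exact: shifted_path_law hZ.
- by move=> t; apply: measurable_explicit_solution; exact: measurable_coord_process.
- by move=> t s w; exact: explicit_solution_shift.
Qed.

Lemma explicit_series_converge_absolutely :
  series_converge_absolutely P Theta Z S r lambda nrm.
Proof.
move=> h t; have hg := good_path_ae h; split=> hl; apply: filterS hg => w [g1 g2 _].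
  have /andP[l0 l1] := hl; rewrite normr_gt0 in l0; rewrite normr_lt1 in l1.
  rewrite inner_termE//; apply: geom_dominated_nneseries => //.
  by apply: inner_series_dominated; apply: g1; rewrite normc_gt0 l0.
rewrite normr_gt1 in hl; have l0 : lambda h != 0 by rewrite -normc_gt0 (lt_trans ltr01).
rewrite outer_termE//; apply: geom_dominated_nneseries => //.
by apply: outer_series_dominated; exact: g2.
Qed.

End sufficiency.

(** * Uniqueness *)

Section vanishing.
Context {R : realType} {dO : measure_display} {Omega : measurableType dO}.
Variable P : probability Omega R.
Local Notation C := R[i].

(** A tight family cannot be blown up from [D t] by the inverse powers of a
    contraction. *)
Lemma tight_contracting_eq0 I p (D : I -> Omega -> 'cV[C]_p) (M : 'M[C]_p) e a b t
    (tau : nat -> I) : tight P D -> contracting M e a b ->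
  {ae P, forall w, forall n, D t w = M ^+ n *m D (tau n) w} ->
  {ae P, forall w, D t w = 0}.
Proof.
move=> [mD tD] hM hD; have [/andP[e0 e1] _ /andP[b0 b1] _] := hM.
have mV : measurable_fun setT (fun w => wnorm e (D t w)) by exact: measurable_wnorm.
have P0 dl : 0 < dl -> P [set w | dl < wnorm e (D t w)] = 0%E.
  move=> dl0; apply: (@le_anti _ (\bar R)); rewrite measure_ge0 andbT.
  apply/lee_addgt0Pr => ep ep0; rewrite add0e.
  have [K hK] := tD _ ep0.
  have K0 : 0 < `|K| + 1 by rewrite ltr_wpDl.
  have [n hn] : exists n, b ^+ n * (`|K| + 1) <= dl.
    have bn : (fun n => b ^+ n) @ \oo --> (0 : R).
      by apply: cvg_expr; rewrite ger0_norm// ltW.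
    have /cvgrPdist_le/(_ (dl / (`|K| + 1)))[|n _ hn] := bn.
      by rewrite divr_gt0.
    exists n; have := hn n (leqnn n); rewrite /= sub0r normrN ger0_norm ?exprn_ge0 ?(ltW b0)//.
    by rewrite ler_pdivlMr.
  apply: le_trans (hK (tau n)); apply: probability_le_ae.
  - exact: measurable_gt_set.
  - by apply: measurable_gt_set; exact: measurable_wnorm.
  apply: filterS hD => w /(_ n) /= -> h.
  have /andP[_ h'] := contractingX n (D (tau n) w) hM.
  have h2 := lt_le_trans (le_lt_trans hn h) h'.
  rewrite ltr_pM2l ?exprn_gt0// in h2.
  apply: (@lt_le_trans _ _ (wnorm e (D (tau n) w))); last first.
    by apply: wnorm_le_wnorm1; rewrite (ltW e0).
  by apply: le_lt_trans h2; rewrite (le_trans (ler_norm K))// lerDl.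
have hk (k : nat) : {ae P, forall w, wnorm e (D t w) <= k.+1%:R^-1}.
  exists [set w | k.+1%:R^-1 < wnorm e (D t w)]; split.
  - exact: measurable_gt_set.
  - by apply: P0; rewrite invr_gt0.
  - by move=> w /= /negP; rewrite -ltNge.
apply: filterS (ae_foralln hk) => w hw.
have [wn _ _] := wnorm_vector_norm p e0; apply: wn; apply: le_anti.
rewrite wnorm_ge0 ?(ltW e0)// andbT; apply/ler_addgt0Pr => ep ep0; rewrite add0r.
have [k _ hk'] := near_infty_natSinv_lt (PosNum ep0).
by apply: le_trans (hw k) _; apply: ltW; exact: hk' (leqnn k).
Qed.

End vanishing.

Section uniqueness.
Context {R : realType} {dO : measure_display} {Omega : measurableType dO}.
Variable P : probability Omega R.
Local Notation C := R[i].
Local Notation normc := Normc.normc.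
Variables (p : nat) (l : C).
Local Notation Phi := (jordan_block p l).

(** Iterate backwards when [|l| < 1], forwards when [|l| > 1], and [p] times when
    [l = 0]. *)
Lemma homogeneous_block_eq0 (D : int -> Omega -> 'cV[C]_p) : tight P D -> normc l != 1 ->
  (forall t, {ae P, forall w, D t w = Phi *m D (t - 1) w}) ->
  forall t, {ae P, forall w, D t w = 0}.
Proof.
move=> tD l1 /ae_forall_int hD t.
have iter : {ae P, forall w, forall n (s : int), D s w = Phi ^+ n *m D (s - n%:Z) w}.
  apply: filterS hD => w hw; elim=> [|n IH] s; first by rewrite expr0 mul1mx subr0.
  rewrite IH hw exprSr -[Phi ^+ n * _]/(_ *m _) -mulmxA; congr (_ *m (_ *m D _ w)).
  by lia.
have [l0|l0] := eqVneq l 0.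
  apply: filterS iter => w /(_ p t); rewrite l0 => ->.
  by rewrite (lower_band_nilpotent (@lower_band_jordan0 _ _)) mul0mx.
have [l1'|l1'] := ltP (normc l) 1.
  have l01 : 0 < normc l < 1 by rewrite normc_gt0 l0.
  have [e [a [b hc]]] := contracting_jordan p l01.
  apply: (tight_contracting_eq0 (tau := fun n => t - n%:Z) tD hc).
  by apply: filterS iter => w hw n; exact: hw.
have lgt1 : 1 < normc l by rewrite lt_neqAle eq_sym l1.
have [e [a [b hc]]] := contracting_invmx_jordan p lgt1.
apply: (tight_contracting_eq0 (tau := fun n => t + n%:Z) tD hc).
apply: filterS iter => w hw n; rewrite (hw n (t + n%:Z)) addrK.
by have := invmxXK n 0 (unitmx_jordan p l0); rewrite addn0 expr0 mulmxA => ->; rewrite mul1mx.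
Qed.

End uniqueness.

(** * Necessity *)

Section iterated_differences.
Context {R : realType}.
Local Notation C := R[i].
Variables (p : nat) (A : 'M[C]_p) (c : C) (n : nat).
Implicit Types x zeta : int -> 'cV[C]_p.

Definition partial_sum zeta (t : int) : 'cV[C]_p := \sum_(i < n) A ^+ i *m zeta (t - (i : nat)%:Z).

Lemma recursion_partial_sum x zeta : (forall t, x t - A *m x (t - 1) = zeta t) ->
  forall t, x t = A ^+ n *m x (t - n%:Z) + partial_sum zeta t.
Proof.
move=> hx; rewrite /partial_sum; elim: n => [|k IH] t.
  by rewrite expr0 mul1mx subr0 big_ord0 addr0.
rewrite IH big_ord_recr/= -(subrK (A *m x (t - k%:Z - 1)) (x (t - k%:Z))) hx.
have -> : t - k.+1%:Z = t - k%:Z - 1 by lia.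
rewrite mulmxDr exprSr -[A ^+ k * _]/(_ *m _) mulmxA.
by rewrite -addrA addrCA [X in _ + X]addrC.
Qed.

(** Iterated differences with lag [n]. They are used with [c = l ^+ n] and
    [|l| = 1], so that they preserve tightness uniformly in [n]. *)
Fixpoint iter_diff (j : nat) x (t : int) : 'cV[C]_p :=
  if j is k.+1 then iter_diff k x t - c *: iter_diff k x (t - n%:Z) else x t.

Fixpoint iter_diff_noise (j : nat) zeta (t : int) : 'cV[C]_p :=
  if j is k.+1 then
    iter_diff_noise k zeta t + (A ^+ n - c%:M) ^+ k *m partial_sum zeta (t - (k * n)%N%:Z)
    - c *: iter_diff_noise k zeta (t - n%:Z)
  else 0.

Lemma iter_diff_noiseS j zeta t : iter_diff_noise j.+1 zeta t =
  iter_diff_noise j zeta t + (A ^+ n - c%:M) ^+ j *m partial_sum zeta (t - (j * n)%N%:Z)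
    - c *: iter_diff_noise j zeta (t - n%:Z).
Proof. by []. Qed.

(** Each differencing replaces one power of [A ^+ n] in front of the remote
    past by [A ^+ n - c]. *)
Lemma iter_diffE x zeta : (forall t, x t - A *m x (t - 1) = zeta t) ->
  forall j t, iter_diff j x t =
    (A ^+ n - c%:M) ^+ j *m x (t - (j * n)%N%:Z) + iter_diff_noise j zeta t.
Proof.
move=> hx; elim=> [|j IH] t; first by rewrite /= expr0 mul1mx mul0n subr0 addr0.
rewrite /= !IH.
have -> : t - n%:Z - (j * n)%N%:Z = t - (j.+1 * n)%N%:Z by lia.
rewrite [in LHS](recursion_partial_sum hx (t - (j * n)%N%:Z)).
have -> : t - (j * n)%N%:Z - n%:Z = t - (j.+1 * n)%N%:Z by lia.
rewrite exprSr -[X in _ = X *m _ + _]/(_ *m _) -mulmxA mulmxBl mul_scalar_mx mulmxBr mulmxDr.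
rewrite scalerDr scalemxAr opprD.
set a := _ *m (A ^+ n *m _); set b := _ *m partial_sum _ _; set e := _ *m (c *: _).
set u := iter_diff_noise _ _ _; set v := c *: iter_diff_noise _ _ _.
by rewrite [u + b]addrC -[a + b + u]addrA addrACA.
Qed.

End iterated_differences.

Section noise_combinations.
Context {R : realType} {dO : measure_display} {Omega : measurableType dO}.
Local Notation C := R[i].
Variables (d p q : nat) (Z : int -> Omega -> 'cV[C]_d) (A : 'M[C]_p) (N : 'M[C]_(p, d)) (c : C) (n : nat).
Local Notation zeta w := (fun t => N *m Z (t - q%:Z) w).
Implicit Types (s : seq int).

Lemma lin_comb_partial_sum s t : uniq s -> (forall k, (k < n)%N -> t - q%:Z - k%:Z \in s) ->
  lin_comb Z s (fun w => partial_sum A n (zeta w) t).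
Proof.
move=> us hs; apply: lin_comb_sum => i.
have : lin_comb Z s (fun w => N *m Z (t - (i : nat)%:Z - q%:Z) w).
  by apply: lin_comb_coord => //; rewrite addrAC; exact: hs.
exact: lin_comb_mulmx.
Qed.

Lemma lin_combN s (V : Omega -> 'cV[C]_p) (a : C) : lin_comb Z s V ->
  lin_comb Z s (fun w => - (a *: V w)).
Proof.
move=> /(@lin_comb_mulmx _ _ _ _ _ _ _ _ (- a%:M)).
by under eq_fun do rewrite mulNmx mul_scalar_mx.
Qed.

Lemma lin_comb_iter_diff_noise j s t : uniq s ->
  (forall k, (k < j * n)%N -> t - q%:Z - k%:Z \in s) ->
  lin_comb Z s (fun w => iter_diff_noise A c n j (zeta w) t).
Proof.
move=> us; elim: j t => [|j IH] t hs; first exact: lin_comb0.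
apply: lin_combD; first apply: lin_combD.
- by apply: IH => k kj; apply: hs; lia.
- apply: lin_comb_mulmx; apply: lin_comb_partial_sum => // k kn.
  have -> : t - (j * n)%N%:Z - q%:Z - k%:Z = t - q%:Z - (j * n + k)%N%:Z by lia.
  by apply: hs; lia.
apply: lin_combN; apply: IH => k kj.
have -> : t - n%:Z - q%:Z - k%:Z = t - q%:Z - (n + k)%N%:Z by lia.
by apply: hs; lia.
Qed.

(** The terms other than [partial_sum] involve the noise of earlier times
    only. *)
Lemma lin_comb_iter_diff_rest j s t : uniq s ->
  (forall k, (n <= k < n + j * n)%N -> t - q%:Z - k%:Z \in s) ->
  lin_comb Z s (fun w => iter_diff_noise A c n j.+1 (zeta w) t - partial_sum A n (zeta w) t).
Proof.
move=> us; elim: j t => [|j IH] t hs.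
  have -> : (fun w => iter_diff_noise A c n 1 (zeta w) t - partial_sum A n (zeta w) t) = fun=> 0.
    apply/funext => w; rewrite /= add0r scaler0 subr0 expr0 mul1mx.
    by rewrite mul0n subr0 subrr.
  exact: lin_comb0.
have -> : (fun w => iter_diff_noise A c n j.+2 (zeta w) t - partial_sum A n (zeta w) t) =
   fun w => (iter_diff_noise A c n j.+1 (zeta w) t - partial_sum A n (zeta w) t)
     + ((A ^+ n - c%:M) ^+ j.+1 *m partial_sum A n (zeta w) (t - (j.+1 * n)%N%:Z)
     - c *: iter_diff_noise A c n j.+1 (zeta w) (t - n%:Z)).
  apply/funext => w; rewrite iter_diff_noiseS.
  move: (iter_diff_noise _ _ _ _ _ _) (_ *m partial_sum _ _ _ _) (c *: _) => a b v.
  by rewrite -[a + b - v]addrA addrAC.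
apply: lin_combD; first by apply: IH => k kj; apply: hs; lia.
apply: lin_combD.
  apply: lin_comb_mulmx; apply: lin_comb_partial_sum => // k kn.
  have -> : t - (j.+1 * n)%N%:Z - q%:Z - k%:Z = t - q%:Z - (j.+1 * n + k)%N%:Z by lia.
  by apply: hs; lia.
apply: lin_combN; apply: lin_comb_iter_diff_noise => // k kj.
have -> : t - n%:Z - q%:Z - k%:Z = t - q%:Z - (n + k)%N%:Z by lia.
by apply: hs; lia.
Qed.

End noise_combinations.

Lemma subr_interchange (V : zmodType) (a b c e : V) : (a - b) - (c - e) = (a - c) - (b - e).
Proof. by rewrite !opprB addrACA [RHS]addrACA [X in _ + X = _]addrC. Qed.

Section necessity.
Context {R : realType} {dO : measure_display} {Omega : measurableType dO}.
Variable P : probability Omega R.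
Local Notation C := R[i].
Local Notation normc := Normc.normc.
Variables (p d q : nat) (Z : int -> Omega -> 'cV[C]_d).
Hypothesis hZ : iid P Z.
Variables (l : C) (L : 'I_q.+1 -> 'M[C]_(p, d)).
Local Notation A := (jordan_block p l).
Local Notation N := (ma_total A L).
Variable X : int -> Omega -> 'cV[C]_p.
Hypothesis tX : tight P X.
Hypothesis hX : forall t, {ae P, forall w, X t w - A *m X (t - 1) w = noise L (Z ^~ w) t}.
Variable nrm : 'cV[C]_p -> R.
Hypothesis hnrm : vector_norm nrm.

(** Subtracting the moving average part leaves a tight process driven by the
    single noise vector [N *m Z (t - q)], see [reduced_rec]. *)
Definition reduced (t : int) (w : Omega) := X t w - ma_part A L (Z ^~ w) t.

Lemma reduced_tight : tight P reduced.
Proof.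
have [mZ _ dZ] := hZ.
have tZ : tight P Z by apply: (tight_identical (i0 := 0)) => // i B mB; exact: dZ.
apply: tightB => //; apply: tight_sum => j.
by apply: tight_mulmx_cst; exact: (tight_comp (fun t => t - (j : nat)%:Z) tZ).
Qed.

Lemma reduced_rec :
  {ae P, forall w, forall t, reduced t w - A *m reduced (t - 1) w = N *m Z (t - q%:Z) w}.
Proof.
apply: filterS (ae_forall_int hX) => w hw t.
rewrite /reduced mulmxBr subr_interchange hw [X in _ - X](ma_part_rec A L (Z ^~ w)).
by rewrite opprB addrCA subrr addr0.
Qed.

Lemma log_moment_of_cf (M : 'M[C]_p) e a b dl :
  contracting M e a b -> 0 < dl ->
  (forall u : 'rV[C]_p, (forall k, normc (u 0 k) <= dl) -> forall n,
    \sum_(i < n) (1 - \int[P]_w cos (Re_form u ((M ^+ i *m N) *m (Z 0 w - Z 1 w)))) <= 3) ->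
  ('E_P[fun w => log_plus (nrm (N *m Z 0 w)%R)] < +oo)%E.
Proof.
move=> hM dl0 hcf; have [mZ _ _] := hZ.
have [K [c [K0 hc]]] := contracting_sum_proba hZ hM dl0 hcf.
have [/andP[e0 e1] a01 _ _] := hM.
have [c' c'0 hc'] := vector_norm_equiv hnrm (wnorm_vector_norm p e0).
apply: (log_plus_expectation_lty (V := fun w => wnorm e (N *m Z 0 w)) a01 K0 c'0) hc => //.
- by apply: measurable_wnorm; exact: measurable_fun_mulmx.
- by move=> w; apply: wnorm_ge0; exact: ltW.
Qed.

Lemma contractingX_tight (M : 'M[C]_p) e a b (Y : nat -> Omega -> 'cV[C]_p) :
  contracting M e a b -> tight P Y -> tight P (fun n w => M ^+ n *m Y n w).
Proof.
move=> hM; have [/andP[e0 e1] _ /andP[b0 b1] _] := hM.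
have [c c0 hc] := vector_norm_equiv (wnorm_vector_norm p (@ltr01 R)) (wnorm_vector_norm p e0).
apply: (tight_mulmx (B := c)) => n v; apply: le_trans (hc _) _; rewrite ler_pM2l//.
have /andP[_ h] := contractingX n v hM; apply: le_trans h _.
apply: le_trans (wnorm_le_wnorm1 v (e := e) _); last by rewrite (ltW e0).
by rewrite ler_piMl ?wnorm_ge0 ?(ltW e0)// exprn_ile1// ltW.
Qed.

Lemma uniq_affine (g : nat -> int) n : injective g -> uniq ([seq g i | i <- iota 0 n] ++ [::]).
Proof. by move=> gi; rewrite cats0 map_inj_uniq ?iota_uniq. Qed.

(** [reduced 0 - A ^+ n *m reduced (- n)] is tight in [n] and equals the sum of
    the independent vectors [A ^+ i *m N *m Z (- i - q)], [i < n]. *)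
Lemma necessity_inner : 0 < normc l < 1 ->
  ('E_P[fun w => log_plus (nrm (N *m Z 0 w)%R)] < +oo)%E.
Proof.
move=> l01; have [e [a [b hM]]] := contracting_jordan p l01.
pose T n w := reduced 0 w - A ^+ n *m reduced (- n%:Z) w.
have tT : tight P T.
  apply: tightB; first exact: (tight_comp (fun=> 0) reduced_tight).
  by apply: contractingX_tight hM _; exact: (tight_comp (fun n : nat => - n%:Z) reduced_tight).
have [|n|dl dl0 hcf] := tight_sum_cf hZ (B := fun i => A ^+ i *m N)
    (tau := fun _ i => - i%:Z - q%:Z) (s := fun=> [::]) tT.
- by move=> n; apply: uniq_affine => i j; lia.
- exists (fun=> 0); split; first exact: lin_comb0.
  apply: filterS reduced_rec => w hw.
  rewrite /T addr0.
  rewrite (recursion_partial_sum n (x := reduced ^~ w) (zeta := fun t => N *m Z (t - q%:Z) w) hw 0).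
  rewrite [_ + partial_sum _ _ _ _]addrC sub0r addrK /partial_sum.
  by apply: eq_bigr => i _; rewrite sub0r mulmxA.
exact: log_moment_of_cf hM dl0 hcf.
Qed.

(** Running time forwards, [A *m (invmx A ^+ n *m reduced n - reduced 0)] is tight
    in [n] and equals the sum of the independent vectors
    [invmx A ^+ i *m N *m Z (i + 1 - q)], [i < n]. *)
Lemma necessity_outer : 1 < normc l ->
  ('E_P[fun w => log_plus (nrm (N *m Z 0 w)%R)] < +oo)%E.
Proof.
move=> l1; have [e [a [b hM]]] := contracting_invmx_jordan p l1.
have l0 : l != 0 by rewrite -normc_gt0 (lt_trans ltr01).
have uA := unitmx_jordan p l0.
pose T n w := A *m (invmx A ^+ n *m reduced n%:Z w - reduced 0 w).
have tT : tight P T.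
  apply: tight_mulmx_cst; apply: tightB; last exact: (tight_comp (fun=> 0) reduced_tight).
  by apply: contractingX_tight hM _; exact: (tight_comp (fun n : nat => n%:Z) reduced_tight).
have [|n|dl dl0 hcf] := tight_sum_cf hZ (B := fun i => invmx A ^+ i *m N)
    (tau := fun _ i => i%:Z + 1 - q%:Z) (s := fun=> [::]) tT.
- by move=> n; apply: uniq_affine => i j; lia.
- exists (fun=> 0); split; first exact: lin_comb0.
  apply: filterS reduced_rec => w hw; rewrite addr0 /T.
  elim: n => [|n IH]; first by rewrite expr0 mul1mx subrr mulmx0 big_ord0.
  rewrite big_ord_recr/= -IH -mulmxA -(subrK (A *m reduced n w) (reduced n.+1 w)).
  have -> : reduced n w = reduced (n.+1%:Z - 1) w by congr (reduced _ w); lia.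
  rewrite hw.
  have -> : n%:Z + 1 - q%:Z = n.+1%:Z - q%:Z by lia.
  set z := N *m _; set x := reduced (_ - 1) w.
  have -> : invmx A ^+ n *m x = invmx A ^+ n.+1 *m (A *m x).
    by rewrite exprSr -[_ * invmx A]/(_ *m _) -mulmxA mulKmx.
  have -> : invmx A ^+ n *m z = A *m (invmx A ^+ n.+1 *m z).
    by rewrite exprS -[invmx A * _]/(_ *m _) -mulmxA mulKVmx.
  by rewrite -mulmxDr addrAC -mulmxDr [A *m x + z]addrC.
exact: log_moment_of_cf hM dl0 hcf.
Qed.

Lemma iter_diff_tight j : normc l = 1 ->
  tight P (fun (nt : nat * int) w => iter_diff (l ^+ nt.1) nt.1 j (reduced ^~ w) nt.2).
Proof.
move=> l1; elim: j => [|j IH]; first exact: (tight_comp snd reduced_tight).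
apply: tightB => //.
apply: (tight_scale (a := fun nt : nat * int => l ^+ nt.1)).
  by move=> nt; rewrite normcX l1 expr1n.
exact: (tight_comp (fun nt : nat * int => (nt.1, nt.2 - nt.1%:Z)) IH).
Qed.

(** The powers of [A] are unbounded when [p > 1], so [A ^+ n *m reduced (- n)] is
    not controlled. After [p] differences with lag [n] this term disappears,
    [A ^+ n - l ^+ n] being nilpotent, and the partial sum of the [n] most recent
    noise vectors is still intact. *)
Lemma necessity_unit : (0 < p)%N -> normc l = 1 ->
  exists alpha : 'cV[C]_p, {ae P, forall w, N *m Z 0 w = alpha}.
Proof.
move=> p0 l1.
pose T n w := iter_diff (l ^+ n) n p (reduced ^~ w) 0.
have tT : tight P T by exact: (tight_comp (fun n : nat => (n, 0 : int)) (iter_diff_tight p l1)).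
pose zeta w t := N *m Z (t - q%:Z) w.
pose g (k : nat) : int := 0 - q%:Z - k%:Z.
have gi : injective g by move=> i j; rewrite /g; lia.
have [|n|dl dl0 hcf] := tight_sum_cf hZ (B := fun i => A ^+ i *m N)
    (tau := fun _ i => g i) (s := fun n => [seq g k | k <- iota n (p.-1 * n)]) tT.
- move=> n; rewrite -map_cat.
  have -> : iota 0 n ++ iota n (p.-1 * n) = iota 0 (n + p.-1 * n) by rewrite iotaD.
  by rewrite map_inj_uniq ?iota_uniq.
- exists (fun w => iter_diff_noise A (l ^+ n) n p (zeta w) 0 - partial_sum A n (zeta w) 0); split.
    have us : uniq [seq g k | k <- iota n (p.-1 * n)] by rewrite map_inj_uniq ?iota_uniq.
    have := @lin_comb_iter_diff_rest _ _ _ d p q Z A N (l ^+ n) n p.-1 _ 0 us.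
    rewrite (prednK p0); apply=> k nk.
    by apply: (map_f g); rewrite mem_iota.
  apply: filterS reduced_rec => w hw.
  rewrite /T (iter_diffE (l ^+ n) n (zeta := zeta w) hw).
  rewrite (lower_band_nilpotent (@lower_band_jordanX _ _ _ _)) mul0mx add0r addrC.
  rewrite (_ : \sum_(i < n) _ = partial_sum A n (zeta w) 0) ?subrK//.
  apply: eq_bigr => i _; rewrite /zeta mulmxA; congr (_ *m Z _ w); rewrite /g; lia.
exact: (unit_modulus_ae_cst hZ l1 dl0 hcf).
Qed.

Lemma arithmetic_progression (y : int -> C) a : (forall t, y t = y (t - 1) + a) ->
  forall n : nat, y 0 - y (- n%:Z) = a *+ n.
Proof.
move=> hy; elim=> [|n IH]; first by rewrite oppr0 subrr.
rewrite mulrS -IH (hy (- n%:Z)).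
have -> : - n.+1%:Z = - n%:Z - 1 by lia.
by rewrite opprD [RHS]addrCA [a + _]addrCA subrr addr0.
Qed.

(** Otherwise the first coordinate of the tight process [reduced] would drift
    linearly in time. *)
Lemma necessity_one alpha : l = 1 -> {ae P, forall w, N *m Z 0 w = alpha} ->
  first_coord_zero alpha.
Proof.
move=> l1 /(noise_const_ae hZ) hN i i0; apply: contrapT => /eqP ai0.
have na0 : 0 < normc (alpha i 0) by rewrite normc_gt0.
pose W n w := reduced 0 w - reduced (- n%:Z) w.
have tW : tight P W.
  apply: tightB; first exact: (tight_comp (fun=> 0) reduced_tight).
  exact: (tight_comp (fun n : nat => - n%:Z) reduced_tight).
have [mW /(_ (1 / 2) ltac:(lra))[K hK]] := tW.
have drift : {ae P, forall w, forall n, W n w i 0 = alpha i 0 *+ n}.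
  apply: filterS2 reduced_rec hN => w hw hNw.
  have coord (x : 'cV[C]_p) : (A *m x) i 0 = x i 0.
    rewrite mxE (bigD1 i)//= big1 ?addr0.
      by rewrite mxE l1 eqxx mulr1n i0 /= addr0 mul1r.
    by move=> j ji; rewrite mxE eq_sym (negPf ji) mulr0n i0 add0r mul0r.
  have step t : reduced t w i 0 = reduced (t - 1) w i 0 + alpha i 0.
    have := congr1 (fun v : 'cV[C]_p => v i 0) (hw t); rewrite hNw.
    move: (reduced t w) (reduced (t - 1) w) => x y.
    by rewrite mxE [X in _ + X]mxE coord => <-; rewrite addrC subrK.
  have WE n : W n w i 0 = reduced 0 w i 0 - reduced (- n%:Z) w i 0.
    by rewrite /W; move: (reduced 0 w) (reduced _ w) => x y; rewrite !mxE.
  by move=> n; rewrite WE -(arithmetic_progression step).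
pose n := (Num.truncn (K / normc (alpha i 0))).+1.
have Kn : K < normc (alpha i 0) * n%:R.
  by rewrite mulrC -ltr_pdivrMr// truncnS_gt.
have : (P setT <= (1 / 2)%:E)%E.
  apply: le_trans (hK n); apply: probability_le_ae => //.
    by apply: measurable_gt_set; exact: measurable_wnorm.
  apply: filterS drift => w /(_ n) hw _ /=.
  apply: lt_le_trans (wnorm1_entry (W n w) i); rewrite hw.
  rewrite -mulr_natr Normc.normcM -(rmorph_nat (real_complex R)) normc_real ger0_norm//.
by rewrite probability_setT lee_fin; lra.
Qed.

End necessity.

(** * Rotation-invariant random variables *)

Section circle.
Context {R : realType}.
Local Notation C := R[i].
Local Notation normc := Normc.normc.

Lemma lebesgue_measure_translation (x : R) (A : set R) : measurable A ->
  lebesgue_measure ((fun u => u + x) @^-1` A) = lebesgue_measure A.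
Proof.
move=> mA.
have mx : measurable_fun setT (fun u : measurableTypeR R => (u + x : measurableTypeR R)).
  by apply: measurable_funD => //; exact: measurable_cst.
rewrite -[LHS]/(pushforward lebesgue_measure (mfun_of mx) A).
apply/esym/lebesgue_measure_unique => //.
move=> _ [[a b]] _ <-.
rewrite -[RHS]/(lebesgue_measure ((fun u => u + x) @^-1` `]a, b]%classic)).
have -> : (fun u => u + x) @^-1` `]a, b]%classic = `]a - x, b - x]%classic.
  by apply/seteqP; split => u /=; rewrite !in_itv/= ltrBlDr lerBrDr.
rewrite !lebesgue_measure_itv/= !lte_fin ltrD2r.
by case: ifP => // _; rewrite -!EFinB; congr EFin; lra.
Qed.

(** Cut the translated interval at [1] and move the second piece back by the
    period. *)
Lemma lebesgue_measure_periodic (x : R) (A : set R) : measurable A ->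
  (forall u, A (u + 1) <-> A u) -> 0 <= x < 1 ->
  lebesgue_measure (((fun u => u + x) @^-1` A) `&` `[0, 1[%classic) =
  lebesgue_measure (A `&` `[0, 1[%classic).
Proof.
move=> mA hA /andP[x0 x1].
have mI i j : measurable (A `&` `[i, j[%classic) by exact: measurableI.
have -> : ((fun u => u + x) @^-1` A) `&` `[0, 1[%classic =
    (fun u => u + x) @^-1` (A `&` `[x, x + 1[%classic).
  apply/seteqP; split => u /=; rewrite !in_itv/= => -[Au /andP[u0 u1]]; split => //;
    by apply/andP; split; lra.
rewrite lebesgue_measure_translation//.
have -> : A `&` `[x, x + 1[%classic = (A `&` `[x, 1[%classic) `|` (A `&` `[1, x + 1[%classic).
  apply/seteqP; split => u /=; rewrite !in_itv/=.
    move=> [Au /andP[u0 u1]]; have [h|h] := ltP u 1; [left|right]; split => //.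
    by rewrite u0.
  by move=> [] [Au /andP[u0 u1]]; split => //; apply/andP; split; lra.
have -> : A `&` `[0, 1[%classic = (A `&` `[0, x[%classic) `|` (A `&` `[x, 1[%classic).
  apply/seteqP; split => u /=; rewrite !in_itv/=.
    move=> [Au /andP[u0 u1]]; have [h|h] := ltP u x; [left|right]; split => //.
    by rewrite u0.
  by move=> [] [Au /andP[u0 u1]]; split => //; apply/andP; split; lra.
have disj i j k : (A `&` `[i, j[%classic) `&` (A `&` `[j, k[%classic) = set0.
  by apply/seteqP; split => // u /=; rewrite !in_itv/= => -[[_ /andP[_ h]] [_ /andP[h' _]]]; lra.
have lU i j k : lebesgue_measure ((A `&` `[i, j[%classic) `|` (A `&` `[j, k[%classic)) =
    (lebesgue_measure (A `&` `[i, j[%classic) + lebesgue_measure (A `&` `[j, k[%classic))%E.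
  by apply: measureU; [exact: mI|exact: mI|exact: disj].
rewrite !lU addeC; congr (_ + _)%E.
rewrite -(lebesgue_measure_translation 1)//; congr lebesgue_measure.
apply/seteqP; split => u /=; rewrite !in_itv/= => -[/hA Au /andP[u0 u1]]; split => //;
  by apply/andP; split; lra.
Qed.

(** [exp (2 pi i u)], as a uniform [u] gives the uniform law on the unit
    circle. *)
Definition circle (u : R) : C := cos (pi *+ 2 * u) +i* sin (pi *+ 2 * u).

Lemma circleD u v : circle (u + v) = circle u * circle v.
Proof.
by rewrite /circle mulrDr cosD sinD; apply/eqP; rewrite eq_complex/= eqxx/= addrC mulrC [X in _ + X]mulrC.
Qed.

Lemma circle1 : circle 1 = 1.
Proof. by rewrite /circle mulr1 cos2pi sin2pi. Qed.

Lemma normc_circle u : normc (circle u) = 1.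
Proof. by rewrite /= cos2Dsin2 sqrtr1. Qed.

Lemma circle_surj (c : C) : normc c = 1 -> exists2 x, 0 <= x < 1 & c = circle x.
Proof.
case: c => a b /= hab.
have ab1 : a ^+ 2 + b ^+ 2 = 1.
  by rewrite -[LHS]sqr_sqrtr ?hab ?expr1n// addr_ge0 ?sqr_ge0.
have a1 : -1 <= a <= 1.
  rewrite -ler_norml -(@ler_pXn2r _ 2) ?nnegrE ?ler01// expr1n real_normK ?num_real//.
  by rewrite -ab1 lerDl sqr_ge0.
have pi0 : 0 < pi :> R by exact: pi_gt0.
have [/andP[c0 cpi] ca] := acos_def a1.
have sa : sin (acos a) = `|b|.
  by rewrite sin_acos// -sqrtr_sqr; congr Num.sqrt; lra.
have pi2p : 0 < pi *+ 2 :> R by rewrite mulr2n addr_gt0.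
have pi2 : pi *+ 2 != 0 :> R by rewrite gt_eqF.
have [b0|b0] := leP 0 b.
  exists (acos a / (pi *+ 2)).
    apply/andP; split; first by rewrite divr_ge0// ltW.
    by rewrite ltr_pdivrMr// mul1r mulr2n; lra.
  rewrite /circle mulrC divfK// ca sa ger0_norm//.
exists (1 - acos a / (pi *+ 2)).
  have ha : 0 < acos a.
    rewrite lt_neqAle c0 andbT; apply/eqP => h0; move: sa; rewrite -h0 sin0 => /esym/normr0P.
    by rewrite lt_eqF.
  apply/andP; split.
    by rewrite subr_ge0 ler_pdivrMr// mul1r mulr2n; lra.
  by rewrite ltrBlDr ltrDl divr_gt0.
rewrite /circle mulrBr mulr1 [_ * (_ / _)]mulrC divfK// addrC cosD2pi sinD2pi.
by rewrite cosN sinN ca sa ltr0_norm// opprK.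
Qed.

Lemma measurable_circle : measurable_fun setT circle.
Proof.
have mm : measurable_fun setT (fun u : R => pi *+ 2 * u).
  by apply: measurable_funM => //; exact: measurable_cst.
apply: measurable_fun_complexP.
  by apply: (measurableT_comp _ mm); apply: continuous_measurable_fun; exact: continuous_cos.
by apply: (measurableT_comp _ mm); apply: continuous_measurable_fun; exact: continuous_sin.
Qed.

Lemma measurable_mulc (c : C) : measurable_fun setT (fun z : C => c * z).
Proof. by apply: measurable_fun_complexM; [exact: measurable_cst|exact: measurable_id]. Qed.

Lemma circle_rotation_invariant {dO : measure_display} {Omega : measurableType dO}
    (P : probability Omega R) (U : Omega -> R) (c : C) (B : set C) :
  uniform01 P U -> normc c = 1 -> measurable B ->
  P ((fun w => c * circle (U w)) @^-1` B) = P ((fun w => circle (U w)) @^-1` B).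
Proof.
move=> [mU hU] /circle_surj[x x01 ->] mB.
pose A := circle @^-1` B.
have mA : measurable A by rewrite -[A]setTI; exact: measurable_circle.
have mAx : measurable ((fun u => u + x) @^-1` A).
  rewrite -[X in measurable X]setTI.
  have mx : measurable_fun setT (fun u : R => u + x).
    by apply: measurable_funD => //; exact: measurable_cst.
  exact: mx.
have -> : (fun w => circle x * circle (U w)) @^-1` B = U @^-1` ((fun u => u + x) @^-1` A).
  by apply/seteqP; split => w; rewrite /A/= addrC circleD.
rewrite hU// lebesgue_measure_periodic//; first by rewrite -hU.
by move=> u; rewrite /A/= circleD circle1 mulr1.
Qed.

End circle.

(** * Other solutions when an eigenvalue has modulus one *)

Section perturbation.
Context {R : realType} {dO : measure_display} {Omega : measurableType dO}.
Variable P : probability Omega R.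
Local Notation C := R[i].
Local Notation normc := Normc.normc.

Lemma normc_exprz (l : C) (s : int) : normc l = 1 -> normc (l ^ s) = 1.
Proof.
move=> l1; case: s => n; rewrite ?NegzE.
  by rewrite -exprnP normcX l1 expr1n.
by rewrite -exprnN Normc.normcV normcX l1 expr1n invr1.
Qed.

Section joint_law.
Context {dE : measure_display} {E : measurableType dE}.
Variable Z : int -> Omega -> E.
Hypothesis hZ : iid P Z.
Variable U : Omega -> R.
Hypothesis hU : uniform01 P U.
Hypothesis indU : forall (A : set R) (F : set Omega),
  measurable A -> generated_sigma_algebra Z F -> P (U @^-1` A `&` F) = (P (U @^-1` A) * P F)%E.
Variable l : C.
Hypothesis l1 : normc l = 1.

Definition path_and_phase (s : int) (w : Omega) : path_space * C :=
  (shifted_path Z s w, l ^ s * circle (U w)).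

Lemma measurable_phase s : measurable_fun setT (fun w => l ^ s * circle (U w)).
Proof.
have [mU _] := hU.
apply: (measurableT_comp (measurable_mulc _)); exact: (measurableT_comp measurable_circle mU).
Qed.

Lemma measurable_path_and_phase s : measurable_fun setT (path_and_phase s).
Proof.
by apply: measurable_fun_pair; [exact: measurable_shifted_path hZ s|exact: measurable_phase].
Qed.

Lemma shifted_path_generated s A : measurable A ->
  generated_sigma_algebra Z (shifted_path Z s @^-1` A).
Proof.
move=> mA; pose G := \bigcup_i preimage_set_system setT (Z i) measurable.
have mZ i : measurable_fun setT (Z (i + s) : g_sigma_algebraType G -> E).
  move=> _ B mB; apply: sub_sigma_algebra; exists (i + s) => //.
  by exists B.
have := measurable_path mZ measurableT mA; rewrite setTI; exact.
Qed.

(** The phase is independent of the path and its law is invariant under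
    rotations, the law of the path is invariant under shifts. *)
Lemma path_and_phase_law s A : measurable A ->
  P (path_and_phase s @^-1` A) = P (path_and_phase 0 @^-1` A).
Proof.
have [mU _] := hU.
apply: (@law_unique _ _ _ P _ _ [set A `*` B | A in @measurable _ (@path_space _ E) & B in @measurable _ C]).
- exact: measurable_prod_measurableType.
- move=> _ _ [A1 mA1 [B1 mB1 <-]] [A2 mA2 [B2 mB2 <-]].
  exists (A1 `&` A2); first exact: measurableI.
  exists (B1 `&` B2); first exact: measurableI.
  by rewrite setXI.
- by exists setT => //; exists setT => //; rewrite setXTT.
- exact: measurable_path_and_phase.
- exact: measurable_path_and_phase.
move=> _ [A1 mA1 [B1 mB1 <-]].
have e s' : P (path_and_phase s' @^-1` (A1 `*` B1)) =
    (P ((fun w => circle (U w)) @^-1` B1) * P (shifted_path Z 0 @^-1` A1))%E.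
  pose A' := (fun u => l ^ s' * circle u) @^-1` B1.
  have mA' : measurable A'.
    rewrite -[A']setTI; apply: (_ : measurable_fun setT (fun u => l ^ s' * circle u)) => //.
    exact: (measurableT_comp (measurable_mulc _) measurable_circle).
  rewrite (_ : _ @^-1` _ = U @^-1` A' `&` shifted_path Z s' @^-1` A1); last first.
    by apply/seteqP; split => w [].
  rewrite indU//; last exact: shifted_path_generated.
  rewrite (shifted_path_law hZ)//; congr (_ * _)%E.
  exact: (circle_rotation_invariant hU (normc_exprz _ l1) mB1).
by rewrite !e.
Qed.

End joint_law.

Variables (m d q H : nat) (Z : int -> Omega -> 'cV[C]_d).
Hypothesis hZ : iid P Z.
Variables (Psi1 : 'M[C]_m) (Theta : 'I_q.+1 -> 'M[C]_(m, d)) (S : 'M[C]_m).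
Variables (r : nat -> nat) (lambda : 'I_H -> C) (f : forall h : 'I_H, 'cV[C]_(bsize r h)).
Variables (l : C) (v : 'cV[C]_m) (U : Omega -> R).
Hypothesis l1 : normc l = 1.
Hypothesis hv : Psi1 *m v = l *: v.
Hypothesis hU : uniform01 P U.
Local Notation Y := (explicit_solution Theta Z S lambda f).

(** For an eigenvector [v] of [Psi1] with eigenvalue [l] the added process solves
    the homogeneous equation. *)
Definition perturbed_solution (t : int) (w : Omega) := Y t w + (l ^ t * circle (U w)) *: v.

Lemma perturbed_solution_is_solution :
  is_solution P Psi1 Theta Z Y -> is_solution P Psi1 Theta Z perturbed_solution.
Proof.
case=> mY hY; split=> t.
  apply: measurable_fun_mxD => //; apply: measurable_fun_scalemx.
    exact: measurable_phase.
  exact: measurable_cst.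
have l0 : l != 0 by rewrite -normc_gt0 l1.
apply: filterS (hY t) => w <-.
rewrite /perturbed_solution mulmxDr opprD addrACA -scalemxAr hv scalerA.
have -> : l ^ t = l ^ (t - 1) * l by rewrite -[X in _ * X]expr1z -expfzDr// subrK.
by rewrite mulrAC subrr addr0.
Qed.

Lemma perturbed_solution_stationary :
  (forall (A : set R) (F : set Omega),
    measurable A -> generated_sigma_algebra Z F -> P (U @^-1` A `&` F) = (P (U @^-1` A) * P F)%E) ->
  strictly_stationary P perturbed_solution.
Proof.
move=> indU; have l0 : l != 0 by rewrite -normc_gt0 l1.
apply: (@strictly_stationary_factor _ _ _ P _ _ _ (@path_space _ 'cV[C]_d * C)%type (path_and_phase Z U l)
  (fun t z => explicit_solution (Omega := path_space) Theta (@coord_process _ _) S lambda f t z.1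
     + (l ^ t * z.2) *: v)).
- exact: measurable_path_and_phase.
- exact: path_and_phase_law.
- move=> t; apply: measurable_fun_mxD.
    apply: (measurableT_comp _ measurable_fst).
    by apply: measurable_explicit_solution; exact: measurable_coord_process.
  apply: measurable_fun_scalemx; last exact: measurable_cst.
  exact: (measurableT_comp (measurable_mulc _) measurable_snd).
move=> t s w; rewrite /perturbed_solution explicit_solution_shift.
by rewrite expfzDr// mulrA.
Qed.

End perturbation.

(** * Existence and uniqueness of stationary solutions *)

Lemma jordan_eigenvector {R : realType} p (l : R[i]) : (0 < p)%N ->
  exists2 e : 'cV[R[i]]_p, e != 0 & jordan_block p l *m e = l *: e.
Proof.
case: p => // p _; exists (delta_mx ord_max 0).
  apply/eqP => /(congr1 (fun e : 'cV[R[i]]_p.+1 => e ord_max 0)).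
  by rewrite !mxE !eqxx => /eqP; rewrite oner_eq0.
apply/colP => i; rewrite mxE (bigD1 ord_max)//= big1 ?addr0; last first.
  by move=> j /negPf jm; rewrite !mxE jm mulr0.
rewrite !mxE !eqxx/= andbT mulr1 [i == p.+1 :> nat]ltn_eqF// addr0.
by rewrite mulr_natr.
Qed.

Section assembly.
Context {R : realType} {dO : measure_display} {Omega : measurableType dO}.
Variable P : probability Omega R.
Local Notation C := R[i].
Local Notation normc := Normc.normc.
Variable nrm : forall s : nat, 'cV[C]_s -> R.
Hypothesis hnrm : forall s, vector_norm (@nrm s).
Variables (m d q : nat) (Z : int -> Omega -> 'cV[C]_d).
Hypothesis hZ : iid P Z.
Variables (Psi1 : 'M[C]_m) (Theta : 'I_q.+1 -> 'M[C]_(m, d)) (S : 'M[C]_m).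
Hypothesis hS : S \in unitmx.
Variables (H : nat) (r : nat -> nat) (lambda : 'I_H -> C).
Hypothesis hr : is_block_partition m H r.
Hypothesis hJ : invmx S *m Psi1 *m S = jordan_form m r lambda.
Local Notation B h := (@block_sel R m r h).

Lemma stationary_tight (Y : int -> Omega -> 'cV[C]_m) : strictly_stationary P Y ->
  (forall t, measurable_fun setT (Y t)) -> tight P Y.
Proof.
by move=> sY mY; apply: (tight_identical (i0 := 0)) => // t A; exact: strictly_stationary_law.
Qed.

Lemma conditions_necessary (Y : int -> Omega -> 'cV[C]_m) :
  strictly_stationary P Y -> is_solution P Psi1 Theta Z Y ->
  [/\ cond_i P Theta Z S r lambda nrm, cond_ii P Theta Z S r lambda
    & cond_iii P Theta Z S r lambda].
Proof.
move=> sY [mY hY]; have tY := stationary_tight sY mY.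
pose X h t w := B h *m invmx S *m Y t w.
have tX h : tight P (X h) by exact: tight_mulmx_cst.
have hX (h : 'I_H) t : {ae P, forall w,
    X h t w - jordan_block (bsize r h) (lambda h) *m X h (t - 1) w =
    noise (block_theta Theta S r h) (Z ^~ w) t}.
  apply: filterS (hY t) => w hw.
  by rewrite noise_block; exact: (block_equation hS hr hJ h hw).
have unit (h : 'I_H) : `|lambda h| = 1 ->
    exists alpha, {ae P, forall w, block_noise_coef Theta S r lambda h *m Z 0 w = alpha}.
  move=> /eqP; rewrite normr_eq1 => /eqP l1.
  exact: (necessity_unit hZ (tX h) (hX h) (bsize_gt0 hr h) l1).
split=> h.
- rewrite normr_eq0 => l0; rewrite normr_eq1 => l1.
  have [l1'|l1'] := ltP (normc (lambda h)) 1.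
    by apply: (necessity_inner hZ (tX h) (hX h) (hnrm _)); rewrite normc_gt0 l0.
  by apply: (necessity_outer hZ (tX h) (hX h) (hnrm _)); rewrite lt_neqAle eq_sym l1.
- by move=> l1 _; exact: unit.
move=> l1; have [|alpha ha] := unit h; first by rewrite l1 normr1.
exists alpha; split => //.
exact: (necessity_one hZ (tX h) (hX h) l1 ha).
Qed.

Lemma solve_shift (h : 'I_H) (alpha : 'cV[C]_(bsize r h)) :
  (lambda h = 1 -> first_coord_zero alpha) ->
  exists f, (1%:M - Phi r lambda h) *m f = alpha.
Proof.
move=> ha; have [l1|l1] := eqVneq (lambda h) 1.
  by rewrite /Phi l1; apply: jordan1_solve; exact: ha.
exists (invmx (1%:M - Phi r lambda h) *m alpha); rewrite mulmxA mulmxV ?mul1mx//.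
by apply: unitmx_sub_jordan; rewrite eq_sym.
Qed.

Lemma noise_constants_exist : cond_ii P Theta Z S r lambda -> cond_iii P Theta Z S r lambda ->
  exists alpha f : (forall h : 'I_H, 'cV[C]_(bsize r h)),
    noise_constants P Theta Z S lambda alpha /\ solves_shift lambda alpha f.
Proof.
move=> h2 h3.
have ha (h : 'I_H) : exists alpha : 'cV[C]_(bsize r h), `|lambda h| = 1 ->
    block_noise_const P Theta Z S lambda alpha /\ (lambda h = 1 -> first_coord_zero alpha).
  have [l1|l1] := eqVneq (lambda h) 1.
    by have [alpha [a1 a2]] := h3 h l1; exists alpha.
  have [n1|n1] := pselect (`|lambda h| = 1); last by exists 0.
  have [alpha a1] := h2 h n1 (elimN eqP l1); exists alpha => _; split => // l1'.
  by rewrite l1' eqxx in l1.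
pose alpha h := sval (cid (ha h)); have halpha h := svalP (cid (ha h)).
have hf (h : 'I_H) : exists f, `|lambda h| = 1 -> (1%:M - Phi r lambda h) *m f = alpha h.
  have [n1|n1] := pselect (`|lambda h| = 1); last by exists 0.
  have [f hf] := solve_shift (halpha h n1).2; by exists f.
exists alpha, (fun h => sval (cid (hf h))); split=> h; first exact: halpha.
exact: (svalP (cid (hf h))).
Qed.

(** The difference of two stationary solutions is tight, even though it need not
    be stationary, and solves the homogeneous equation in every block. *)
Lemma solution_unique (Y Y' : int -> Omega -> 'cV[C]_m) :
  (forall h : 'I_H, `|lambda h| <> 1) ->
  strictly_stationary P Y -> is_solution P Psi1 Theta Z Y ->
  strictly_stationary P Y' -> is_solution P Psi1 Theta Z Y' ->
  forall t, {ae P, forall w, Y t w = Y' t w}.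
Proof.
move=> l1 sY [mY hY] sY' [mY' hY'] t.
have tD := tightB (stationary_tight sY mY) (stationary_tight sY' mY').
have hD (h : 'I_H) : {ae P, forall w, B h *m invmx S *m (Y t w - Y' t w) = 0}.
  apply: (homogeneous_block_eq0 (l := lambda h)
    (D := fun t w => B h *m invmx S *m (Y t w - Y' t w))) => [||s].
  - exact: tight_mulmx_cst.
  - by rewrite -normr_eq1; apply/eqP.
  apply: filterS2 (hY s) (hY' s) => w w1 w2.
  apply/eqP; rewrite -subr_eq0; apply/eqP.
  rewrite [LHS](block_equation hS hr hJ h (v := 0)) ?mulmx0//.
  by rewrite mulmxBr subr_interchange w1 w2 subrr.
have good : {ae P, forall w, forall h : 'I_H, B h *m invmx S *m (Y t w - Y' t w) = 0}.
  exact: filter_forall.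
apply: filterS good => w hw; apply/eqP; rewrite -subr_eq0; apply/eqP.
rewrite -[LHS](mulKVmx hS) -(stack_block hr (invmx S *m _)) /stack big1 ?mulmx0// => h _.
by rewrite [B h *m _]mulmxA hw mulmx0.
Qed.

(** Perturb the explicit solution along the eigenvector of the [h]-th block by a
    uniform phase independent of the noise. *)
Lemma solution_not_unique (f : forall h : 'I_H, 'cV[C]_(bsize r h)) (h : 'I_H) :
  rich_enough P Z -> `|lambda h| = 1 ->
  is_solution P Psi1 Theta Z (explicit_solution Theta Z S lambda f) ->
  exists Y, [/\ strictly_stationary P Y, is_solution P Psi1 Theta Z Y
    & forall w, Y 0 w != explicit_solution Theta Z S lambda f 0 w].
Proof.
move=> [U [hU indU]] /eqP; rewrite normr_eq1 => /eqP l1 sol.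
have [e e0 he] := jordan_eigenvector (lambda h) (bsize_gt0 hr h).
pose v := S *m ((B h)^T *m e).
have hv : Psi1 *m v = lambda h *: v.
  have -> : Psi1 = S *m jordan_form m r lambda *m invmx S.
    by rewrite -hJ -!mulmxA mulmxV// mulmx1 mulKVmx.
  rewrite /v -!mulmxA (mulmxA (invmx S) S) mulVmx// mul1mx scalemxAr; congr (S *m _).
  rewrite /jordan_form mulmx_suml (bigD1 h)//= big1 ?addr0.
    by rewrite -!mulmxA (mulmxA (B h)) (block_sel_tr hr) mul1mx he -scalemxAr.
  move=> h' h'h; rewrite -!mulmxA (mulmxA (B h')) (block_sel_tr_neq hr)//.
  by rewrite mul0mx !mulmx0.
have v0 : v != 0.
  apply: contra e0 => /eqP v0; apply/eqP.
  have : B h *m (invmx S *m v) = e by rewrite mulKmx// mulmxA (block_sel_tr hr) mul1mx.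
  by rewrite v0 !mulmx0.
exists (perturbed_solution Z Theta S lambda f (lambda h) v U); split.
- exact: perturbed_solution_stationary.
- exact: perturbed_solution_is_solution.
move=> w; rewrite -subr_eq0 /perturbed_solution addrC addrA addNr add0r.
rewrite scaler_eq0 negb_or v0 andbT -normc_gt0 Normc.normcM normc_exprz// normc_circle.
by rewrite mulr1 ltr01.
Qed.

End assembly.

Unset Implicit Arguments.
Set Strict Implicit.

Theorem theorem2p1
  (R : realType) (dO : measure_display) (Omega : measurableType dO)
  (P : probability Omega R)
  (nrm : forall s : nat, 'cV[R[i]]_s -> R)
  (hnrm : forall s : nat, vector_norm (nrm s))
  (m d q : nat) (hm : (0 < m)%N) (hd : (0 < d)%N)
  (Z : int -> Omega -> 'cV[R[i]]_d) (hZ : iid P Z)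
  (Psi1 : 'M[R[i]]_m) (Theta : 'I_q.+1 -> 'M[R[i]]_(m, d))
  (S : 'M[R[i]]_m) (hS : S \in unitmx)
  (H : nat) (r : nat -> nat) (lambda : 'I_H -> R[i])
  (hr : is_block_partition m H r)
  (hJ : invmx S *m Psi1 *m S = jordan_form m r lambda) :
  let conditions :=
    [/\ cond_i P Theta Z S r lambda nrm,
        cond_ii P Theta Z S r lambda
      & cond_iii P Theta Z S r lambda] in
  [/\ (exists Y : int -> Omega -> 'cV[R[i]]_m,
         strictly_stationary P Y /\ is_solution P Psi1 Theta Z Y)
      <-> conditions,
      conditions ->
        [/\ series_converge_absolutely P Theta Z S r lambda nrm,
            (forall h : 'I_H, `|lambda h| = 1 -> lambda h <> 1 ->
               1%:M - Phi r lambda h \in unitmx)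
          & forall alpha : (forall h : 'I_H, 'cV[R[i]]_(bsize r h)),
              noise_constants P Theta Z S lambda alpha ->
              (forall h : 'I_H, `|lambda h| = 1 ->
                 exists fh : 'cV[R[i]]_(bsize r h),
                   (1%:M - Phi r lambda h) *m fh = alpha h) /\
              (forall f : (forall h : 'I_H, 'cV[R[i]]_(bsize r h)),
                 solves_shift lambda alpha f ->
                 let Y := explicit_solution Theta Z S lambda f in
                 strictly_stationary P Y /\ is_solution P Psi1 Theta Z Y)]
    & conditions -> rich_enough P Z ->
        forall alpha f : (forall h : 'I_H, 'cV[R[i]]_(bsize r h)),
          noise_constants P Theta Z S lambda alpha ->
          solves_shift lambda alpha f ->
          (forall Y : int -> Omega -> 'cV[R[i]]_m,
             strictly_stationary P Y -> is_solution P Psi1 Theta Z Y ->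
             forall t : int, {ae P, forall w,
               Y t w = explicit_solution Theta Z S lambda f t w})
          <-> (forall h : 'I_H, `|lambda h| <> 1)].
Proof.
move=> conditions.
have sufficient : conditions -> forall alpha f : (forall h : 'I_H, 'cV[R[i]]_(bsize r h)),
    noise_constants P Theta Z S lambda alpha -> solves_shift lambda alpha f ->
    strictly_stationary P (explicit_solution Theta Z S lambda f) /\
    is_solution P Psi1 Theta Z (explicit_solution Theta Z S lambda f).
  move=> [c1 _ _] alpha f ha hf; split; first exact: explicit_solution_stationary.
  exact: (explicit_solution_is_solution hnrm hZ hS hr hJ ha hf c1).
split.
- split=> [[Y [sY hY]]|c]; first exact: (conditions_necessary hnrm hZ hS hr hJ sY hY).
  have [_ c2 c3] := c; have [alpha [f [ha hf]]] := noise_constants_exist c2 c3.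
  by exists (explicit_solution Theta Z S lambda f); exact: sufficient ha hf.
- move=> c; have [c1 c2 c3] := c; split.
  + have [alpha [f [ha hf]]] := noise_constants_exist c2 c3.
    exact: (explicit_series_converge_absolutely hnrm hZ ha hf c1).
  + move=> h _ l1; apply: unitmx_sub_jordan.
    by rewrite eq_sym; apply/eqP.
  move=> alpha ha; split=> [h l1|f hf Y].
    exact: solve_shift (ha h l1).2.
  exact: sufficient ha hf.
move=> c rich alpha f ha hf; have [sY hY] := sufficient c alpha f ha hf.
split=> [uniq h l1|l1 Y sY' hY' t].
  have [Y [sY' hY' neq]] := solution_not_unique hZ hS hr hJ rich l1 hY.
  have [N [mN PN hN]] := uniq Y sY' hY' 0.
  have NT : N = setT.
    by apply/seteqP; split => // w _; apply: hN => /= e; move: (neq w); rewrite e eqxx.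
  move: PN; rewrite NT probability_setT => /eqP.
  by rewrite onee_eq0.
exact: (solution_unique hS hr hJ l1 sY' hY' sY hY).
Qed.
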